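(* Let $\Gamma\rightrightarrows M$ be a second countable Hausdorff continuous groupoid with a continuous left Haar system $\nu=\{\nu^x\}_{x\in M}$ and a $\sigma$-finite quasi-invariant Radon measure $\mu$ on $M$, and suppose $\nu$ is source-compatible with $\mu$. Then the canonical quantum reference frame $\mathcal R_{\mathrm{can}}=(U^{\mathrm{can}},\mathsf E_{\mathcal R_{\mathrm{can}}},\mathscr H^{\mathrm{can}}_{\mathcal R})$ is a principal groupoid quantum reference frame for $\Gamma$. Moreover $\mathcal R_{\mathrm{can}}$ is sharp (hence ideal and localizable) and $\mu$-admissible. If in addition $\Gamma$ is a Lie groupoid then $\mathcal R_{\mathrm{can}}$ is Lie, and if $\Gamma$ is bisection-admissible then $\mathcal R_{\mathrm{can}}$ is bisection-admissible.
   Context: **Groupoids.** A continuous groupoid $\Gamma\rightrightarrows M$ has topological spaces $\Gamma$ (arrows), $M$ (objects), continuous source/target maps $s,t$, units $x\mapsto1_x$, inversion, and composition $\alpha\circ\beta$ defined when $s(\alpha)=t(\beta)$. $\Gamma^x:=t^{-1}(x)$; $L_\alpha:\Gamma^{s(\alpha)}\to\Gamma^{t(\alpha)}$, $L_\alpha\beta=\alpha\circ\beta$. A continuous left Haar system: positive Radon measures $\nu^x$ on $\Gamma^x$ with $\mathrm{supp}\,\nu^x=\Gamma^x$, depending continuously on $x$ ($x\mapsto\int f\,d\nu^x$ continuous for $f\in C_c(\Gamma)$), with $(L_\alpha)_*\nu^{s(\alpha)}=\nu^{t(\alpha)}$. $\mu$ quasi-invariant: $\lambda:=\int_M\nu^xd\mu(x)$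 is mutually absolutely continuous with its image under inversion. $\nu$ is source-compatible with $\mu$ if for $\mu$-a.e. $x$, $s_*\nu^x\ll\mu$, where $s_*\nu^x(N)=\nu^x(s^{-1}(N)\cap\Gamma^x)$. A Lie groupoid is a continuous groupoid with $\Gamma,M$ smooth manifolds, $s,t$ smooth surjective submersions, and smooth structure maps. A bisection of a Lie groupoid is a smooth section $b:M\to\Gamma$ of $s$ with $\varphi_b:=t\circ b\in\mathrm{Diff}(M)$; $(\Gamma,\nu,\mu)$ is bisection-admissible if it is Lie and $(\varphi_b)_*\mu$ and $\mu$ are mutually absolutely continuous for all bisections $b$. **Frames.** Hilbert spaces are complex separable. A principal groupoid quantum reference frame $\mathcal R=(U,\mathsf E_{\mathcal R},\mathscr H_{\mathcal R})$ for $\Gamma$: a continuous field $\mathscr H_{\mathcal R}=\bigsqcup_x\mathcal H^x_{\mathcal R}$ of separable Hilbert spaces over $M$; a unitary representation $U$ of $\Gamma$ (measurable assignment of unitaries $U_\alpha:\mathcal H_{\mathcal R}^{s(\alpha)}\to\mathcal H_{\mathcal R}^{t(\alpha)}$ with $U_{\alpha\circ\beta}=U_\alpha U_\beta$, $U_{1_x}=\mathbb 1$) that is fibre-wise ultraweakly continuous, i.e. $\alpha\mapsto\mathrm{Tr}[U_\alpha\chi_\alpha]$ is continuous for every field $\chi_\alpha\in\mathcal T(\mathcal H_{\mathcal R}^{t(\alpha)},\mathcal H_{\mathcal R}^{s(\alpha)})$ that is locally a trace-norm uniform limit of finite-rank fields $\sum_j|\xi^j_{s(\alpha)}\rangle\langle\eta^j_{t(\alpha)}|$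 with $\xi^j,\eta^j$ continuous sections; and a family of normalized POVMs $\mathsf E^x_{\mathcal R}:\mathrm{Bor}(\Gamma^x)\to\mathcal E(\mathcal H^x_{\mathcal R})$ (effects), measurable ($x\mapsto\mathsf E^x_{\mathcal R}(\Delta\cap\Gamma^x)$ is a measurable operator field for all $\Delta\in\mathrm{Bor}(\Gamma)$) and covariant: $U_\alpha\mathsf E^{s(\alpha)}_{\mathcal R}(\Delta)U_\alpha^\dagger=\mathsf E^{t(\alpha)}_{\mathcal R}(L_\alpha\Delta)$ for $\Delta\in\mathrm{Bor}(\Gamma^{s(\alpha)})$. ''Principal'' means the POVMs are defined on the target fibres of $\Gamma$ itself. $\mathcal R$ is: $\mu$-admissible if for $\mu$-a.e. $x$, $\mu(N)=0\Rightarrow\mathsf E^x_{\mathcal R}(s^{-1}(N)\cap\Gamma^x)=0$; sharp if each $\mathsf E^x_{\mathcal R}$ is projection-valued; ideal if principal and sharp; localizable if $\|\mathsf E^x_{\mathcal R}(\Delta)\|=1$ for every $x$ and $\Delta$ with $\mathsf E^x_{\mathcal R}(\Delta)\ne0$; Lie if $\Gamma$ is a Lie groupoid; bisection-admissible if $(\Gamma\rightrightarrows M,\nu,\mu)$ is Lie and bisection-admissible. **Canonical frame.** $\mathcal H^{x,\mathrm{can}}_{\mathcal R}:=L^2(\Gamma^x,\nu^x)$, $\mathscr H^{\mathrm{can}}_{\mathcal R}:=\bigsqcup_xL^2(\Gamma^x,\nu^x)$ with continuous structure generated by the restrictions $f|_{\Gamma^x}$, $f\in C_c(\Gamma)$;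 for $\alpha:x\to y$, $(U^{\mathrm{can}}_\alpha f)(\gamma):=f(\alpha^{-1}\circ\gamma)$, $\gamma\in\Gamma^y$; $\mathsf E^x_{\mathcal R_{\mathrm{can}}}(\Delta)f:=\mathbf 1_\Delta f$ for $\Delta\in\mathrm{Bor}(\Gamma^x)$.
   Formalization: The groupoid Γ is assumed in addition to be locally compact; without this the claim fails, e.g. for Γ = M = ℚ with only units and Dirac measures ν^x, where C_c(Γ) = {0} does not generate a continuous field. *)

(* Defs.v *)
From HB Require Import structures.
From mathcomp Require Import all_boot all_order all_algebra.
From mathcomp Require Import all_classical all_reals all_analysis.
From mathcomp Require Import measurable_realfun complex ring lra.

Set Implicit Arguments.
Unset Strict Implicit.
Unset Printing Implicit Defensive.

Import Order.TTheory GRing.Theory Num.Theory.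
Import numFieldNormedType.Exports.

Local Open Scope classical_set_scope.
Local Open Scope ring_scope.

(* Quotient of a left module by a submodule; MathComp only has quotients of   *)
(* rings by ideals.                                                           *)
Section LmodQuotient.
Variables (K : nzRingType) (V : lmodType K) (N : submodClosed V).

Lemma submod_oppP u : (- u \in N) = (u \in N).
Proof.
have H v : v \in N -> - v \in N by move=> Nv; rewrite -scaleN1r rpredZ.
by apply/idP/idP => /H //; rewrite opprK.
Qed.

Definition mod_rel (u v : V) : bool := u - v \in N.

Lemma mod_rel_refl : reflexive mod_rel.
Proof. by move=> u; rewrite /mod_rel subrr rpred0. Qed.

Lemma mod_rel_sym : symmetric mod_rel.
Proof. by move=> u v; rewrite /mod_rel -opprB submod_oppP. Qed.

Lemma mod_rel_trans : transitive mod_rel.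
Proof. by move=> v u w uv vw; rewrite /mod_rel -(subrKA v u) rpredD. Qed.

Canonical mod_equiv := EquivRel mod_rel mod_rel_refl mod_rel_sym mod_rel_trans.

Definition lmod_quot : Type := {eq_quot mod_equiv}%qT.
HB.instance Definition _ := EqQuotient.on lmod_quot.
HB.instance Definition _ := Choice.on lmod_quot.

Local Notation cl := (\pi_lmod_quot)%qT.

Definition quot_zero : lmod_quot := cl 0.
Definition quot_opp (a : lmod_quot) : lmod_quot := cl (- repr a).
Definition quot_add (a b : lmod_quot) : lmod_quot := cl (repr a + repr b).
Definition quot_scale (k : K) (a : lmod_quot) : lmod_quot := cl (k *: repr a).

Lemma quot_eqP (u v : V) : reflect (cl u = cl v) (u - v \in N).
Proof. by apply: (iffP idP) => [uv|/eqmodP//]; apply/eqmodP. Qed.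

Lemma quot_reprP (u : V) : repr (cl u) - u \in N.
Proof. by apply/quot_eqP; rewrite reprK. Qed.

Lemma quot_oppE u : quot_opp (cl u) = cl (- u).
Proof. by apply/quot_eqP; rewrite -opprD submod_oppP quot_reprP. Qed.

Lemma quot_addE u v : quot_add (cl u) (cl v) = cl (u + v).
Proof. by apply/quot_eqP; rewrite opprD addrACA rpredD ?quot_reprP. Qed.

Lemma quot_scaleE k u : quot_scale k (cl u) = cl (k *: u).
Proof. by apply/quot_eqP; rewrite -scalerBr rpredZ ?quot_reprP. Qed.

Lemma quot_addA : associative quot_add.
Proof.
elim/quotW=> a; elim/quotW=> b; elim/quotW=> c.
by rewrite (quot_addE b c) (quot_addE a b) !quot_addE addrA.
Qed.

Lemma quot_addC : commutative quot_add.
Proof. by elim/quotW=> a; elim/quotW=> b; rewrite !quot_addE addrC. Qed.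

Lemma quot_add0 : left_id quot_zero quot_add.
Proof. by elim/quotW=> a; rewrite quot_addE add0r. Qed.

Lemma quot_addN : left_inverse quot_zero quot_opp quot_add.
Proof. by elim/quotW=> a; rewrite quot_oppE quot_addE addNr. Qed.

HB.instance Definition _ :=
  GRing.isZmodule.Build lmod_quot quot_addA quot_addC quot_add0 quot_addN.

Lemma quot_scaleA a b v : quot_scale a (quot_scale b v) = quot_scale (a * b) v.
Proof. by elim/quotW: v => v; rewrite (quot_scaleE b) !quot_scaleE scalerA. Qed.

Lemma quot_scale1 : left_id 1 quot_scale.
Proof. by elim/quotW=> v; rewrite quot_scaleE scale1r. Qed.

Lemma quot_scaleDr : right_distributive quot_scale +%R.
Proof.
move=> k; elim/quotW=> u; elim/quotW=> v; rewrite -[_ + _]/(quot_add _ _).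
by rewrite -[RHS]/(quot_add _ _) (quot_addE u v) (quot_scaleE k u)
  (quot_scaleE k v) quot_scaleE quot_addE scalerDr.
Qed.

Lemma quot_scaleDl v : {morph quot_scale^~ v : a b / a + b}.
Proof.
move=> a b; elim/quotW: v => v; rewrite -[RHS]/(quot_add _ _) /=.
by rewrite (quot_scaleE a v) (quot_scaleE b v) quot_scaleE quot_addE scalerDl.
Qed.

HB.instance Definition _ := GRing.Zmodule_isLmodule.Build K lmod_quot
  quot_scaleA quot_scale1 quot_scaleDr quot_scaleDl.

End LmodQuotient.

Section ComplexIntegration.
Context d (T : measurableType d) (R : realType).
Variable mu : {measure set T -> \bar R}.

Definition csqnorm (z : R[i]) : R := complex.Re z ^+ 2 + complex.Im z ^+ 2.

Definition cmeasurable (f : T -> R[i]) : Prop :=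
  measurable_fun setT (fun x => complex.Re (f x)) /\
  measurable_fun setT (fun x => complex.Im (f x)).

Definition cintegral (f : T -> R[i]) : R[i] :=
  Complex (Rintegral mu setT (fun x => complex.Re (f x)))
          (Rintegral mu setT (fun x => complex.Im (f x))).

Definition square_integrable (f : T -> R[i]) : Prop :=
  cmeasurable f /\ (\int[mu]_x (csqnorm (f x))%:E < +oo)%E.

Definition L2fun : {pred T -> R[i]} := [pred f | `[< square_integrable f >]].

Lemma csqnorm_ge0 z : 0 <= csqnorm z.
Proof. by rewrite addr_ge0 // sqr_ge0. Qed.

Lemma csqnorm_le a z w :
  csqnorm (a * z + w) <= 2 * csqnorm a * csqnorm z + 2 * csqnorm w.
Proof.
case: a z w => [a b] [c e] [f g]; rewrite /csqnorm /=.
have := sqr_ge0 (a * c - b * e - f); have := sqr_ge0 (a * e + b * c - g).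
nra.
Qed.

Lemma cmeasurable_sqnorm f : cmeasurable f ->
  measurable_fun setT (fun x => csqnorm (f x)).
Proof. by move=> [mr mi]; apply: measurable_funD; exact: measurable_funX. Qed.

Lemma L2fun_submod_closed : submod_closed L2fun.
Proof.
split.
  apply/asboolP; split; first by split; exact: measurable_cst.
  by rewrite integral0_eq // => x _; rewrite /csqnorm /= expr0n /= addr0.
move=> a f g /asboolP[mf If] /asboolP[mg Ig]; apply/asboolP.
have mh : cmeasurable (a *: f + g).
  case: mf mg => mrf mif [mrg mig]; split.
  - rewrite (_ : (fun x => _) = fun x => complex.Re a * complex.Re (f x)
      - complex.Im a * complex.Im (f x) + complex.Re (g x)); last first.
      apply/funext => x; rewrite /= !fctE /=.
      by case: a (f x) (g x) => [? ?] [? ?] [? ?].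
    by apply: measurable_funD => //; apply: measurable_funB;
      apply: measurable_funM => //; exact: measurable_cst.
  - rewrite (_ : (fun x => _) = fun x => complex.Re a * complex.Im (f x)
      + complex.Im a * complex.Re (f x) + complex.Im (g x)); last first.
      apply/funext => x; rewrite /= !fctE /=.
      by case: a (f x) (g x) => [? ?] [? ?] [? ?].
    by apply: measurable_funD => //; apply: measurable_funD;
      apply: measurable_funM => //; exact: measurable_cst.
split => //.
pose F x := ((2 * csqnorm a)%:E * (csqnorm (f x))%:E
             + 2%:E * (csqnorm (g x))%:E)%E.
have c0 : (0 <= 2 * csqnorm a) by rewrite mulr_ge0 ?csqnorm_ge0.
have mE h : cmeasurable h -> measurable_fun setT (fun x => (csqnorm (h x))%:E).
  by move=> ?; apply/measurable_EFinP; exact: cmeasurable_sqnorm.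
have mf' := mE _ mf; have mg' := mE _ mg.
apply: (@le_lt_trans _ _ (\int[mu]_x F x)%E).
  apply: ge0_le_integral => //=.
  - by move=> x _; rewrite lee_fin csqnorm_ge0.
  - exact: mE.
  - by apply: emeasurable_funD; exact: measurable_funeM.
  - by move=> x _; rewrite /F -!EFinM -EFinD lee_fin; exact: csqnorm_le.
rewrite ge0_integralD //=; first last.
- exact: measurable_funeM.
- by move=> x _; rewrite -EFinM lee_fin mulr_ge0 ?csqnorm_ge0.
- exact: measurable_funeM.
- by move=> x _; rewrite -EFinM lee_fin mulr_ge0 ?csqnorm_ge0.
have If0 h : (0 <= \int[mu]_x (csqnorm (h x))%:E)%E.
  by apply: integral_ge0 => x _; rewrite lee_fin csqnorm_ge0.
rewrite !ge0_integralZl_EFin //=; try by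
  move=> x _; rewrite lee_fin csqnorm_ge0.
by rewrite lte_add_pinfty // lte_mul_pinfty.
Qed.

HB.instance Definition _ :=
  GRing.isSubmodClosed.Build _ _ L2fun L2fun_submod_closed.

Definition L2fun_type : Type := {f : T -> R[i] | f \in L2fun}.
HB.instance Definition _ := Choice.on L2fun_type.
HB.instance Definition _ := SubType.on L2fun_type.
HB.instance Definition _ := [SubChoice_isSubLmodule of L2fun_type by <:].

Definition L2null : {pred L2fun_type} :=
  [pred f | `[< {ae mu, forall x, val f x = 0} >]].

Lemma L2null_submod_closed : submod_closed L2null.
Proof.
split; first by apply/asboolP; apply: aeW => x.
move=> a f g /asboolP f0 /asboolP g0; apply/asboolP.
by apply: filterS2 f0 g0 => x fx gx; rewrite /= !fctE /= fx gx scaler0 addr0.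
Qed.

HB.instance Definition _ :=
  GRing.isSubmodClosed.Build _ _ L2null L2null_submod_closed.

Definition L2 : lmodType R[i] := lmod_quot L2null.

(* The class of [f]; it is 0 when [f] is not square-integrable. *)
Definition L2class (f : T -> R[i]) : L2 :=
  (\pi_(lmod_quot L2null) (insubd (0 : L2fun_type) f))%qT.

Definition L2repr (u : L2) : T -> R[i] :=
  val (repr (u : lmod_quot L2null) : L2fun_type).

End ComplexIntegration.

Section HilbertSpaces.
Variable R : realType.

(* The axioms are in [is_hilbert]; [dot] is linear in its second argument. *)
Record innerSpace := InnerSpace {
  carrier :> lmodType R[i];
  dot : carrier -> carrier -> R[i]
}.

Definition hnorm (H : innerSpace) (u : H) : R :=
  Num.sqrt (complex.Re (dot u u)).

Definition is_inner_product (H : innerSpace) : Prop :=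
  [/\ forall (a : R[i]) (u v w : H),
        dot u (a *: v + w) = a * dot u v + dot u w,
      forall u v : H, dot v u = conjc (dot u v),
      forall u : H, 0 <= dot u u &
      forall u : H, dot u u = 0 -> u = 0].

Definition is_complete (H : innerSpace) : Prop :=
  forall u_ : nat -> H,
    (forall e : R, 0 < e -> exists N, forall m n : nat,
       (N <= m)%N -> (N <= n)%N -> hnorm (u_ m - u_ n) < e) ->
  exists l : H, forall e : R, 0 < e -> exists N, forall n : nat,
    (N <= n)%N -> hnorm (u_ n - l) < e.

Definition is_separable (H : innerSpace) : Prop :=
  exists d_ : nat -> H, forall (u : H) (e : R), 0 < e ->
    exists n, hnorm (u - d_ n) < e.

Definition is_hilbert (H : innerSpace) : Prop :=
  is_inner_product H /\ is_complete H.

Definition bounded_op (H K : innerSpace) (A : H -> K) : Prop :=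
  (forall (a : R[i]) u v, A (a *: u + v) = a *: A u + A v) /\
  exists c : R, forall u, hnorm (A u) <= c * hnorm u.

Definition is_adjoint (H K : innerSpace) (A : H -> K) (B : K -> H) : Prop :=
  forall u v, dot v (A u) = dot (B v) u.

Definition opnorm (H K : innerSpace) (A : H -> K) : R :=
  sup [set hnorm (A u) | u in [set u | hnorm u <= 1]].

Definition positive_op (H : innerSpace) (A : H -> H) : Prop :=
  bounded_op A /\ forall u, 0 <= dot u (A u).

Definition effect (H : innerSpace) (A : H -> H) : Prop :=
  positive_op A /\ forall u, dot u (A u) <= dot u u.

Definition projection (H : innerSpace) (A : H -> H) : Prop :=
  [/\ bounded_op A, is_adjoint A A & forall u, A (A u) = A u].

Definition unitary (H K : innerSpace) (A : H -> K) : Prop :=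
  bounded_op A /\ exists B : K -> H,
    [/\ is_adjoint A B, cancel A B & cancel B A].

(* Zero vectors are allowed as padding, so that finite-dimensional spaces     *)
(* also have orthonormal bases indexed by [nat].                              *)
Definition orthonormal_basis (H : innerSpace) (e : nat -> H) : Prop :=
  [/\ forall m n, m != n -> dot (e m) (e n) = 0,
      forall n, e n = 0 \/ dot (e n) (e n) = 1 &
      forall u, (forall n, dot (e n) u = 0) -> u = 0].

Definition is_trace (H : innerSpace) (A : H -> H) (c : R[i]) : Prop :=
  forall e : nat -> H, orthonormal_basis e ->
    (fun n => \sum_(k < n) dot (e k) (A (e k)) : R[i]^o) @ \oo --> (c : R[i]^o).

(* [P] is the absolute value of [A], i.e. the positive square root of A^* A. *)
Definition is_abs (H K : innerSpace) (A : H -> K) (P : H -> H) : Prop :=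
  positive_op P /\ exists B : K -> H,
    is_adjoint A B /\ forall u, P (P u) = B (A u).

Definition is_trace_norm (H K : innerSpace) (A : H -> K) (c : R) : Prop :=
  exists P : H -> H, is_abs A P /\ is_trace P (real_complex R c).

Definition trace_class (H K : innerSpace) (A : H -> K) : Prop :=
  bounded_op A /\ exists c : R, is_trace_norm A c.

Definition L2space d (T : measurableType d)
    (mu : {measure set T -> \bar R}) : innerSpace :=
  @InnerSpace (L2 mu)
    (fun u v => cintegral mu (fun x => conjc (L2repr u x) * L2repr v x)).

End HilbertSpaces.

Section ContinuousFields.
Context (R : realType) (M : topologicalType).
Implicit Types H : M -> innerSpace R.

(* The axioms of a continuous field of Hilbert spaces (Dixmier), where [S] is *)
(* the space of continuous sections.                                          *)
Definition continuous_field H (S : set (forall x, H x)) : Prop :=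
  [/\ forall x, is_hilbert (H x),
      S (fun=> 0) /\ (forall (a : R[i]) xi eta, S xi -> S eta ->
        S (fun x => a *: xi x + eta x)),
      forall x (u : H x) (e : R), 0 < e ->
        exists2 xi, S xi & hnorm (u - xi x) < e,
      forall xi, S xi -> continuous (fun x => hnorm (xi x)) &
      forall zeta : (forall x, H x),
        (forall (x : M) (e : R), 0 < e -> exists2 xi, S xi &
           \forall y \near x, hnorm (zeta y - xi y) <= e) -> S zeta].

(* The continuous structure generated by a linear space [L] of sections which *)
(* is fibrewise dense and has continuous norm functions.                      *)
Definition generated_sections H (L : set (forall x, H x)) :
    set (forall x, H x) :=
  [set zeta | forall (x : M) (e : R), 0 < e -> exists2 xi, L xi &
     \forall y \near x, hnorm (zeta y - xi y) <= e].

End ContinuousFields.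

Definition borel (X : ptopologicalType) := g_sigma_algebraType (@open X).
HB.instance Definition _ (X : ptopologicalType) :=
  Measurable.on (borel X).

Section BorelMeasures.
Context (R : realType) (X : ptopologicalType).
Implicit Types m : {measure set (borel X) -> \bar R}.

Definition is_radon m : Prop :=
  [/\ forall K : set X, compact K -> (m K < +oo)%E,
      forall A : set (borel X), measurable A ->
        m A = ereal_inf [set m U | U in [set U : set X | open U /\ A `<=` U]] &
      forall U : set X, open U ->
        m U = ereal_sup
                [set m K | K in [set K : set X | compact K /\ K `<=` U]]].

Definition measure_support m : set X :=
  [set x | forall U : set X, open U -> U x -> (0 < m U)%E].

End BorelMeasures.

Definition Cc (R : realType) (X : topologicalType) : set (X -> R[i]) :=
  [set f | continuous (f : X -> R[i]^o) /\
           compact (closure [set x | f x != 0])].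

(* [comp a b] is a o b, which is meaningful only if [src a = tgt b]. *)
Record continuous_groupoid (Gam M : topologicalType) := ContinuousGroupoid {
  src : Gam -> M;
  tgt : Gam -> M;
  unit : M -> Gam;
  inv : Gam -> Gam;
  comp : Gam -> Gam -> Gam;
  src_unit : forall x, src (unit x) = x;
  tgt_unit : forall x, tgt (unit x) = x;
  src_comp : forall a b, src a = tgt b -> src (comp a b) = src b;
  tgt_comp : forall a b, src a = tgt b -> tgt (comp a b) = tgt a;
  compA : forall a b c, src a = tgt b -> src b = tgt c ->
    comp a (comp b c) = comp (comp a b) c;
  comp1l : forall a, comp (unit (tgt a)) a = a;
  comp1r : forall a, comp a (unit (src a)) = a;
  src_inv : forall a, src (inv a) = tgt a;
  tgt_inv : forall a, tgt (inv a) = src a;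
  comp_inv : forall a, comp a (inv a) = unit (tgt a);
  inv_comp : forall a, comp (inv a) a = unit (src a);
  src_continuous : continuous src;
  tgt_continuous : continuous tgt;
  unit_continuous : continuous unit;
  inv_continuous : continuous inv;
  comp_continuous : {within [set p : Gam * Gam | src p.1 = tgt p.2],
    continuous (fun p => comp p.1 p.2)}
}.

Section Arrows.
Context (Gam M : topologicalType) (G : continuous_groupoid Gam M).

Definition fibre (x : M) : Type := [set g | tgt G g = x].
HB.instance Definition _ x := Topological.on (fibre x).
HB.instance Definition _ x := isPointed.Build (fibre x)
  (exist _ (unit G x) (mem_set (tgt_unit G x))).

Definition arrow (x y : M) : Type := {a : Gam | src G a = x /\ tgt G a = y}.

Definition arrow_of (a : Gam) : arrow (src G a) (tgt G a) :=
  exist _ a (conj erefl erefl).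

Definition arrow_unit (x : M) : arrow x x :=
  exist _ (unit G x) (conj (src_unit G x) (tgt_unit G x)).

Lemma arrow_inv_subproof x y (a : arrow x y) :
  src G (inv G (sval a)) = y /\ tgt G (inv G (sval a)) = x.
Proof. by case: a => a [sa ta]; rewrite src_inv tgt_inv. Qed.

Definition arrow_inv x y (a : arrow x y) : arrow y x :=
  exist _ _ (arrow_inv_subproof a).

Lemma arrow_comp_subproof x y z (a : arrow y z) (b : arrow x y) :
  src G (comp G (sval a) (sval b)) = x /\
  tgt G (comp G (sval a) (sval b)) = z.
Proof.
case: a b => [a [sa ta]] [b [sb tb]] /=.
by have ab : src G a = tgt G b; rewrite ?src_comp ?tgt_comp // sa tb.
Qed.

Definition arrow_comp x y z (a : arrow y z) (b : arrow x y) : arrow x z :=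
  exist _ _ (arrow_comp_subproof a b).

Lemma ltrans_subproof x y (a : arrow x y) (g : fibre x) :
  comp G (sval a) (set_val g) \in [set h | tgt G h = y].
Proof.
case: a => a [sa ta]; have tg : tgt G (set_val g) = x := set_mem (valP g).
by apply/mem_set; rewrite /= tgt_comp ?sa ?tg.
Qed.

Definition ltrans x y (a : arrow x y) (g : fibre x) : fibre y :=
  exist _ (comp G (sval a) (set_val g)) (ltrans_subproof a g).

End Arrows.

Section MeasuredGroupoids.
Context (R : realType) (Gam M : ptopologicalType).
Variable G : continuous_groupoid Gam M.

Definition fibre_measures :=
  forall x : M, {measure set (borel (fibre G x)) -> \bar R}.

Variables (nu : fibre_measures) (mu : {measure set (borel M) -> \bar R}).

Definition haar_system : Prop :=
  [/\ forall x, is_radon (nu x),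
      forall x, measure_support (nu x) = setT,
      forall f : Gam -> R[i], Cc f -> continuous
        (fun x => cintegral (nu x) (fun g => f (set_val g)) : R[i]^o) &
      forall x y (a : arrow G x y) (A : set (borel (fibre G y))),
        measurable A -> pushforward (nu x)
          (ltrans a : borel (fibre G x) -> borel (fibre G y)) A = nu y A].

(* The measure lambda = \int nu^x d mu(x). *)
Definition integrated_measure (A : set (borel Gam)) : \bar R :=
  (\int[mu]_x nu x [set g | A (set_val g)])%E.

Definition quasi_invariant : Prop :=
  integrated_measure `<<
    pushforward integrated_measure (inv G : borel Gam -> borel Gam) /\
  pushforward integrated_measure (inv G : borel Gam -> borel Gam) `<<
    integrated_measure.

Definition source_compatible : Prop :=
  {ae mu, forall x : borel M,
    pushforward (nu x)
      ((fun g => src G (set_val g)) : borel (fibre G x) -> borel M) `<< mu}.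

End MeasuredGroupoids.

(* The data of a frame whose POVMs live on the target fibres of the groupoid; *)
(* the axioms are in [principal_frame].                                       *)
Record frame (R : realType) (Gam M : topologicalType)
    (G : continuous_groupoid Gam M) := Frame {
  fib : M -> innerSpace R;
  sections : set (forall x, fib x);
  rep : forall x y, arrow G x y -> fib x -> fib y;
  povm : forall x, set (borel (fibre G x)) -> fib x -> fib x
}.

Arguments fib {R Gam M G} f x.
Arguments sections {R Gam M G} f.
Arguments rep {R Gam M G} f {x y} a _.
Arguments povm {R Gam M G} f {x} D _.

Section Frames.
Context (R : realType) (Gam M : ptopologicalType).
Variable G : continuous_groupoid Gam M.
Variable F : frame R G.

Definition unitary_representation : Prop :=
  [/\ forall x y (a : arrow G x y), unitary (rep F a),
      forall x y z (a : arrow G y z) (b : arrow G x y),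
        rep F (arrow_comp a b) = rep F a \o rep F b,
      forall x, rep F (arrow_unit G x) = id &
      forall xi eta, sections F xi -> sections F eta ->
        cmeasurable (fun a : borel Gam =>
          dot (xi (tgt G a)) (rep F (arrow_of G a) (eta (src G a))))].

(* \sum_j |xi^j_(s a)> <eta^j_(t a)| *)
Definition finite_rank_field n (xi eta : 'I_n -> forall x, fib F x) (a : Gam)
    (u : fib F (tgt G a)) : fib F (src G a) :=
  \sum_(j < n) dot (eta j (tgt G a)) u *: xi j (src G a).

Definition uw_test_field
    (chi : forall a : Gam, fib F (tgt G a) -> fib F (src G a)) : Prop :=
  (forall a, trace_class (chi a)) /\
  forall a0 : Gam, exists2 V : set Gam, nbhs a0 V &
    forall e : R, 0 < e -> exists n (xi eta : 'I_n -> forall x, fib F x),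
      (forall j, sections F (xi j) /\ sections F (eta j)) /\
      forall a, V a -> exists2 c : R, c <= e &
        is_trace_norm (fun u => chi a u - finite_rank_field xi eta u) c.

Definition uw_continuous : Prop :=
  forall chi, uw_test_field chi ->
    exists2 tau : Gam -> R[i],
      forall a, is_trace (fun u => rep F (arrow_of G a) (chi a u)) (tau a) &
      continuous (tau : Gam -> R[i]^o).

Definition normalized_povm x : Prop :=
  [/\ forall D, measurable D -> effect (povm F (x := x) D),
      povm F (x := x) setT = id &
      forall D : nat -> set (borel (fibre G x)),
        (forall n, measurable (D n)) -> trivIset setT D ->
        forall u v, (fun n => \sum_(k < n) dot u (povm F (D k) v) : R[i]^o)
          @ \oo --> (dot u (povm F (\bigcup_n D n) v) : R[i]^o)].

Definition measurable_povm : Prop :=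
  forall D : set (borel Gam), measurable D ->
  forall xi eta, sections F xi -> sections F eta ->
    cmeasurable (fun x : borel M =>
      dot (xi x) (povm F [set g : borel (fibre G x) | D (set_val g)] (eta x))).

Definition covariant_povm : Prop :=
  forall x y (a : arrow G x y), exists2 Ud, is_adjoint (rep F a) Ud &
    forall D : set (borel (fibre G x)), measurable D ->
      rep F a \o povm F D \o Ud = povm F (ltrans a @` D).

Definition principal_frame : Prop :=
  [/\ continuous_field (sections F) /\ (forall x, is_separable (fib F x)),
      unitary_representation, uw_continuous,
      forall x, normalized_povm x &
      measurable_povm /\ covariant_povm].

Definition mu_admissible (mu : {measure set (borel M) -> \bar R}) : Prop :=
  {ae mu, forall x : borel M, forall N : set (borel M),
    measurable N -> mu N = 0 ->
    povm F [set g : borel (fibre G x) | N (src G (set_val g))] = fun=> 0}.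

Definition sharp : Prop :=
  forall x (D : set (borel (fibre G x))), measurable D ->
    projection (povm F D).

Definition ideal_frame : Prop := principal_frame /\ sharp.

Definition localizable : Prop :=
  forall x (D : set (borel (fibre G x))), measurable D ->
    povm F D <> (fun=> 0) -> opnorm (povm F D) = 1.

End Frames.

Section SmoothManifolds.
Variable R : realType.

Fixpoint Ck_on n (k : nat) (U : set 'rV[R]_n) (f : 'rV[R]_n -> R) : Prop :=
  (forall p, U p -> {for p, continuous f}) /\
  if k is k'.+1 then
    forall j : 'I_n, (forall p, U p -> derivable f p (delta_mx 0 j)) /\
      Ck_on k' U (fun p => 'D_(delta_mx 0 j) f p)
  else True.

Definition smooth_on n m (U : set 'rV[R]_n) (f : 'rV[R]_n -> 'rV[R]_m) :=
  forall (k : nat) (i : 'I_m), Ck_on k U (fun p => f p 0 i).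

(* [cinv] is meaningful only on the image of [cdom]. *)
Record chart (X : topologicalType) (n : nat) := Chart {
  cdom : set X;
  cmap : X -> 'rV[R]_n;
  cinv : 'rV[R]_n -> X
}.

Definition is_chart X n (c : chart X n) : Prop :=
  [/\ open (cdom c), open (cmap c @` cdom c),
      forall p, cdom c p -> cinv c (cmap c p) = p,
      forall p, cdom c p -> {for p, continuous (cmap c)} &
      forall v, (cmap c @` cdom c) v -> {for v, continuous (cinv c)}].

Definition smooth_manifold X n (A : set (chart X n)) : Prop :=
  [/\ hausdorff_space X, @second_countable X,
      forall c, A c -> is_chart c,
      forall p, exists2 c, A c & cdom c p &
      forall c d, A c -> A d ->
        smooth_on (cmap c @` (cdom c `&` cdom d)) (cmap d \o cinv c)].

Definition smooth_map_on X n Y m (A : set (chart X n)) (B : set (chart Y m))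
    (W : set X) (f : X -> Y) : Prop :=
  [/\ open W, forall p, W p -> {for p, continuous f} &
      forall c d, A c -> B d ->
        smooth_on (cmap c @` (W `&` cdom c `&` f @^-1` cdom d))
                  (cmap d \o f \o cinv c)].

Definition smooth_map X n Y m (A : set (chart X n)) (B : set (chart Y m))
    (f : X -> Y) : Prop := smooth_map_on A B setT f.

Definition submersion X n Y m (A : set (chart X n)) (B : set (chart Y m))
    (f : X -> Y) : Prop :=
  smooth_map A B f /\
  forall c d p, A c -> B d -> cdom c p -> cdom d (f p) ->
    \rank ('J (cmap d \o f \o cinv c) (cmap c p)) = m.

Definition diffeomorphism X n (A : set (chart X n)) (f : X -> X) : Prop :=
  smooth_map A A f /\
  exists g : X -> X, [/\ smooth_map A A g, cancel f g & cancel g f].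

Definition prod_chart X n Y m (c : chart X n) (d : chart Y m) :
    chart (X * Y)%type (n + m) :=
  Chart (cdom c `*` cdom d)
    (fun p => row_mx (cmap c p.1) (cmap d p.2))
    (fun v => (cinv c (lsubmx v), cinv d (rsubmx v))).

Definition prod_atlas X n Y m (A : set (chart X n)) (B : set (chart Y m)) :
    set (chart (X * Y)%type (n + m)) :=
  [set e | exists c d, [/\ A c, B d & e = prod_chart c d]].

(* Smoothness on an arbitrary subset means local smooth extendability; on an  *)
(* embedded submanifold such as the set of composable pairs this is           *)
(* smoothness for the submanifold structure.                                  *)
Definition smooth_on_subset X n Y m (A : set (chart X n)) (B : set (chart Y m))
    (S : set X) (f : X -> Y) : Prop :=
  forall p, S p -> exists (W : set X) (h : X -> Y),
    [/\ W p, smooth_map_on A B W h & forall q, W q -> S q -> h q = f q].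

End SmoothManifolds.

Section LieGroupoids.
Context (R : realType) (Gam M : ptopologicalType).
Variable G : continuous_groupoid Gam M.
Context (nG nM : nat) (AG : set (chart R Gam nG)) (AM : set (chart R M nM)).

Definition lie_groupoid : Prop :=
  [/\ smooth_manifold AG /\ smooth_manifold AM,
      submersion AG AM (src G) /\ range (src G) = setT,
      submersion AG AM (tgt G) /\ range (tgt G) = setT,
      smooth_map AM AG (unit G) /\ smooth_map AG AG (inv G) &
      smooth_on_subset (prod_atlas AG AG) AG
        [set p : Gam * Gam | src G p.1 = tgt G p.2]
        (fun p => comp G p.1 p.2)].

Definition bisection (b : M -> Gam) : Prop :=
  [/\ smooth_map AM AG b, cancel b (src G) &
      diffeomorphism AM (tgt G \o b)].

Definition bisection_admissible (mu : {measure set (borel M) -> \bar R}) :=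
  lie_groupoid /\
  forall b, bisection b ->
    pushforward mu (tgt G \o b : borel M -> borel M) `<< mu /\
    mu `<< pushforward mu (tgt G \o b : borel M -> borel M).

Definition lie_frame (F : frame R G) : Prop := lie_groupoid.

Definition bisection_admissible_frame (F : frame R G)
    (mu : {measure set (borel M) -> \bar R}) : Prop :=
  bisection_admissible mu.

End LieGroupoids.

Section CanonicalFrame.
Context (R : realType) (Gam M : ptopologicalType).
Variable G : continuous_groupoid Gam M.
Variable nu : fibre_measures R G.

Definition can_fib (x : M) : innerSpace R := L2space (nu x).

Definition can_section (f : Gam -> R[i]) (x : M) : can_fib x :=
  L2class (nu x) (fun g => f (set_val g)).

Definition can_sections : set (forall x, can_fib x) :=
  generated_sections [set can_section f | f in @Cc R Gam].

Definition can_rep x y (a : arrow G x y) (u : can_fib x) : can_fib y :=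
  L2class (nu y) (fun g => L2repr u (ltrans (arrow_inv a) g)).

Definition can_povm x (D : set (borel (fibre G x))) (u : can_fib x) :
    can_fib x :=
  L2class (nu x) (fun g => \1_D g * L2repr u g).

Definition canonical_frame : frame R G :=
  Frame can_sections can_rep can_povm.

End CanonicalFrame.

(* Main.v *)
(* The Hilbert-space part of the statement reduces to two facts about functions *)
(* f, h in C_c(Gam): the coefficient                                            *)
(*     a |-> \int conj(f(g)) h(a^-1 g) d nu^(t a)(g)                            *)
(* is continuous, and x |-> \int_D f d nu^x is Borel for every Borel set D.     *)
(* For the first one freezes a = a0 in h(a^-1 g): on the compact slice of       *)
(* supp f over t(a0) the function g |-> h(a0^-1 g) extends by Tietze to a       *)
(* continuous H on Gam, compactness makes h(a^-1 g) - H(g) uniformly small for  *)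
(* a near a0, and \int conj(f) H d nu^x is continuous by the Haar property.     *)
(* For the second, open sets D are handled by Urysohn functions increasing to   *)
(* the indicator of D, and general D by Dynkin's lemma. Both facts pass to all  *)
(* sections of the field because these are locally uniform limits of C_c ones.  *)
(*                                                                              *)
(* Ultraweak continuity does not need the spectral theorem: if P is an absolute *)
(* value of A with finite trace, Gram-Schmidt for the (degenerate) form         *)
(* <u, P v> yields A = \sum_j |A f_j><P f_j| with \sum_j |A f_j| |P f_j| at     *)
(* most the trace norm, so that Tr(U A) exists and is bounded by that norm;     *)
(* hence a |-> Tr(U_a chi_a) is locally a uniform limit of finite sums of       *)
(* coefficients.                                                                *)

Require Import Defs.
From HB Require Import structures.
From mathcomp Require Import all_boot all_order all_algebra.
From mathcomp Require Import all_classical all_reals all_analysis.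
From mathcomp Require Import measurable_realfun complex ring lra.
Set Implicit Arguments.
Unset Strict Implicit.
Unset Printing Implicit Defensive.
Import Order.TTheory GRing.Theory Num.Theory.
Import numFieldNormedType.Exports.
Local Open Scope classical_set_scope.
Local Open Scope ring_scope.

(** The algebraic half of the statement is left translation on [L2] of the fibres. By invariance of
    the Haar system, [can_rep] is a change of variables, so translation by the inverse arrow is both
    its adjoint and its inverse. A map that has an adjoint is linear ([adjoint_linear]), and
    unitarity and the representation laws follow. The POVM is multiplication by indicators: each
    value is a self-adjoint idempotent ([can_povm_projection]), which gives effects, sharpness and
    norm one for nonzero values. Countable additivity is dominated convergence, and covariance is
    the identity 1_{aD}(g) = 1_D(a^-1 g). Source-compatibility makes s^-1(N) a null set of almost
    every nu^x when N is mu-null, whence [can_mu_admissible].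

    The fibres are complete by Riesz-Fischer ([L2_complete]). Density of C_c functions in them comes
    from Radon regularity and Urysohn functions, packaged as [closed_subspace_full]: a closed
    subspace of L2 containing the square-integrable members of a family that separates compact sets
    from complements of open neighbourhoods is the whole space. The same lemma, applied to the
    closure of the rational combinations of a countable Urysohn family, gives separability.

    The analytic core consists of [can_coefficient_continuous], [can_uw_continuous] and
    [can_measurable_povm]. The Lie and bisection clauses are conditions on the groupoid and on mu,
    so the canonical frame inherits them by definition. *)

Local Notation Re := complex.Re.
Local Notation Im := complex.Im.
Import Normc.

(** * Complex numbers and sesquilinear forms *)

Section ComplexNumbers.
Variable R : realType.
Implicit Types z w : R[i].

Lemma ReD z w : Re (z + w) = Re z + Re w. Proof. by case: z w => ? ? [? ?]. Qed.
Lemma ImD z w : Im (z + w) = Im z + Im w. Proof. by case: z w => ? ? [? ?]. Qed.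
Lemma ReN z : Re (- z) = - Re z. Proof. by case: z. Qed.
Lemma ImN z : Im (- z) = - Im z. Proof. by case: z. Qed.
Lemma ReM z w : Re (z * w) = Re z * Re w - Im z * Im w.
Proof. by case: z w => ? ? [? ?]. Qed.
Lemma ImM z w : Im (z * w) = Re z * Im w + Im z * Re w.
Proof. by case: z w => ? ? [? ?]. Qed.
Lemma Re_conj z : Re (conjc z) = Re z. Proof. by case: z. Qed.
Lemma Im_conj z : Im (conjc z) = - Im z. Proof. by case: z. Qed.

Definition ReImE := (ReD, ImD, ReN, ImN, ReM, ImM, Re_conj, Im_conj).

Lemma eqC z w : Re z = Re w -> Im z = Im w -> z = w.
Proof. by case: z w => ? ? [? ?] /= -> ->. Qed.

Lemma normc_ge0 z : 0 <= normc z.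
Proof. by case: z => a b; exact: sqrtr_ge0. Qed.

Lemma sqr_normcE z : normc z ^+ 2 = csqnorm z.
Proof. by case: z => a b; rewrite /csqnorm /= sqr_sqrtr // addr_ge0 // sqr_ge0. Qed.

Lemma normc_sqrt z : normc z = Num.sqrt (csqnorm z).
Proof. by case: z. Qed.

Lemma conjM_csqnorm z : conjc z * z = (csqnorm z)%:C%C.
Proof. by apply: eqC; rewrite !ReImE /csqnorm /=; ring. Qed.

Lemma csqnormM z w : csqnorm (z * w) = csqnorm z * csqnorm w.
Proof. by rewrite /csqnorm !ReImE; ring. Qed.

Lemma csqnorm_conj z : csqnorm (conjc z) = csqnorm z.
Proof. by rewrite /csqnorm !ReImE; ring. Qed.

Lemma normc_conj z : normc (conjc z) = normc z.
Proof. by rewrite !normc_sqrt csqnorm_conj. Qed.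

Lemma normc_real (r : R) : 0 <= r -> normc r%:C%C = r.
Proof. by move=> r0; rewrite /= expr0n /= addr0 sqrtr_sqr ger0_norm. Qed.

Lemma ler_normRe z : `|Re z| <= normc z.
Proof.
case: z => a b /=; rewrite -sqrtr_sqr ler_wsqrtr // lerDl; exact: sqr_ge0.
Qed.

Lemma ler_normIm z : `|Im z| <= normc z.
Proof.
case: z => a b /=; rewrite -sqrtr_sqr ler_wsqrtr // lerDr; exact: sqr_ge0.
Qed.

Lemma normc_leD z : normc z <= `|Re z| + `|Im z|.
Proof.
rewrite -(@ler_pXn2r _ 2) ?nnegrE ?addr_ge0 ?normc_ge0 // sqr_normcE /csqnorm.
rewrite -(real_normK (num_real (Re z))) -(real_normK (num_real (Im z))).
by have := normr_ge0 (Re z); have := normr_ge0 (Im z); nra.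
Qed.

Lemma normc_sum (I : Type) (r : seq I) (P : pred I) (F : I -> R[i]) :
  normc (\sum_(i <- r | P i) F i) <= \sum_(i <- r | P i) normc (F i).
Proof.
elim/big_ind2 : _ => //; first by rewrite normc0.
by move=> x a y b xa yb; rewrite (le_trans (le_normcD _ _)) // lerD.
Qed.

Lemma Re_sum (I : Type) (r : seq I) (P : pred I) (F : I -> R[i]) :
  Re (\sum_(i <- r | P i) F i) = \sum_(i <- r | P i) Re (F i).
Proof. by elim/big_rec2 : _ => // i y x _ <-; rewrite ReD. Qed.

Lemma normC_normc z : `|z| = (normc z)%:C%C.
Proof. by rewrite normc_def normc_sqrt. Qed.

Section Convergence.
Context (T : Type) (F : set_system T) {FF : Filter F}.
Variables (f : T -> R[i]) (l : R[i]).

Lemma cvg_complexP :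
  f @ F --> (l : R[i]^o) <->
  forall e : R, 0 < e -> \forall t \near F, normc (l - f t) < e.
Proof.
split=> [/(@cvgrPdist_lt _ R[i]^o) fl e e0|fl].
  have ec0 : 0 < e%:C%C :> R[i] by rewrite ltcR.
  by apply: filterS (fl _ ec0) => t; rewrite normC_normc ltcR.
apply/(@cvgrPdist_lt _ R[i]^o) => -[e e'] /=.
(* The order of [R[i]] compares only numbers with equal imaginary parts, so a positive radius is
   real. *)
rewrite ltcE /= => /andP[/eqP -> e0].
by apply: filterS (fl _ e0) => t; rewrite normC_normc ltcR.
Qed.

Lemma cvg_ReImP :
  f @ F --> (l : R[i]^o) <->
  (fun t => Re (f t)) @ F --> Re l /\ (fun t => Im (f t)) @ F --> Im l.
Proof.
split=> [/cvg_complexP fl|[fr fi]].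
  split; apply/cvgrPdist_lt => e e0; apply: filterS (fl _ e0) => t.
    by apply: le_lt_trans; rewrite -ReN -ReD ler_normRe.
  by apply: le_lt_trans; rewrite -ImN -ImD ler_normIm.
apply/cvg_complexP => e e0; have e20 : 0 < e / 2 by rewrite divr_gt0.
move/cvgrPdist_lt : fr => /(_ _ e20) fr; move/cvgrPdist_lt : fi => /(_ _ e20) fi.
apply: filterS2 fr fi => t fr fi.
by rewrite (le_lt_trans (normc_leD _)) // !ReImE (splitr e) ltrD.
Qed.

Lemma cvg_csqnorm : f @ F --> (l : R[i]^o) ->
  (fun t => csqnorm (f t)) @ F --> csqnorm l.
Proof.
move=> /cvg_ReImP[l1 l2]; apply: cvgD; rewrite expr2;
  under eq_fun do rewrite expr2; exact: cvgM.
Qed.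

End Convergence.

Lemma cvg_complexD (T : Type) (F : set_system T) {FF : Filter F}
    (f g : T -> R[i]) (l m : R[i]) :
  f @ F --> (l : R[i]^o) -> g @ F --> (m : R[i]^o) ->
  (fun t => f t + g t) @ F --> ((l + m : R[i]) : R[i]^o).
Proof.
move=> /cvg_ReImP[fl1 fl2] /cvg_ReImP[gm1 gm2].
apply/(cvg_ReImP (fun t => f t + g t)); split.
  by rewrite ReD; under eq_fun do rewrite ReD; exact: cvgD.
by rewrite ImD; under eq_fun do rewrite ImD; exact: cvgD.
Qed.

Lemma cvg_complexN (T : Type) (F : set_system T) {FF : Filter F}
    (f : T -> R[i]) (l : R[i]) :
  f @ F --> (l : R[i]^o) -> (fun t => - f t) @ F --> ((- l : R[i]) : R[i]^o).
Proof.
move=> /cvg_ReImP[fl1 fl2]; apply/(cvg_ReImP (fun t => - f t)); split.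
  by rewrite ReN; under eq_fun do rewrite ReN; exact: cvgN.
by rewrite ImN; under eq_fun do rewrite ImN; exact: cvgN.
Qed.

Lemma cvg_complexB (T : Type) (F : set_system T) {FF : Filter F}
    (f g : T -> R[i]) (l m : R[i]) :
  f @ F --> (l : R[i]^o) -> g @ F --> (m : R[i]^o) ->
  (fun t => f t - g t) @ F --> ((l - m : R[i]) : R[i]^o).
Proof. move=> fl gm; exact: (cvg_complexD fl (cvg_complexN gm)). Qed.

Lemma cvg_complexM (T : Type) (F : set_system T) {FF : Filter F}
    (f g : T -> R[i]) (l m : R[i]) :
  f @ F --> (l : R[i]^o) -> g @ F --> (m : R[i]^o) ->
  (fun t => f t * g t) @ F --> ((l * m : R[i]) : R[i]^o).
Proof.
move=> /cvg_ReImP[fl1 fl2] /cvg_ReImP[gm1 gm2].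
apply/(cvg_ReImP (fun t => f t * g t)); split.
  rewrite ReM; under eq_fun do rewrite ReM.
  by apply: cvgB; exact: cvgM.
rewrite ImM; under eq_fun do rewrite ImM.
by apply: cvgD; exact: cvgM.
Qed.

Lemma cvg_complex_conj (T : Type) (F : set_system T) {FF : Filter F}
    (f : T -> R[i]) (l : R[i]) :
  f @ F --> (l : R[i]^o) -> (fun t => conjc (f t)) @ F --> ((conjc l : R[i]) : R[i]^o).
Proof.
move=> /cvg_ReImP[fl1 fl2]; apply/(cvg_ReImP (fun t => conjc (f t))); split.
  by rewrite Re_conj; under eq_fun do rewrite Re_conj.
by rewrite Im_conj; under eq_fun do rewrite Im_conj; exact: cvgN.
Qed.

Lemma cvg_complex_cst (T : Type) (F : set_system T) {FF : Filter F} (c : R[i]) :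
  (fun _ : T => c) @ F --> (c : R[i]^o).
Proof.
apply/(cvg_complexP (fun _ : T => c) c) => e e0.
by apply: nearW => t; rewrite subrr normc0.
Qed.

Lemma cvg_complex_unique (T : Type) (F : set_system T) {FF : ProperFilter F}
    (f : T -> R[i]) (l m : R[i]) :
  f @ F --> (l : R[i]^o) -> f @ F --> (m : R[i]^o) -> l = m.
Proof.
move=> /cvg_ReImP[fl1 fl2] /cvg_ReImP[fm1 fm2].
by apply: eqC; [exact: cvg_unique fl1 fm1 | exact: cvg_unique fl2 fm2].
Qed.

Lemma cvg_complex_le (T : Type) (F : set_system T) {FF : ProperFilter F}
    (f : T -> R[i]) (l m : R[i]) (c : R) :
  f @ F --> (l : R[i]^o) -> (\forall t \near F, normc (m - f t) <= c) ->
  normc (m - l) <= c.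
Proof.
move=> /cvg_complexP fl fc; apply/ler_addgt0Pr => e e0.
have [t []] := @filter_ex _ F _ _ (filterI (fl _ e0) fc).
move=> lt mt; rewrite (_ : m - l = (m - f t) + (- (l - f t))); last by ring.
by rewrite (le_trans (le_normcD _ _)) // normcN lerD // ltW.
Qed.

End ComplexNumbers.

Section SesquilinearForms.
Variables (R : realType) (V : lmodType R[i]) (B : V -> V -> R[i]).

(** Definiteness is left out so that Cauchy-Schwarz, Bessel and Gram-Schmidt apply both to inner
    products and to the possibly degenerate form <u, P v> of a positive operator [P]. *)
Definition semi_inner : Prop :=
  [/\ forall (a : R[i]) (u v w : V), B u (a *: v + w) = a * B u v + B u w,
      forall u v : V, B v u = conjc (B u v) &
      forall u : V, 0 <= B u u].

Hypothesis HB : semi_inner.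

Definition sqform (u : V) : R := Re (B u u).
Definition seminorm (u : V) : R := Num.sqrt (sqform u).

Lemma formDr u v w : B u (v + w) = B u v + B u w.
Proof. by case: HB => H _ _; rewrite -[X in B u (X + _)]scale1r H mul1r. Qed.

Lemma form0r u : B u 0 = 0.
Proof. by apply: (addrI (B u 0)); rewrite -formDr !addr0. Qed.

Lemma formZr u a v : B u (a *: v) = a * B u v.
Proof. by case: HB => H _ _; rewrite -[a *: v]addr0 H form0r addr0. Qed.

Lemma formNr u v : B u (- v) = - B u v.
Proof. by rewrite -scaleN1r formZr mulN1r. Qed.

Lemma formC u v : B v u = conjc (B u v). Proof. by case: HB. Qed.

Lemma formDl u v w : B (v + w) u = B v u + B w u.
Proof. by rewrite formC formDr rmorphD /= -!formC. Qed.

Lemma form0l u : B 0 u = 0.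
Proof. by rewrite formC form0r rmorph0. Qed.

Lemma formNl u v : B (- v) u = - B v u.
Proof. by rewrite formC formNr rmorphN /= -!formC. Qed.

Lemma formZl u a v : B (a *: v) u = conjc a * B v u.
Proof. by rewrite formC formZr rmorphM /= -!formC. Qed.

Lemma form_sumr (I : Type) (r : seq I) (P : pred I) (F : I -> V) u :
  B u (\sum_(i <- r | P i) F i) = \sum_(i <- r | P i) B u (F i).
Proof.
by elim/big_rec2 : _ => [|i y x _ <-]; rewrite ?form0r // formDr.
Qed.

Lemma form_suml (I : Type) (r : seq I) (P : pred I) (F : I -> V) u :
  B (\sum_(i <- r | P i) F i) u = \sum_(i <- r | P i) B (F i) u.
Proof.
by elim/big_rec2 : _ => [|i y x _ <-]; rewrite ?form0l // formDl.
Qed.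

Lemma sqform_ge0 u : 0 <= sqform u.
Proof. by case: HB => _ _ /(_ u); rewrite lecE => /andP[_]. Qed.

Lemma formE u : B u u = (sqform u)%:C%C.
Proof. by case: HB => _ _ /(_ u); rewrite lecE => /andP[/eqP] /= ? _; exact: eqC. Qed.

Lemma seminorm_ge0 u : 0 <= seminorm u. Proof. exact: sqrtr_ge0. Qed.

Lemma sqr_seminorm u : seminorm u ^+ 2 = sqform u.
Proof. by rewrite sqr_sqrtr // sqform_ge0. Qed.

Lemma sqformZ a u : sqform (a *: u) = csqnorm a * sqform u.
Proof.
by rewrite /sqform formZr formZl formE /csqnorm !ReImE /=; ring.
Qed.

Lemma sqformD u v : sqform (u + v) = sqform u + sqform v + 2 * Re (B u v).
Proof.
by rewrite /sqform !formDr !formDl !ReD (formC u v) Re_conj; ring.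
Qed.

Lemma Cauchy_Schwarz u v : csqnorm (B u v) <= sqform u * sqform v.
Proof.
(* A null vector [u] cannot be normalized. Instead, positivity at v - t B(u,v) u for every real [t]
   forces B(u,v) = 0. *)
have [u0|u0] := eqVneq (sqform u) 0.
  have H (t : R) : 0 <= sqform v - 2 * t * csqnorm (B u v).
    have := sqform_ge0 ((- (t%:C%C * B u v)) *: u + v).
    rewrite sqformD sqformZ u0 mulr0 add0r formZl.
    by rewrite /csqnorm !ReImE /=; nra.
  rewrite u0 mul0r leNgt; apply/negP => c0.
  (* This [t] makes the right-hand side of [H] equal to -1. *)
  have := H ((sqform v + 1) / (2 * csqnorm (B u v))).
  rewrite (_ : 2 * _ * _ = sqform v + 1); first by lra.
  by field; rewrite gt_eqF.
have up : 0 < sqform u by rewrite lt0r u0 sqform_ge0.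
(* This is [sqform u] times the component of [v] orthogonal to [u], scaled to avoid division. *)
have := sqform_ge0 ((- B u v) *: u + (sqform u)%:C%C *: v).
rewrite sqformD !sqformZ formZl formZr /csqnorm !ReImE /= => H.
have {}H : 0 <= sqform u * (sqform u * sqform v - csqnorm (B u v)).
  by move: H; rewrite /csqnorm; nra.
by rewrite -subr_ge0; move: H; rewrite pmulr_rge0.
Qed.

Lemma normc_form u v : normc (B u v) <= seminorm u * seminorm v.
Proof.
by rewrite normc_sqrt -sqrtrM ?sqform_ge0 // ler_wsqrtr // Cauchy_Schwarz.
Qed.

Lemma seminormD u v : seminorm (u + v) <= seminorm u + seminorm v.
Proof.
rewrite -(@ler_pXn2r _ 2) ?nnegrE ?addr_ge0 ?seminorm_ge0 // sqrrD !sqr_seminorm.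
rewrite sqformD addrAC lerD2r lerD2l mulr2n.
have := le_trans (ler_normRe (B u v)) (normc_form u v).
by have := ler_norm (Re (B u v)); lra.
Qed.

Lemma seminormZ a u : seminorm (a *: u) = normc a * seminorm u.
Proof. by rewrite /seminorm sqformZ sqrtrM ?csqnorm_ge0 // normc_sqrt. Qed.

Lemma seminormN u : seminorm (- u) = seminorm u.
Proof. by rewrite -scaleN1r seminormZ normcN normc1 mul1r. Qed.

Lemma seminorm0 : seminorm 0 = 0.
Proof. by rewrite /seminorm /sqform form0r sqrtr0. Qed.

Lemma seminormB u v : seminorm (u - v) = seminorm (v - u).
Proof. by rewrite -seminormN opprB. Qed.

Lemma seminorm_dist u v : `|seminorm u - seminorm v| <= seminorm (u - v).
Proof.
rewrite ler_norml; apply/andP; split.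
  by rewrite lerNl opprB lerBlDr seminormB -{1}(subrK u v) seminormD.
by rewrite lerBlDr -{1}(subrK v u) seminormD.
Qed.

Definition orthonormal (f : nat -> V) : Prop :=
  (forall m n, m != n -> B (f m) (f n) = 0) /\
  forall n, f n = 0 \/ B (f n) (f n) = 1.

Definition projn (f : nat -> V) (n : nat) (u : V) : V :=
  \sum_(k < n) B (f k) u *: f k.

Lemma projnB f n u v : projn f n (u - v) = projn f n u - projn f n v.
Proof.
rewrite /projn -sumrB; apply: eq_bigr => k _.
by rewrite formDr formNr scalerBl.
Qed.

Section Bessel.
Variable f : nat -> V.
Hypothesis of_ : orthonormal f.

Lemma form_projn_lt n k u : (k < n)%N -> B (f k) (projn f n u) = B (f k) u.
Proof.
move=> kn; rewrite form_sumr (bigD1 (Ordinal kn)) //= big1.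
  rewrite addr0 formZr; have [_ /(_ k)[->|->]] := of_; rewrite ?mulr1 //.
  by rewrite form0l mul0r.
move=> [i ik] /=; rewrite formZr -val_eqE /= => ik'.
by rewrite (proj1 of_) ?mulr0 // eq_sym.
Qed.

Lemma form_projn n u v :
  B u (projn f n v) = \sum_(k < n) B u (f k) * B (f k) v.
Proof.
by rewrite form_sumr; apply: eq_bigr => k _; rewrite formZr mulrC.
Qed.

Lemma sqform_projn n u :
  sqform (projn f n u) = \sum_(k < n) csqnorm (B (f k) u).
Proof.
rewrite /sqform form_suml Re_sum; apply: eq_bigr => k _.
by rewrite formZl form_projn_lt // conjM_csqnorm.
Qed.

Lemma sqform_projnB n u :
  sqform (u - projn f n u) = sqform u - \sum_(k < n) csqnorm (B (f k) u).
Proof.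
have H : B u (projn f n u) = (\sum_(k < n) csqnorm (B (f k) u))%:C%C.
  rewrite form_projn rmorph_sum; apply: eq_bigr => k _.
  by rewrite (formC (f k) u) conjM_csqnorm.
rewrite sqformD formNr H ReN /= -scaleN1r sqformZ sqform_projn /csqnorm !ReImE /=.
by ring.
Qed.

Lemma Bessel n u : \sum_(k < n) csqnorm (B (f k) u) <= sqform u.
Proof. by rewrite -subr_ge0 -sqform_projnB sqform_ge0. Qed.

Lemma seminorm_projnB n u : seminorm (u - projn f n u) <= seminorm u.
Proof.
rewrite ler_wsqrtr // sqform_projnB gerBl.
by apply: sumr_ge0 => k _; exact: csqnorm_ge0.
Qed.

Lemma seminorm_projn n u : seminorm (projn f n u) <= seminorm u.
Proof. by rewrite ler_wsqrtr // sqform_projn Bessel. Qed.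

Lemma seminorm_projnB_le n m u : (n <= m)%N ->
  seminorm (u - projn f m u) <= seminorm (u - projn f n u).
Proof.
move=> nm; rewrite ler_wsqrtr // !sqform_projnB lerD2l lerN2.
rewrite -!(big_mkord xpredT (fun k => csqnorm (B (f k) u))) /=.
rewrite [leRHS](big_cat_nat _ nm) //= lerDl.
by apply: sumr_ge0 => k _; exact: csqnorm_ge0.
Qed.

End Bessel.

(** A remainder of seminorm 0 is replaced by the zero vector, even when it is a nonzero null vector
    of a degenerate form. *)
Definition gs_step (s : seq V) (v : V) : V :=
  let w := v - \sum_(f <- s) B f v *: f in
  if sqform w == 0 then 0 else ((seminorm w)^-1)%:C%C *: w.

(** Each step needs all earlier outputs, so the recursion builds their list; [gs_seqE] identifies
    that list with the first values of [gram_schmidt]. *)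
Fixpoint gs_seq (d : nat -> V) (n : nat) : seq V :=
  if n is m.+1 then rcons (gs_seq d m) (gs_step (gs_seq d m) (d m)) else [::].

Definition gram_schmidt (d : nat -> V) (n : nat) : V :=
  gs_step (gs_seq d n) (d n).

Lemma gs_seqE d n : gs_seq d n = mkseq (gram_schmidt d) n.
Proof. by elim: n => // n IH /=; rewrite IH mkseqS -IH. Qed.

Lemma gram_schmidtE d n (w := d n - projn (gram_schmidt d) n (d n)) :
  gram_schmidt d n =
    if sqform w == 0 then 0 else ((seminorm w)^-1)%:C%C *: w.
Proof.
rewrite {1}/gram_schmidt /gs_step gs_seqE big_map.
by rewrite (_ : iota 0 n = index_iota 0 n) ?big_mkord // /index_iota subn0.
Qed.

Lemma gram_schmidt_orthonormal d : orthonormal (gram_schmidt d).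
Proof.
set f := gram_schmidt d.
have f1 n : f n = 0 \/ B (f n) (f n) = 1.
  rewrite /f gram_schmidtE; set w := _ - _; case: ifPn => [_|w0]; first by left.
  right; rewrite formZl formZr formE conjc_real -!rmorphM /= -sqr_seminorm.
  congr (_%:C)%C; field; rewrite sqrtr_eq0 -ltNge lt0r w0; exact: sqform_ge0.
(* Strong induction on the larger index; the other order of the indices follows from hermitian
   symmetry. *)
have f0 n : forall k, (k < n)%N -> B (f k) (f n) = 0.
  elim/ltn_ind: n => n IH k kn.
  rewrite /f [gram_schmidt d n]gram_schmidtE -/f.
  set w := _ - _; case: ifPn => _; first by rewrite form0r.
  rewrite formZr /w formDr formNr form_sumr (bigD1 (Ordinal kn)) //= big1.
    rewrite addr0 formZr; case: (f1 k) => ->; last by rewrite mulr1 subrr mulr0.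
    by rewrite !form0l mul0r subrr mulr0.
  move=> [i ik] /=; rewrite formZr -val_eqE /= => ik'.
  have [lt|lt|e] := ltngtP i k; last by rewrite e eqxx in ik'.
    by rewrite (formC (f i) (f k)) IH // conjc0 mulr0.
  by rewrite IH // mulr0.
split => // m n; rewrite neq_ltn => /orP[|] mn; first exact: f0.
by rewrite formC f0 // conjc0.
Qed.

(** The remainder [w] of [d n] is either null or its seminorm times the n-th output, so projecting
    onto one more vector removes it. Further projections only decrease the distance. *)
Lemma gram_schmidt_span d n m : (n < m)%N ->
  seminorm (d n - projn (gram_schmidt d) m (d n)) = 0.
Proof.
move=> nm; have of_ := gram_schmidt_orthonormal d.
apply/eqP; rewrite eq_le seminorm_ge0 andbT.
rewrite (le_trans (seminorm_projnB_le of_ _ nm)) //.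
rewrite {1}/projn big_ord_recr /= -/(projn _ _ _).
rewrite gram_schmidtE; set w := d n - projn _ _ _.
case: ifPn => [/eqP w0|w0].
  by rewrite scaler0 addr0 -/w /seminorm w0 sqrtr0.
rewrite opprD addrA -/w formZl.
have -> : B w (d n) = (sqform w)%:C%C.
  rewrite -[d n](subrK (projn (gram_schmidt d) n (d n))) -/w formDr formE.
  rewrite form_sumr big1 ?addr0 // => k _; rewrite formZr.
  rewrite (formC _ w) /w formDr formNr form_projn_lt // subrr rmorph0 mulr0 //.
rewrite conjc_real scalerA -!rmorphM /= -sqr_seminorm.
rewrite (_ : _ * _ * _ = 1) ?scale1r ?subrr ?seminorm0 //.
by field; rewrite sqrtr_eq0 -ltNge lt0r w0 sqform_ge0.
Qed.

(** With P the projection, u - P u = ((u - d k) - P (u - d k)) + (d k - P (d k)), where the last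
    bracket is null and the first is no longer than u - d k. *)
Lemma gram_schmidt_dense d :
  (forall u e, 0 < e -> exists n, seminorm (u - d n) < e) ->
  forall u e, 0 < e -> exists N, forall n, (N <= n)%N ->
    seminorm (u - projn (gram_schmidt d) n u) < e.
Proof.
move=> dd u e e0; have [k ke] := dd u e e0; exists k.+1 => n kn.
have of_ := gram_schmidt_orthonormal d.
apply: le_lt_trans ke; set P := projn _ _ u.
rewrite (_ : u - P = ((u - d k) - projn (gram_schmidt d) n (u - d k))
    + (d k - projn (gram_schmidt d) n (d k))); last first.
  by rewrite projnB -/P (opprD P) (addrACA u) -opprD subrK.
rewrite (le_trans (seminormD _ _)) // gram_schmidt_span // addr0.
exact: seminorm_projnB.
Qed.

End SesquilinearForms.

(** * Hilbert spaces and traces *)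

Section HilbertSpaceTheory.
Variable R : realType.
Implicit Types H K : innerSpace R.

Lemma inner_semi H : is_inner_product H -> semi_inner (@dot R H).
Proof. by case. Qed.

Lemma hnormE H (u : H) : hnorm u = seminorm (@dot R H) u.
Proof. by []. Qed.

Lemma hnorm_eq0 H : is_inner_product H -> forall u : H, hnorm u = 0 -> u = 0.
Proof.
move=> HH u; have hs := inner_semi HH; case: HH => _ _ _ H0 u0; apply: H0.
by rewrite (formE hs) -(sqr_seminorm hs) -hnormE u0 expr0n.
Qed.

Lemma sqr_hnorm H : is_inner_product H ->
  forall u : H, dot u u = (hnorm u ^+ 2)%:C%C.
Proof.
by move=> HH u; have hs := inner_semi HH; rewrite (formE hs) (sqr_seminorm hs).
Qed.

Lemma sum_ord_subr (V : zmodType) (F : nat -> V) m n : (m <= n)%N ->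
  \sum_(j < n) F j - \sum_(j < m) F j = \sum_(m <= j < n) F j.
Proof.
move=> mn; rewrite -!(big_mkord xpredT F) (big_cat_nat _ mn) //= addrAC.
by rewrite subrr add0r.
Qed.

Lemma cvg_complex_sum (T I : Type) (F : set_system T) {FF : Filter F}
    (r : seq I) (f : I -> T -> R[i]) (l : I -> R[i]) :
  (forall i, f i @ F --> (l i : R[i]^o)) ->
  (fun t => \sum_(i <- r) f i t) @ F --> ((\sum_(i <- r) l i : R[i]) : R[i]^o).
Proof.
move=> fl; elim: r => [|i r IH].
  rewrite big_nil; under eq_fun do rewrite big_nil.
    exact: cvg_complex_cst.
rewrite big_cons; under eq_fun do rewrite big_cons.
exact: cvg_complexD (fl i) IH.
Qed.

Lemma complex_cauchy_cvg (s : nat -> R[i]) :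
  (forall e : R, 0 < e -> exists N, forall n, (N <= n)%N ->
    normc (s N - s n) < e) -> exists t : R[i], s @ \oo --> (t : R[i]^o).
Proof.
move=> cs; have H (F : R[i] -> R) : {morph F : a b / a - b} ->
    (forall w, `|F w| <= normc w) -> cvgn (F \o s).
  move=> Fb Fn; apply/cauchy_cvgP/cauchy_exP => e e0.
  have [N HN] := cs _ e0; exists (F (s N)); exists N => // n Nn.
  by rewrite /ball /= -Fb (le_lt_trans (Fn _)) // HN.
have cr : cvgn (@complex.Re R \o s).
  by apply: H => [a b|w]; rewrite ?ReD ?ReN ?ler_normRe.
have ci : cvgn (@complex.Im R \o s).
  by apply: H => [a b|w]; rewrite ?ImD ?ImN ?ler_normIm.
exists (Complex (limn (@complex.Re R \o s)) (limn (@complex.Im R \o s))).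
by apply/cvg_ReImP.
Qed.

Lemma cvg_series_bounded_cauchy (b : nat -> R) (c : R) :
  (forall k, 0 <= b k) -> (forall n, \sum_(k < n) b k <= c) ->
  forall e, 0 < e -> exists N, forall n, (N <= n)%N ->
    \sum_(N <= k < n) b k <= e.
Proof.
move=> b0 bc e e0.
pose s n := \sum_(k < n) b k.
have sE m n : (m <= n)%N -> s n = s m + \sum_(m <= k < n) b k.
  move=> mn; rewrite /s -!(big_mkord xpredT b).
  by rewrite (big_cat_nat _ mn).
have ndS : nondecreasing_seq s.
  move=> m n mn; rewrite (sE _ _ mn) lerDl; exact: sumr_ge0.
have ub : has_ubound (range s) by exists c => _ [n _ <-]; exact: bc.
have /cvgrPdist_le /(_ _ e0) [N _ HN] :=
  nondecreasing_cvgn ndS ub.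
exists N => n Nn; have := HN N (leqnn N).
have sup_ge : s n <= sup (range s) by apply: sup_ubound => //; exists n.
have := ler_norm (sup (range s) - s N).
rewrite (sE _ _ Nn) in sup_ge; lra.
Qed.

Lemma le_projn_cauchy H (f : nat -> H) (u : H) m n : is_inner_product H ->
  orthonormal (@dot R H) f -> (m <= n)%N ->
  hnorm (projn (@dot R H) f n u - projn (@dot R H) f m u) ^+ 2 =
  \sum_(m <= k < n) csqnorm (dot (f k) u).
Proof.
move=> HH of_ mn; have hs := inner_semi HH.
rewrite sqr_seminorm // /projn (sum_ord_subr (fun k => dot (f k) u *: f k) mn).
rewrite /sqform (form_suml hs) Re_sum big_nat [RHS]big_nat.
apply: eq_bigr => k /andP[mk kn].
rewrite (formZl hs) (form_sumr hs) (bigD1_seq k) ?mem_index_iota ?mk ?iota_uniq //=.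
rewrite big1 => [|i ik]; last by rewrite (formZr hs) (proj1 of_) ?mulr0 // eq_sym.
rewrite addr0 (formZr hs); case: (proj2 of_ k) => ->.
  by rewrite !(form0l hs) !mulr0 /csqnorm /= !expr0n addr0.
by rewrite mulr1 conjM_csqnorm.
Qed.

(** Bessel makes the partial expansions Cauchy, completeness gives a limit [l], and u - l is
    orthogonal to every basis vector, hence 0 by maximality of the basis. *)
Lemma orthonormal_basis_cvg H : is_hilbert H ->
  forall e : nat -> H, orthonormal_basis e ->
  forall (u : H) (r : R), 0 < r -> exists N, forall n, (N <= n)%N ->
    hnorm (u - projn (@dot R H) e n u) < r.
Proof.
move=> [HH cH] e [e0 e1 e2] u r r0; have hs := inner_semi HH.
have oe : orthonormal (@dot R H) e by split.
pose P n := projn (@dot R H) e n u.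
have [l lP] : exists l : H, forall r : R, 0 < r -> exists N, forall n,
    (N <= n)%N -> hnorm (P n - l) < r.
  apply: cH => t t0; have t40 : 0 < (t / 4) ^+ 2 by rewrite exprn_gt0 // divr_gt0.
  have [N HN] := cvg_series_bounded_cauchy
    (fun k => csqnorm_ge0 (dot (e k) u)) (fun n => Bessel hs oe n u) t40.
  have HN' n : (N <= n)%N -> hnorm (P n - P N) <= t / 4.
    move=> Nn; rewrite -(@ler_pXn2r _ 2) ?nnegrE ?sqrtr_ge0 //; last by rewrite ltW ?divr_gt0.
    by rewrite le_projn_cauchy // HN.
  exists N => m n Nm Nn; rewrite -(subrKA (P N)).
  apply: (le_lt_trans (seminormD hs _ _)).
  rewrite (seminormB hs (P N)); have := HN' _ Nm; have := HN' _ Nn.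
  by rewrite -!hnormE; lra.
have ul : u = l.
  apply/eqP; rewrite -subr_eq0; apply/eqP; apply: e2 => n.
  apply: eq0_normc; apply/eqP; rewrite eq_le normc_ge0 andbT.
  apply/ler_addgt0Pr => t t0; rewrite add0r.
  have t20 : 0 < t by [].
  (* Past index [n] the partial expansion has the same n-th coefficient as [u], so that coefficient
     of u - l is controlled by the norm of P m - l. *)
  have [N HN] := lP _ t0; pose m := maxn N n.+1.
  have -> : dot (e n) (u - l) = dot (e n) (P m - l).
    by rewrite !(formDr hs) !(formNr hs) /P form_projn_lt // leq_max ltnSn orbT.
  apply: (le_trans (normc_form hs _ _)).
  rewrite (le_trans (ler_piMl _ _)) ?seminorm_ge0 //; last first.
    by apply/ltW/HN; rewrite leq_maxl.
  rewrite /seminorm /sqform; case: (e1 n) => ->.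
    by rewrite (form0l hs) sqrtr0.
  by rewrite sqrtr1.
have [N HN] := lP _ r0; exists N => n Nn.
by rewrite hnormE seminormB // [X in _ - X]ul; exact: HN.
Qed.

Lemma dot_cvg_projn H : is_hilbert H ->
  forall e : nat -> H, orthonormal_basis e -> forall u v : H,
  (fun n => dot u (projn (@dot R H) e n v) : R[i]^o) @ \oo -->
    (dot u v : R[i]^o).
Proof.
move=> hH e oe u v; have hs := inner_semi (proj1 hH).
apply/cvg_complexP => r r0.
have u1 : 0 < hnorm u + 1 by rewrite ltr_pwDr // sqrtr_ge0.
have [N HN] := orthonormal_basis_cvg hH oe v (divr_gt0 r0 u1).
exists N => // n /= Nn; rewrite -formNr // -formDr //.
apply: (le_lt_trans (normc_form hs _ _)); rewrite -!hnormE.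
have := HN n Nn; rewrite ltr_pdivlMr // mulrC; apply: le_lt_trans.
by rewrite ler_wpM2r ?sqrtr_ge0 // lerDl.
Qed.

Lemma exists_orthonormal_basis H : is_hilbert H -> is_separable H ->
  exists e : nat -> H, orthonormal_basis e.
Proof.
move=> [HH _] [d dd]; have hs := inner_semi HH.
exists (gram_schmidt (@dot R H) d).
have [of0 of1] := gram_schmidt_orthonormal hs d.
split => // u u0; apply: hnorm_eq0 => //.
apply/eqP; rewrite eq_le sqrtr_ge0 andbT; apply/ler_addgt0Pr => r r0.
rewrite add0r; have [N HN] := gram_schmidt_dense hs dd u r0.
have := HN N (leqnn N); rewrite /projn big1 => [|k _]; last by rewrite u0 scale0r.
by rewrite subr0 => /ltW.
Qed.

Lemma is_trace_unique H : is_hilbert H -> is_separable H ->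
  forall (A : H -> H) (a b : R[i]), is_trace A a -> is_trace A b -> a = b.
Proof.
move=> hH sH A a b Aa Ab; have [e oe] := exists_orthonormal_basis hH sH.
exact: cvg_complex_unique (Aa e oe) (Ab e oe).
Qed.

Lemma is_traceB H : is_inner_product H ->
  forall (A B : H -> H) (a b : R[i]), is_trace A a -> is_trace B b ->
  is_trace (fun u => A u - B u) (a - b).
Proof.
move=> HH A B a b Aa Bb e oe; have hs := inner_semi HH.
under eq_fun => n.
  under eq_bigr do rewrite (formDr hs) (formNr hs).
  rewrite sumrB; over.
by apply: cvg_complexB; [exact: Aa | exact: Bb].
Qed.

(* [A = \sum_j |z j> <y j|] in the strong sense. *)
Definition nuclear_repr H K (A : H -> K) (y : nat -> H) (z : nat -> K) : Prop :=
  forall (u : H) (r : R), 0 < r -> exists N, forall n, (N <= n)%N ->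
    hnorm (A u - \sum_(j < n) dot (y j) u *: z j) < r.

(** The trace is \sum_j <y j, z j>. In a basis [e] with partial projections P_m, the m-th partial
    trace is \sum_j <y j, P_m (z j)>. Its tail in [j] is small uniformly in [m], so one truncates in
    [j] first and then lets [m] tend to infinity. *)
Lemma nuclear_trace H : is_hilbert H ->
  forall (A : H -> H) (y z : nat -> H) (c : R), nuclear_repr A y z ->
  (forall n, \sum_(j < n) hnorm (y j) * hnorm (z j) <= c) ->
  exists2 t : R[i], is_trace A t & normc t <= c.
Proof.
move=> hH A y z c Ayz yzc; have HH := proj1 hH; have hs := inner_semi HH.
pose b j := hnorm (y j) * hnorm (z j).
have b0 j : 0 <= b j by rewrite mulr_ge0 // sqrtr_ge0.
pose s n : R[i] := \sum_(j < n) dot (y j) (z j).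
have tail := cvg_series_bounded_cauchy b0 yzc.
have bE (G : nat -> H) m n : (forall j, hnorm (G j) <= hnorm (z j)) ->
    normc (\sum_(m <= j < n) dot (y j) (G j)) <= \sum_(m <= j < n) b j.
  move=> Gz; rewrite (le_trans (normc_sum _ _ _)) // ler_sum // => j _.
  rewrite (le_trans (normc_form hs _ _)) // ler_wpM2l ?sqrtr_ge0 //.
  exact: Gz.
have [t st] : exists t : R[i], s @ \oo --> (t : R[i]^o).
  apply: complex_cauchy_cvg => e e0.
  have [N HN] := tail _ (divr_gt0 e0 (ltr0Sn _ 1)); exists N => n Nn.
  rewrite -normcN opprB (sum_ord_subr (fun j => dot (y j) (z j)) Nn).
  by rewrite (le_lt_trans (bE _ _ _ _)) // (le_lt_trans (HN _ Nn)) // gtr_pMr // invf_lt1 // ltr1n.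
exists t; last first.
  rewrite -normcN -sub0r; apply: cvg_complex_le st _; apply: nearW => n.
  rewrite sub0r normcN /s -(big_mkord xpredT (fun j => dot (y j) (z j))).
  by rewrite (le_trans (bE _ _ _ _)) // big_mkord.
move=> e oe; have oe' : orthonormal (@dot R H) e by case: oe.
pose Pr m := projn (@dot R H) e m.
(* The bound does not depend on [m] because projections do not increase the norm of [z j]. *)
have key m N r : (forall n, (N <= n)%N -> \sum_(N <= k < n) b k <= r) ->
    normc (\sum_(j < N) dot (y j) (Pr m (z j)) -
      \sum_(k < m) dot (e k) (A (e k))) <= r.
  move=> HN; pose f n := \sum_(j < n) dot (y j) (Pr m (z j)).
  have fE n : f n = \sum_(k < m) dot (e k) (\sum_(j < n) dot (y j) (e k) *: z j).
    under eq_bigr do rewrite (form_sumr hs).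
    rewrite exchange_big /=; apply: eq_bigr => j _.
    rewrite /Pr form_projn //; apply: eq_bigr => k _.
    by rewrite formZr.
  have fS : f @ \oo --> (\sum_(k < m) dot (e k) (A (e k)) : R[i]^o).
    rewrite (funext fE); apply: cvg_complex_sum => k.
    apply/cvg_complexP => d d0.
    have e1 : 0 < hnorm (e k) + 1 by rewrite ltr_pwDr // sqrtr_ge0.
    have [M HM] := Ayz (e k) _ (divr_gt0 d0 e1); exists M => // n /= Mn.
    rewrite -formNr // -formDr // (le_lt_trans (normc_form hs _ _)) // -!hnormE.
    have := HM n Mn; rewrite ltr_pdivlMr // mulrC; apply: le_lt_trans.
    by rewrite ler_wpM2r ?sqrtr_ge0 // lerDl.
  apply: cvg_complex_le fS _; exists N => // n /= Nn.
  rewrite -normcN opprB (sum_ord_subr (fun j => dot (y j) (Pr m (z j))) Nn).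
  rewrite (le_trans (bE (fun j => Pr m (z j)) _ _ _)) ?HN // => j.
  exact: seminorm_projn.
apply/cvg_complexP => r r0; have r40 : 0 < r / 4 by rewrite divr_gt0.
have [N HN] := tail _ r40.
have tN : normc (s N - t) <= r / 4.
  apply: cvg_complex_le st _; exists N => // n /= Nn.
  rewrite -normcN opprB (sum_ord_subr (fun j => dot (y j) (z j)) Nn).
  by rewrite (le_trans (bE _ _ _ _)) // HN.
have : (fun m => \sum_(j < N) dot (y j) (Pr m (z j))) @ \oo --> (s N : R[i]^o).
  by apply: cvg_complex_sum => j; exact: dot_cvg_projn.
move=> /cvg_complexP /(_ _ r40); apply: filterS => m Hm.
move: Hm (key m N _ HN); set f := \sum_(j < N) _; set S := \sum_(k < m) _ => Hm HS.
rewrite (_ : t - S = - (s N - t) + ((s N - f) + (f - S))); last by ring.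
rewrite (le_lt_trans (le_normcD _ _)) // normcN.
have := le_normcD (s N - f) (f - S); lra.
Qed.

Lemma linear_op_sum (V W : lmodType R[i]) (A : V -> W) :
  (forall (a : R[i]) u v, A (a *: u + v) = a *: A u + A v) ->
  forall n (c : 'I_n -> R[i]) v,
  A (\sum_(j < n) c j *: v j) = \sum_(j < n) c j *: A (v j).
Proof.
move=> lA; elim=> [|n IH] c v; last by rewrite !big_ord_recl addrC addrC lA IH.
by rewrite !big_ord0; have := lA (-1) 0 0; rewrite scaler0 addr0 scaleN1r addNr.
Qed.

Lemma linear_opB (V W : lmodType R[i]) (A : V -> W) :
  (forall (a : R[i]) u v, A (a *: u + v) = a *: A u + A v) ->
  forall u v, A (u - v) = A u - A v.
Proof. by move=> lA u v; rewrite addrC -scaleN1r lA scaleN1r addrC. Qed.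

Lemma linear_opZ (V W : lmodType R[i]) (A : V -> W) :
  (forall (a : R[i]) u v, A (a *: u + v) = a *: A u + A v) ->
  forall (a : R[i]) u, A (a *: u) = a *: A u.
Proof.
by move=> lA a u; have := linear_op_sum lA (fun _ : 'I_1 => a) (fun=> u); rewrite !big_ord1.
Qed.

Lemma nuclear_repr_comp H K (L : innerSpace R) (hK : is_inner_product K) (A : H -> K)
    (U : K -> L) (y : nat -> H) (z : nat -> K) :
  (forall (a : R[i]) u v, U (a *: u + v) = a *: U u + U v) ->
  (forall u, hnorm (U u) = hnorm u) ->
  nuclear_repr A y z -> nuclear_repr (fun u => U (A u)) y (fun j => U (z j)).
Proof.
move=> lU nU Ayz u r r0; have [N HN] := Ayz u r r0; exists N => n Nn.
rewrite (_ : \sum_(j < n) _ = U (\sum_(j < n) dot (y j) u *: z j)).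
  by rewrite -(linear_opB lU) nU; exact: HN.
by rewrite (linear_op_sum lU).
Qed.

(** Polarization: positivity makes the diagonal real, and reality at u + v and at i u + v yields the
    real and imaginary parts of the symmetry. *)
Lemma form_hermitian (V : lmodType R[i]) (S : V -> V -> R[i]) :
  (forall (a : R[i]) u v w, S u (a *: v + w) = a * S u v + S u w) ->
  (forall (a : R[i]) u v w, S (a *: v + w) u = conjc a * S v u + S w u) ->
  (forall u, 0 <= S u u) -> semi_inner S.
Proof.
move=> Sr Sl S0; split => // u v.
have im0 w : Im (S w w) = 0 by have := S0 w; rewrite lecE => /andP[/eqP].
have := im0 (1%:C%C *: u + v); have := im0 (Complex 0 1 *: u + v).
rewrite !Sl !Sr !ReImE /= !im0 => H1 H2.
by apply: eqC; rewrite !ReImE; lra.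
Qed.

(** The defect of linearity has zero inner product with everything, since [A] can be moved to the
    other side. This spares almost-everywhere computations for [can_rep] and [can_povm]. *)
Lemma adjoint_linear H K (A : H -> K) (B : K -> H) :
  is_inner_product H -> is_inner_product K -> is_adjoint A B ->
  forall (a : R[i]) u v, A (a *: u + v) = a *: A u + A v.
Proof.
move=> HH HK AB a u v; have hs := inner_semi HH; have ks := inner_semi HK.
apply/eqP; rewrite -subr_eq0; apply/eqP; case: HK => _ _ _; apply.
set w := _ - _; rewrite {2}/w formDr // formNr // formDr // formZr // !AB.
by rewrite formDr // formZr // subrr.
Qed.

Lemma sqr_lt_weight (D h r : R) : 1 <= D -> 0 <= h -> h * D < r ->
  D * h ^+ 2 < r ^+ 2.
Proof.
move=> D1 h0 hDr; have D0 : 0 <= D := le_trans ler01 D1.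
have : (h * D) ^+ 2 < r ^+ 2.
  by rewrite ltr_pXn2r ?nnegrE ?mulr_ge0 // ltW // (le_lt_trans _ hDr) // mulr_ge0.
apply: le_lt_trans; rewrite exprMn mulrC ler_wpM2l ?sqr_ge0 // expr2.
by rewrite -[leLHS]mul1r ler_wpM2r.
Qed.

(* [P] plays the role of |A|. Its form [S u v = <u, P v>] may be degenerate, so *)
(* Gram-Schmidt is run for [S]; the weights are controlled by the trace of [P] *)
(* through Bessel's inequality for [S] at the vectors of an orthonormal basis. *)
Lemma trace_norm_nuclear H K : is_hilbert H -> is_separable H ->
  is_inner_product K -> forall (A : H -> K) (c : R), is_trace_norm A c ->
  exists y z, nuclear_repr A y z /\
    forall n, \sum_(j < n) hnorm (y j) * hnorm (z j) <= c.
Proof.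
move=> hH sH HK A c [P [[[[Plin [C PC]] Ppos] [B [AB PP]]] PT]].
have HH := proj1 hH; have hs := inner_semi HH; have ks := inner_semi HK.
pose S (u v : H) := dot u (P v).
have Ss : semi_inner S.
  apply: form_hermitian => [a u v w|a u v w|u]; last exact: Ppos.
    by rewrite /S Plin formDr // formZr.
  by rewrite /S formDl // formZl.
have Alin := adjoint_linear HH HK AB.
(* Both squared norms are <u, P (P u)>, because P P is the adjoint of [A] composed with [A]. *)
have PA u : hnorm (A u) = hnorm (P u).
  rewrite /hnorm AB -PP -[dot (P (P u)) u](conjcK) -(formC hs).
  by rewrite -/(S u (P u)) (formC Ss (P u) u) conjcK.
pose D := `|C| + 1; have D0 : 0 < D by rewrite ltr_pwDr.
have PD u : hnorm (P u) <= D * hnorm u.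
  rewrite (le_trans (PC u)) // ler_wpM2r ?sqrtr_ge0 // (le_trans (ler_norm C)) //.
  by rewrite lerDl.
have SD u : sqform S u <= D * hnorm u ^+ 2.
  rewrite /sqform (le_trans (ler_norm _)) // (le_trans (ler_normRe _)) //.
  rewrite (le_trans (normc_form hs _ _)) // -!hnormE expr2 mulrA mulrC.
  by rewrite ler_wpM2r ?sqrtr_ge0 // PD.
(* Cauchy-Schwarz for [S] at w and P w, using S(w, P w) = |P w|^2 and S(P w, P w) <= D |P w|^2; one
   factor |P w|^2 cancels. *)
have PS w : hnorm (P w) ^+ 2 <= D * sqform S w.
  have [->|Pw0] := eqVneq (hnorm (P w)) 0.
    by rewrite expr0n /= mulr_ge0 ?(ltW D0) // sqform_ge0.
  have Pw : 0 < hnorm (P w) ^+ 2 by rewrite exprn_gt0 // lt0r Pw0 sqrtr_ge0.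
  rewrite -(ler_pM2r Pw).
  have := Cauchy_Schwarz Ss w (P w).
  have -> : S w (P w) = (hnorm (P w) ^+ 2)%:C%C.
    by rewrite (formC Ss) -/(S _ _) {1}/S sqr_hnorm // conjc_real.
  rewrite /csqnorm /= expr0n addr0 expr2 => /le_trans; apply.
  by rewrite mulrAC mulrC ler_wpM2r ?sqform_ge0 // -mulrC mulrC SD.
have [d dd] := sH; pose f := gram_schmidt S d.
(* By [SD] a dense sequence for the norm is dense for the seminorm of [S] as well. *)
have dS u r : 0 < r -> exists n, seminorm S (u - d n) < r.
  move=> r0; have [n Hn] := dd u _ (divr_gt0 r0 D0); exists n.
  rewrite -(@ltr_pXn2r _ 2) ?nnegrE ?seminorm_ge0 ?(ltW r0) // sqr_seminorm //.
  rewrite (le_lt_trans (SD _)) //; move: Hn; rewrite ltr_pdivlMr // => Hn.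
  have h0 : 0 <= hnorm (u - d n) by rewrite sqrtr_ge0.
  have D1 : 1 <= D by rewrite lerDr.
  exact: sqr_lt_weight.
have yE j u : dot (P (f j)) u = S (f j) u.
  by rewrite (formC hs) -/(S u (f j)) (formC Ss (f j)) conjcK.
(* Applying [A] to the [S]-expansion of [u] gives \sum_j S(f j, u) A (f j), and S(f j, u) = <P (f
   j), u>. By [PA] and [PS], convergence in the seminorm of [S] implies convergence of the images
   under [A]. *)
exists (fun j => P (f j)), (fun j => A (f j)); split.
  move=> u r r0; have [N HN] := gram_schmidt_dense Ss dS u (divr_gt0 r0 D0).
  exists N => n /HN {}HN.
  have -> : \sum_(j < n) dot (P (f j)) u *: A (f j) = A (projn S f n u).
    by rewrite (linear_op_sum Alin); apply: eq_bigr => j _; rewrite yE.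
  rewrite -(linear_opB Alin) PA.
  rewrite -(@ltr_pXn2r _ 2) ?nnegrE ?sqrtr_ge0 ?(ltW r0) //.
  rewrite (le_lt_trans (PS _)) // -sqr_seminorm //.
  move: HN; rewrite ltr_pdivlMr // => HN.
  have h0 := seminorm_ge0 S (u - projn S f n u).
  have D1 : 1 <= D by rewrite lerDr.
  exact: sqr_lt_weight.
move=> n; have [e oe] := exists_orthonormal_basis hH sH.
have oe' : orthonormal (@dot R H) e by case: oe.
have /cvg_ReImP[/= PTe _] := PT e oe.
have yc : (fun m => \sum_(j < n)
    dot (P (f j)) (projn (@dot R H) e m (P (f j)))) @ \oo -->
    (\sum_(j < n) dot (P (f j)) (P (f j)) : R[i]^o).
  by apply: cvg_complex_sum => j; exact: dot_cvg_projn.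
move/cvg_ReImP : yc => [yc _].
(* Each product is |P (f j)|^2, which Parseval expands as \sum_k |S(f j, e k)|^2. Summing over [j]
   first, Bessel for [S] bounds the k-th term by S(e k, e k), and these sum to the trace of [P]. *)
have -> : \sum_(j < n) hnorm (P (f j)) * hnorm (A (f j)) =
    Re (\sum_(j < n) dot (P (f j)) (P (f j))).
  rewrite Re_sum; apply: eq_bigr => j _.
  by rewrite sqr_hnorm //= PA expr2.
apply: ler_cvg_to yc PTe _; apply: nearW => /= m.
have -> : \sum_(j < n) dot (P (f j)) (projn (@dot R H) e m (P (f j))) =
    \sum_(k < m) \sum_(j < n) dot (P (f j)) (e k) * dot (e k) (P (f j)).
  rewrite exchange_big /=; apply: eq_bigr => j _; exact: form_projn.
rewrite !Re_sum ler_sum // => k _.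
rewrite Re_sum -/(S (e k) (e k)) -/(sqform S (e k)).
apply: le_trans (Bessel Ss (gram_schmidt_orthonormal Ss d) n (e k)).
apply: ler_sum => j _.
by rewrite (formC hs (P (f j))) yE mulrC conjM_csqnorm.
Qed.

Lemma finite_rank_trace H (hH : is_hilbert H) n (eta zeta : 'I_n -> H) :
  is_trace (fun u => \sum_(j < n) dot (eta j) u *: zeta j)
    (\sum_(j < n) dot (eta j) (zeta j)).
Proof.
move=> e oe; have hs := inner_semi (proj1 hH).
rewrite (_ : (fun m => _) = (fun m => \sum_(j < n)
    dot (eta j) (projn (@dot R H) e m (zeta j)))).
  by apply: cvg_complex_sum => j; exact: dot_cvg_projn.
apply/funext => m; under eq_bigr do rewrite (form_sumr hs).
rewrite exchange_big /=; apply: eq_bigr => j _.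
by rewrite form_projn //; apply: eq_bigr => k _; rewrite formZr.
Qed.

Definition closed_subspace H (S : set H) : Prop :=
  [/\ S 0, forall (a : R[i]) u v, S u -> S v -> S (a *: u + v) &
      forall u : H, (forall e : R, 0 < e -> exists2 v, S v & hnorm (u - v) < e) ->
        S u].

(** Stability of [D] under linear combinations is required only up to arbitrarily small errors, so
    that rational combinations qualify although the scalars are complex. *)
Lemma closure_closed_subspace H (D : set H) : is_inner_product H ->
  D 0 -> (forall (a : R[i]) u v (e : R), D u -> D v -> 0 < e ->
    exists2 w, D w & hnorm (a *: u + v - w) < e) ->
  closed_subspace [set u | forall e : R, 0 < e -> exists2 v, D v & hnorm (u - v) < e].
Proof.
move=> HH D0 Dl; have hs := inner_semi HH; split.
- by move=> e e0; exists 0; rewrite // subr0 hnormE seminorm0.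
- move=> a u v Su Sv e e0; have e30 : 0 < e / 3 by rewrite divr_gt0.
  have n0 := normc_ge0 a.
  have d0 : 0 < e / 3 / (normc a + 1) by rewrite divr_gt0 // ltr_pwDr.
  have [u' Du' uu'] := Su _ d0; have [v' Dv' vv'] := Sv _ e30.
  have [w Dw Hw] := Dl a u' v' _ Du' Dv' e30; exists w => //.
  rewrite (_ : a *: u + v - w = a *: (u - u') + ((v - v') + (a *: u' + v' - w))).
    rewrite (le_lt_trans (seminormD hs _ _)) // seminormZ //.
    have := seminormD hs (v - v') (a *: u' + v' - w).
    have : normc a * seminorm (@dot R H) (u - u') <= e / 3.
      move/ltW : uu'; rewrite hnormE ler_pdivlMr ?ltr_pwDr // => uu'.
      rewrite (le_trans _ uu') // mulrC ler_wpM2l ?seminorm_ge0 // lerDl //.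
    by rewrite hnormE in vv'; rewrite hnormE in Hw; lra.
  by rewrite (addrC (a *: u')) -(addrA v') subrKA scalerBr addrACA addKr -addrA.
- move=> u Su e e0; have e20 : 0 < e / 2 by rewrite divr_gt0.
  have [v Sv uv] := Su _ e20; have [w Dw vw] := Sv _ e20; exists w => //.
  rewrite -(subrKA v) (le_lt_trans (seminormD hs _ _)) //.
  by rewrite hnormE in uv; rewrite hnormE in vw; lra.
Qed.

Lemma rat_dense_complex (a : R[i]) (e : R) : 0 < e ->
  exists p q : rat, normc (a - Complex (ratr p) (ratr q)) < e.
Proof.
move=> e0; have e20 : 0 < e / 2 by rewrite divr_gt0.
have H (r : R) : exists p : rat, `|r - ratr p| < e / 2.
  have [p] := @rat_in_itvoo R (r - e / 2) (r + e / 2) ltac:(lra).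
  rewrite in_itv /= => /andP[p1 p2]; exists p.
  by rewrite ltr_norml; apply/andP; split; lra.
have [p Hp] := H (Re a); have [q Hq] := H (Im a); exists p, q.
by rewrite (le_lt_trans (normc_leD _)) // !ReImE /= (splitr e) ltrD.
Qed.

(** An entry holds the real part, the imaginary part and the index. Such lists form a countable
    type, so [pickle] enumerates the combinations. *)
Definition rat_combination H (psi : nat -> H) (s : seq (rat * rat * nat)) : H :=
  \sum_(t <- s) Complex (ratr t.1.1) (ratr t.1.2) *: psi t.2.

Lemma rat_combination_closure H (psi : nat -> H) : is_inner_product H ->
  closed_subspace [set u | forall e : R, 0 < e ->
    exists2 v, range (rat_combination psi) v & hnorm (u - v) < e].
Proof.
move=> HH; have hs := inner_semi HH; apply: closure_closed_subspace => //.
  by exists [::] => //; rewrite /rat_combination big_nil.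
move=> a _ _ e [s _ <-] [t _ <-] e0; set u := rat_combination psi s.
have d0 : 0 < e / (hnorm u + 1) by rewrite divr_gt0 // ltr_pwDr // sqrtr_ge0.
have [p [q Hpq]] := rat_dense_complex a d0.
(* Every coefficient of [s] is multiplied by p + i q. *)
pose s' := [seq (p * x.1.1 - q * x.1.2, p * x.1.2 + q * x.1.1, x.2) | x <- s].
exists (rat_combination psi (s' ++ t)); first by exists (s' ++ t).
have -> : rat_combination psi (s' ++ t) = Complex (ratr p) (ratr q) *: u +
    rat_combination psi t.
  rewrite /rat_combination big_cat /=; congr (_ + _).
  rewrite big_map scaler_sumr; apply: eq_bigr => x _ /=; rewrite scalerA.
  congr (_ *: _); apply: eqC; rewrite !ReImE /=.
    by rewrite rmorphB !rmorphM.
  by rewrite rmorphD !rmorphM.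
rewrite opprD addrACA subrr addr0 -scalerBl hnormE seminormZ //.
move: Hpq; rewrite ltr_pdivlMr ?ltr_pwDr ?sqrtr_ge0 //; apply: le_lt_trans.
by rewrite ler_wpM2l ?normc_ge0 // lerDl.
Qed.

Lemma rat_combination_separable H (psi : nat -> H) :
  (forall (u : H) (e : R), 0 < e ->
    exists2 v, range (rat_combination psi) v & hnorm (u - v) < e) ->
  is_separable H.
Proof.
move=> Hd; exists (fun n => if unpickle n is Some s then rat_combination psi s else 0).
move=> u e e0; have [_ [s _ <-] Hs] := Hd u e e0.
by exists (pickle s); rewrite pickleK.
Qed.

End HilbertSpaceTheory.

(** * Complex integration and L2 *)

Section ComplexMeasurability.
Context d (T : measurableType d) (R : realType).
Implicit Types f g : T -> R[i].

Lemma cmeasurable_cst (a : R[i]) : cmeasurable (fun _ : T => a).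
Proof. by split; exact: measurable_cst. Qed.

Lemma cmeasurableD f g : cmeasurable f -> cmeasurable g ->
  cmeasurable (fun x => f x + g x).
Proof.
move=> [f1 f2] [g1 g2]; split.
  by under eq_fun do rewrite ReD; exact: measurable_funD.
by under eq_fun do rewrite ImD; exact: measurable_funD.
Qed.

Lemma cmeasurableM f g : cmeasurable f -> cmeasurable g ->
  cmeasurable (fun x => f x * g x).
Proof.
move=> [f1 f2] [g1 g2]; split.
  under eq_fun do rewrite ReM.
  by apply: measurable_funB; exact: measurable_funM.
under eq_fun do rewrite ImM.
by apply: measurable_funD; exact: measurable_funM.
Qed.

Lemma cmeasurableZ (a : R[i]) f : cmeasurable f -> cmeasurable (fun x => a * f x).
Proof. by apply: cmeasurableM; exact: cmeasurable_cst. Qed.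

Lemma cmeasurable_conj f : cmeasurable f -> cmeasurable (fun x => conjc (f x)).
Proof.
move=> [f1 f2]; split; first by under eq_fun do rewrite Re_conj.
by under eq_fun do rewrite Im_conj; exact: measurableT_comp.
Qed.

Lemma cmeasurableN f : cmeasurable f -> cmeasurable (fun x => - f x).
Proof.
by move=> mf; under eq_fun do rewrite -mulN1r; exact: cmeasurableZ.
Qed.

Lemma cmeasurableB f g : cmeasurable f -> cmeasurable g ->
  cmeasurable (fun x => f x - g x).
Proof. by move=> mf mg; apply: cmeasurableD => //; exact: cmeasurableN. Qed.

Lemma Re_indic (D : set T) x : Re (\1_D x : R[i]) = \1_D x.
Proof. by rewrite !indicE; case: (x \in D). Qed.

Lemma Im_indic (D : set T) x : Im (\1_D x : R[i]) = 0.
Proof. by rewrite !indicE; case: (x \in D). Qed.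

Lemma conj_indic (D : set T) x : conjc (\1_D x : R[i]) = \1_D x.
Proof. by apply: eqC; rewrite !ReImE // Im_indic oppr0. Qed.

Lemma csqnorm_indic (D : set T) x : csqnorm (\1_D x : R[i]) = \1_D x.
Proof. by rewrite /csqnorm Re_indic Im_indic expr0n addr0 indicE; case: (_ \in _); rewrite ?expr1n ?expr0n. Qed.

Lemma cmeasurable_indic (D : set T) : measurable D ->
  cmeasurable (fun x => \1_D x : R[i]).
Proof.
move=> mD; split; first by under eq_fun do rewrite Re_indic; exact: measurable_indic.
by under eq_fun do rewrite Im_indic; exact: measurable_cst.
Qed.

Lemma cmeasurable_comp d' (T' : measurableType d') (h : T' -> T) f :
  measurable_fun setT h -> cmeasurable f -> cmeasurable (fun x => f (h x)).
Proof. by move=> mh [f1 f2]; split; [exact: (measurableT_comp f1 mh) | exact: (measurableT_comp f2 mh)]. Qed.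

End ComplexMeasurability.

Section ComplexIntegral.
Context d (T : measurableType d) (R : realType).
Variable mu : {measure set T -> \bar R}.
Implicit Types f g : T -> R[i].

Definition cintegrable f : Prop :=
  mu.-integrable setT (fun x => (Re (f x))%:E) /\
  mu.-integrable setT (fun x => (Im (f x))%:E).

Lemma cintegrable_measurable f : cintegrable f -> cmeasurable f.
Proof.
by move=> [/integrableP[f1 _] /integrableP[f2 _]]; split; exact/measurable_EFinP.
Qed.

Lemma cintegrable_le f (h : T -> R) : cmeasurable f ->
  mu.-integrable setT (fun x => (h x)%:E) ->
  (forall x, normc (f x) <= h x) -> cintegrable f.
Proof.
move=> [f1 f2] ih fh.
split; apply: le_integrable ih => //; (try exact/measurable_EFinP) => x _ /=;
  rewrite lee_fin.
- by rewrite (le_trans (ler_normRe _)) // (le_trans (fh x)) // ler_norm.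
- by rewrite (le_trans (ler_normIm _)) // (le_trans (fh x)) // ler_norm.
Qed.

Lemma cintegrable_lin (a : R[i]) f g : cintegrable f -> cintegrable g ->
  cintegrable (fun x => a * f x + g x).
Proof.
move=> [f1 f2] [g1 g2]; split.
  rewrite (_ : (fun x => _) = (fun x => (Re a)%:E * (Re (f x))%:E
    + (- Im a)%:E * (Im (f x))%:E + (Re (g x))%:E)%E); last first.
    by apply/funext => x; rewrite -!EFinM -!EFinD !ReImE; congr (_%:E); ring.
  by do 2!apply: integrableD => //; exact: integrableZl.
rewrite (_ : (fun x => _) = (fun x => (Re a)%:E * (Im (f x))%:E
    + (Im a)%:E * (Re (f x))%:E + (Im (g x))%:E)%E); last first.
  by apply/funext => x; rewrite -!EFinM -!EFinD !ReImE; congr (_%:E); ring.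
by do 2!apply: integrableD => //; exact: integrableZl.
Qed.

Lemma cintegral_lin (a : R[i]) f g : cintegrable f -> cintegrable g ->
  cintegral mu (fun x => a * f x + g x) = a * cintegral mu f + cintegral mu g.
Proof.
move=> [f1 f2] [g1 g2].
have iZ (r : R) (h : T -> R) : mu.-integrable setT (EFin \o h) ->
    mu.-integrable setT (EFin \o (fun x => r * h x)).
  by move=> ih; rewrite (_ : _ \o _ = (fun x => r%:E * (h x)%:E)%E);
    [exact: integrableZl | apply/funext].
apply: eqC; rewrite !ReImE /=.
- rewrite (_ : (fun x => _) = (fun x => Re a * Re (f x) +
    ((- Im a) * Im (f x) + Re (g x)))); last by apply/funext => x; rewrite !ReImE; ring.
  rewrite RintegralD //; [|exact: iZ|]; last first.
    rewrite (_ : _ \o _ = (fun x => ((- Im a) * Im (f x))%:E + (Re (g x))%:E)%E);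
      [apply: integrableD => //; exact: iZ | exact/funext].
  rewrite RintegralD //; [|exact: iZ].
  by rewrite !RintegralZl //; ring.
- rewrite (_ : (fun x => _) = (fun x => Re a * Im (f x) +
    (Im a * Re (f x) + Im (g x)))); last by apply/funext => x; rewrite !ReImE; ring.
  rewrite RintegralD //; [|exact: iZ|]; last first.
    rewrite (_ : _ \o _ = (fun x => (Im a * Re (f x))%:E + (Im (g x))%:E)%E);
      [apply: integrableD => //; exact: iZ | exact/funext].
  rewrite RintegralD //; [|exact: iZ].
  by rewrite !RintegralZl //; ring.
Qed.

Lemma cintegral_conj f : cintegrable f ->
  cintegral mu (fun x => conjc (f x)) = conjc (cintegral mu f).
Proof.
move=> [f1 f2]; apply: eqC; rewrite !ReImE /=.
  by apply: eq_Rintegral => x _; rewrite Re_conj.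
rewrite -mulN1r -RintegralZl //.
by apply: eq_Rintegral => x _; rewrite Im_conj mulN1r.
Qed.

Lemma cintegral_ae f g : cmeasurable f -> cmeasurable g ->
  {ae mu, forall x, f x = g x} -> cintegral mu f = cintegral mu g.
Proof.
move=> [f1 f2] [g1 g2] fg.
rewrite /cintegral /Rintegral; congr (Complex (fine _) (fine _));
  apply: ae_eq_integral => //; try exact/measurable_EFinP;
  by apply: filterS fg => x fg _; rewrite fg.
Qed.

Lemma eq_cintegral f g : f =1 g -> cintegral mu f = cintegral mu g.
Proof. by move=> /funext ->. Qed.

Lemma cintegral0 : cintegral mu (fun=> 0 : R[i]) = 0.
Proof. by rewrite /cintegral /Rintegral !integral0_eq. Qed.

(* The factor 2 comes from estimating real and imaginary parts separately. *)
Lemma normc_cintegral_le f (h : T -> R) : cintegrable f ->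
  mu.-integrable setT (fun x => (h x)%:E) -> (forall x, normc (f x) <= h x) ->
  normc (cintegral mu f) <= 2 * Rintegral mu setT h.
Proof.
move=> [f1 f2] ih fh; rewrite (le_trans (normc_leD _)) //= mulr_natl mulr2n.
apply: lerD; apply: (le_trans (le_normr_Rintegral _ _)) => //.
- apply: le_Rintegral => //; first exact: (@integrable_norm _ _ _ mu setT (fun x => (Re (f x)))).
  by move=> x _; rewrite (le_trans (ler_normRe _)).
- apply: le_Rintegral => //; first exact: (@integrable_norm _ _ _ mu setT (fun x => (Im (f x)))).
  by move=> x _; rewrite (le_trans (ler_normIm _)).
Qed.

Lemma cintegral_dominated (f_ : nat -> T -> R[i]) f (h : T -> R) :
  (forall n, cmeasurable (f_ n)) -> cmeasurable f ->
  (forall x, (fun n => f_ n x) @ \oo --> (f x : R[i]^o)) ->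
  mu.-integrable setT (fun x => (h x)%:E) ->
  (forall n x, normc (f_ n x) <= h x) ->
  (fun n => cintegral mu (f_ n)) @ \oo --> (cintegral mu f : R[i]^o).
Proof.
move=> mf_ mf ff ih fh.
have H (F : R[i] -> R) : (forall w, `|F w| <= normc w) ->
   (forall n, measurable_fun setT (fun x => F (f_ n x))) ->
   measurable_fun setT (fun x => F (f x)) ->
   (forall x, (fun n => F (f_ n x)) @ \oo --> F (f x)) ->
   (fun n => Rintegral mu setT (fun x => F (f_ n x))) @ \oo -->
     Rintegral mu setT (fun x => F (f x)).
  move=> Fn m1 m2 Fc.
  have [i1 _ i2] : [/\ mu.-integrable setT (fun x => (F (f x))%:E),
    [sequence \int[mu]_(x in setT) (`|(F (f_ n x))%:E - (F (f x))%:E|)]_n @ \oo --> 0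
    & [sequence \int[mu]_(x in setT) (F (f_ n x))%:E]_n @ \oo -->
    \int[mu]_(x in setT) (F (f x))%:E]%E.
    apply: (@dominated_convergence _ _ _ mu setT _ (fun n x => (F (f_ n x))%:E)
      (fun x => (F (f x))%:E) (fun x => (h x)%:E)) => //.
    - by move=> n; exact/measurable_EFinP.
    - exact/measurable_EFinP.
    - by apply: aeW => x _; apply: cvg_EFin; [exact: nearW | exact: Fc].
    - by apply: aeW => x n _; rewrite lee_fin (le_trans (Fn _)).
  apply: fine_cvg; rewrite fineK //; exact: integrable_fin_num.
apply/cvg_ReImP; split; apply: H.
- exact: ler_normRe.
- by move=> n; case: (mf_ n).
- by case: mf.
- by move=> x; have /cvg_ReImP[] := ff x.
- exact: ler_normIm.
- by move=> n; case: (mf_ n).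
- by case: mf.
- by move=> x; have /cvg_ReImP[] := ff x.
Qed.

Lemma square_integrableP f : square_integrable mu f <->
  cmeasurable f /\ mu.-integrable setT (fun x => (csqnorm (f x))%:E).
Proof.
split=> [[mf If]|[mf /integrableP[_ If]]]; split => //.
  apply/integrableP; split; first exact/measurable_EFinP/cmeasurable_sqnorm.
  apply: le_lt_trans If; apply: ge0_le_integral => //.
  - by do 2!apply: measurableT_comp => //; exact: cmeasurable_sqnorm.
  - by apply/measurable_EFinP/cmeasurable_sqnorm.
  - by move=> x _; rewrite gee0_abs // lee_fin csqnorm_ge0.
apply: le_lt_trans If; apply: ge0_le_integral => //.
- by move=> x _; rewrite lee_fin csqnorm_ge0.
- by apply/measurable_EFinP/cmeasurable_sqnorm.
- by do 2!apply: measurableT_comp => //; exact: cmeasurable_sqnorm.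
- by move=> x _; rewrite lee_abs.
Qed.

Lemma normc_le_csqnorm (z w : R[i]) : normc (conjc z * w) <= csqnorm z + csqnorm w.
Proof.
rewrite normcM normc_conj -!sqr_normcE.
by have := normc_ge0 z; have := normc_ge0 w; have := sqr_ge0 (normc z - normc w); nra.
Qed.

Lemma cintegrable_conjM f g : square_integrable mu f -> square_integrable mu g ->
  cintegrable (fun x => conjc (f x) * g x).
Proof.
move=> /square_integrableP[mf If] /square_integrableP[mg Ig].
apply: (@cintegrable_le _ (fun x => csqnorm (f x) + csqnorm (g x))).
- by apply: cmeasurableM => //; exact: cmeasurable_conj.
- rewrite (_ : (fun x => _) = (fun x => (csqnorm (f x))%:E + (csqnorm (g x))%:E)%E) //.
  exact: integrableD.
- by move=> x; exact: normc_le_csqnorm.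
Qed.

Lemma square_integrable_le f g : cmeasurable f -> square_integrable mu g ->
  (forall x, csqnorm (f x) <= csqnorm (g x)) -> square_integrable mu f.
Proof.
move=> mf [mg Ig] fg; split => //; apply: le_lt_trans Ig.
apply: ge0_le_integral => //.
- by move=> x _; rewrite lee_fin csqnorm_ge0.
- by apply/measurable_EFinP/cmeasurable_sqnorm.
- by apply/measurable_EFinP/cmeasurable_sqnorm.
- by move=> x _; rewrite lee_fin.
Qed.

Lemma square_integrable_lin (a : R[i]) f g : square_integrable mu f ->
  square_integrable mu g -> square_integrable mu (fun x => a * f x + g x).
Proof.
move=> sf sg.
have : (a *: (f : T -> R[i]^o) + g) \in L2fun mu.
  by case: (L2fun_submod_closed mu) => _; apply; exact/asboolP.
by move/asboolP.
Qed.

Lemma square_integrable0 : square_integrable mu (fun=> 0 : R[i]).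
Proof. by have : 0 \in L2fun mu by [apply: rpred0]; move/asboolP. Qed.

Lemma square_integrableZ (a : R[i]) f : square_integrable mu f ->
  square_integrable mu (fun x => a * f x).
Proof.
move=> sf; have := square_integrable_lin a sf square_integrable0.
by under eq_fun do rewrite addr0.
Qed.

Lemma square_integrableB f g : square_integrable mu f ->
  square_integrable mu g -> square_integrable mu (fun x => f x - g x).
Proof.
move=> sf sg; under eq_fun do rewrite addrC -mulN1r.
exact: square_integrable_lin.
Qed.

Lemma square_integrable_indic (D : set T) f : measurable D ->
  square_integrable mu f -> square_integrable mu (fun x => \1_D x * f x).
Proof.
move=> mD sf; apply: (square_integrable_le _ sf).
  by apply: cmeasurableM (proj1 sf); exact: cmeasurable_indic.
move=> x; rewrite csqnormM csqnorm_indic indicE; case: (_ \in _) => /=.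
  by rewrite mul1r.
by rewrite mul0r csqnorm_ge0.
Qed.

Lemma square_integrable_ae f g : cmeasurable g -> square_integrable mu f ->
  {ae mu, forall x, f x = g x} -> square_integrable mu g.
Proof.
move=> mg [mf If] fg; split => //.
rewrite -(@ge0_ae_eq_integral _ _ _ mu setT (fun x => (csqnorm (f x))%:E)) //.
- by apply/measurable_EFinP/cmeasurable_sqnorm.
- by apply/measurable_EFinP/cmeasurable_sqnorm.
- by move=> x _; rewrite lee_fin csqnorm_ge0.
- by move=> x _; rewrite lee_fin csqnorm_ge0.
- by apply: filterS fg => x -> _.
Qed.

End ComplexIntegral.

Section L2Space.
Context d (T : measurableType d) (R : realType).
Variable mu : {measure set T -> \bar R}.
Implicit Types (f g : T -> R[i]) (u v : L2 mu).

Local Notation N := (@L2null d T R mu).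
Local Notation cl := (\pi_(lmod_quot N))%qT.

Lemma square_integrable_repr u : square_integrable mu (L2repr u).
Proof. by have := valP (repr (u : lmod_quot _)) => /asboolP. Qed.

Lemma cl_reprK u : cl (repr (u : lmod_quot N)) = u :> L2 mu.
Proof. exact: reprK. Qed.

Lemma cl_repr_ae (w : L2fun_type mu) :
  {ae mu, forall x, L2repr (cl w) x = val w x}.
Proof.
have /asboolP := @quot_reprP _ _ N w; apply: filterS => x.
by rewrite /= !fctE => /eqP; rewrite subr_eq0 => /eqP.
Qed.

Lemma L2class_repr_ae f : square_integrable mu f ->
  {ae mu, forall x, L2repr (L2class mu f) x = f x}.
Proof.
move=> sf; apply: filterS (cl_repr_ae (insubd 0 f)) => x ->.
by rewrite insubdK //; exact/asboolP.
Qed.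

Lemma L2_ext u v : {ae mu, forall x, L2repr u x = L2repr v x} -> u = v.
Proof.
move=> uv; rewrite -[u]cl_reprK -[v]cl_reprK.
apply/quot_eqP/asboolP; apply: filterS uv => x uv.
by rewrite /= !fctE; move: uv; rewrite /L2repr => ->; rewrite subrr.
Qed.

Lemma L2class_repr u : L2class mu (L2repr u) = u.
Proof. by apply: L2_ext; apply: L2class_repr_ae; exact: square_integrable_repr. Qed.

Lemma L2class_eq f g : square_integrable mu f -> square_integrable mu g ->
  {ae mu, forall x, f x = g x} -> L2class mu f = L2class mu g.
Proof.
move=> sf sg fg; apply: L2_ext.
by apply: filterS3 fg (L2class_repr_ae sf) (L2class_repr_ae sg) => x fg -> ->.
Qed.

Lemma L2repr_lin (a : R[i]) u v :
  {ae mu, forall x, L2repr (a *: u + v) x = a * L2repr u x + L2repr v x}.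
Proof.
have E : a *: u + v = cl (a *: repr (u : lmod_quot N) +
    repr (v : lmod_quot N)).
  rewrite -{1}[u]cl_reprK -{1}[v]cl_reprK.
  by rewrite -[LHS]/(quot_add (quot_scale _ _) _) quot_scaleE quot_addE.
by rewrite E; apply: filterS (cl_repr_ae (a *: repr (u : lmod_quot N) + repr (v : lmod_quot N))) => x ->.
Qed.

Lemma L2repr_sub u v :
  {ae mu, forall x, L2repr (u - v) x = L2repr u x - L2repr v x}.
Proof.
have := L2repr_lin (-1) v u; rewrite scaleN1r addrC; apply: filterS => x ->.
by rewrite mulN1r addrC.
Qed.

Lemma L2repr0 : {ae mu, forall x, L2repr (0 : L2 mu) x = 0}.
Proof.
have := L2repr_sub 0 0; rewrite subr0; apply: filterS => x ->.
by rewrite subrr.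
Qed.

Lemma L2class_lin (a : R[i]) f g : square_integrable mu f ->
  square_integrable mu g ->
  L2class mu (fun x => a * f x + g x) = a *: L2class mu f + L2class mu g.
Proof.
move=> sf sg; apply: L2_ext.
have := L2class_repr_ae (square_integrable_lin a sf sg).
apply: filterS3 (L2repr_lin a (L2class mu f) (L2class mu g))
  (filterI (L2class_repr_ae sf) (L2class_repr_ae sg)) => x E1 [E2 E3] E4.
by rewrite E4 E1 E2 E3.
Qed.

Lemma L2class0 : L2class mu (fun=> 0) = 0.
Proof.
apply: L2_ext.
by apply: filterS2 (L2class_repr_ae (square_integrable0 mu)) L2repr0 => x -> ->.
Qed.

Lemma L2classZ (a : R[i]) f : square_integrable mu f ->
  L2class mu (fun x => a * f x) = a *: L2class mu f.
Proof.
move=> sf; rewrite -[RHS]addr0 -L2class0 -L2class_lin //; last first.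
  exact: square_integrable0.
by congr L2class; apply/funext => x; rewrite addr0.
Qed.

Lemma L2class_sub f g : square_integrable mu f -> square_integrable mu g ->
  L2class mu (fun x => f x - g x) = L2class mu f - L2class mu g.
Proof.
move=> sf sg; rewrite addrC -scaleN1r -L2class_lin //; congr L2class.
by apply/funext => x; rewrite mulN1r addrC.
Qed.

Let H := L2space mu.

Lemma L2dotE (u v : H) :
  dot u v = cintegral mu (fun x => conjc (L2repr u x) * L2repr v x).
Proof. by []. Qed.

Lemma dot_ae (u v : H) f g : cmeasurable f -> cmeasurable g ->
  {ae mu, forall x, L2repr u x = f x} -> {ae mu, forall x, L2repr v x = g x} ->
  dot u v = cintegral mu (fun x => conjc (f x) * g x).
Proof.
move=> mf mg uf vg; apply: cintegral_ae.
- apply: cmeasurableM; first apply: cmeasurable_conj.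
    by case: (square_integrable_repr u).
  by case: (square_integrable_repr v).
- by apply: cmeasurableM => //; exact: cmeasurable_conj.
- by apply: filterS2 uf vg => x -> ->.
Qed.

Lemma dot_class f g : square_integrable mu f -> square_integrable mu g ->
  dot (L2class mu f : H) (L2class mu g) =
  cintegral mu (fun x => conjc (f x) * g x).
Proof.
move=> sf sg; apply: dot_ae; (try by case: sf); (try by case: sg);
  exact: L2class_repr_ae.
Qed.

Lemma cintegral_csqnorm f :
  cintegral mu (fun x => conjc (f x) * f x) =
  (Rintegral mu setT (fun x => csqnorm (f x)))%:C%C.
Proof.
rewrite (eq_cintegral mu (fun x => conjM_csqnorm (f x))).
apply: eqC => //=; rewrite /Rintegral integral0_eq //.
Qed.

Lemma L2_inner_product : is_inner_product H.
Proof.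
split=> [a u v w|u v|u|u].
- have su := square_integrable_repr u; have sv := square_integrable_repr v.
  have sw := square_integrable_repr w.
  rewrite (dot_ae (proj1 su) _ (aeW _ (fun=> erefl)) (L2repr_lin a v w)); last first.
    exact: (proj1 (square_integrable_lin a sv sw)).
  rewrite -cintegral_lin; try exact: cintegrable_conjM.
  by apply: eq_cintegral => x; ring.
- rewrite !L2dotE -cintegral_conj; last first.
    by apply: cintegrable_conjM; exact: square_integrable_repr.
  by apply: eq_cintegral => x; rewrite rmorphM /= conjcK mulrC.
- rewrite L2dotE cintegral_csqnorm ler0c.
  by apply: Rintegral_ge0 => x _; exact: csqnorm_ge0.
- rewrite L2dotE cintegral_csqnorm => /(congr1 (@complex.Re R)) /= u0.
  apply: L2_ext.
  have /square_integrableP[mu1 iu] := square_integrable_repr u.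
  have ae0 : ae_eq mu setT (fun x => (csqnorm (L2repr u x))%:E) (cst 0%E).
    apply/ae_eq_integral_abs => //; first exact/measurable_EFinP/cmeasurable_sqnorm.
    rewrite -[RHS]/(0%:E) -u0 /Rintegral fineK; last exact: integrable_fin_num.
    by apply: eq_integral => x _; rewrite gee0_abs // lee_fin csqnorm_ge0.
  apply: filterS2 ae0 L2repr0 => x /(_ I) [ux0] ->.
  by apply: eq0_normc; rewrite normc_sqrt ux0 sqrtr0.
Qed.

Lemma hnorm_ae (u : H) f : cmeasurable f -> {ae mu, forall x, L2repr u x = f x} ->
  hnorm u ^+ 2 = Rintegral mu setT (fun x => csqnorm (f x)).
Proof.
move=> mf uf; apply: (@complexI R).
rewrite -(sqr_hnorm L2_inner_product) (dot_ae mf mf uf uf).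
exact: cintegral_csqnorm.
Qed.

Lemma hnorm_class f : square_integrable mu f ->
  hnorm (L2class mu f : H) ^+ 2 = Rintegral mu setT (fun x => csqnorm (f x)).
Proof.
by move=> sf; apply: hnorm_ae; [case: sf | exact: L2class_repr_ae].
Qed.

Lemma integral_hnorm (u : H) f : cmeasurable f ->
  {ae mu, forall x, L2repr u x = f x} ->
  (\int[mu]_x (csqnorm (f x))%:E = (hnorm u ^+ 2)%:E)%E.
Proof.
move=> mf uf; rewrite (hnorm_ae mf uf) /Rintegral fineK //.
apply: integrable_fin_num => //.
by have /square_integrableP[] := square_integrable_ae mf (square_integrable_repr u) uf.
Qed.

(** Fatou's lemma for the sequence shifted by [K], since the bound on the integrals is known only
    from that index on. *)
Lemma fatou_cvg (h : nat -> T -> \bar R) (hl : T -> \bar R) (C : \bar R) (K : nat) :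
  (forall k, measurable_fun setT (h k)) -> (forall k x, 0 <= h k x)%E ->
  measurable_fun setT hl -> (forall x, 0 <= hl x)%E ->
  {ae mu, forall x, h ^~ x @ \oo --> hl x} ->
  (forall k, (K <= k)%N -> \int[mu]_x h k x <= C)%E ->
  (\int[mu]_x hl x <= C)%E.
Proof.
move=> mh h0 mhl hl0 hhl hC; pose h' k := h (k + K)%N.
have einf0 x : (0 <= limn_einf (h' ^~ x))%E.
  rewrite limn_einf_lim; apply: lime_ge; first exact: is_cvg_einfs.
  by apply: nearW => n; apply: le_ereal_inf_tmp => _ [m /= _ <-]; exact: h0.
have meinf : measurable_fun setT (fun x => limn_einf (h' ^~ x)).
  rewrite /limn_einf; apply: measurableT_comp => //.
  by apply: measurable_fun_limn_esup => k; apply: measurableT_comp => //; exact: mh.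
rewrite (@ge0_ae_eq_integral _ _ _ mu setT hl (fun x => limn_einf (h' ^~ x))) //; last first.
  apply: filterS hhl => x hx _; apply/esym.
  have : h' ^~ x @ \oo --> hl x by rewrite /h' (cvg_shiftn K (h ^~ x)).
  by move=> /cvg_limn_einf_sup[].
apply: (le_trans (fatou mu measurableT _ _)); first by move=> k; exact: mh.
  by move=> k x _; exact: h0.
rewrite limn_einf_lim; apply: lime_le; first exact: is_cvg_einfs.
apply: nearW => n; apply: (@le_trans _ _ (\int[mu]_x h' n x)%E).
  by apply: ereal_inf_lbound; exists n => //=.
by apply: hC; rewrite leq_addl.
Qed.

Lemma geometric_step_cvg (w : nat -> R[i]) (c : R) : 0 <= c ->
  (forall k, 4 ^+ k * csqnorm (w k.+1 - w k) <= c) ->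
  exists t : R[i], w @ \oo --> (t : R[i]^o).
Proof.
move=> c0 wc.
(* Here c + 1 serves as an upper bound for the square root of [c]. *)
have step k : normc (w k.+1 - w k) <= (c + 1) * 2^-1 ^+ k.
  rewrite -(@ler_pXn2r _ 2) ?nnegrE ?normc_ge0 ?mulr_ge0 ?exprn_ge0 ?addr_ge0 //.
  rewrite sqr_normcE exprMn -exprM mulnC exprM.
  rewrite (_ : 2^-1 ^+ 2 = 4^-1 :> R); last by field.
  rewrite exprVn ler_pdivlMr ?exprn_gt0 // mulrC (le_trans (wc k)) //.
  by have := c0; nra.
have dist n k : normc (w n - w (n + k)%N) <= (c + 1) * (2 * 2^-1 ^+ n - 2 * 2^-1 ^+ (n + k)).
  elim: k => [|k IH]; first by rewrite addn0 !subrr mulr0 normc0.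
  rewrite addnS (_ : w n - _ = (w n - w (n + k)%N) - (w (n + k).+1 - w (n + k)%N)); last by ring.
  rewrite (le_trans (le_normcD _ _)) // normcN (le_trans (lerD IH (step _))) //.
  by rewrite le_eqVlt exprS; apply/orP; left; apply/eqP; field.
apply: complex_cauchy_cvg => e e0.
have : (fun n => geometric (2 * (c + 1)) (2^-1 : R) n) @ \oo --> 0.
  by apply: cvg_geometric; rewrite ger0_norm // invf_lt1 // ltr1n.
move/cvgrPdist_lt => /(_ _ e0) [N _ HN]; exists N => n Nn.
have := HN N (leqnn N); rewrite sub0r normrN /= ger0_norm; last first.
  by rewrite mulr_ge0 ?exprn_ge0 // mulr_ge0 // addr_ge0.
apply: le_lt_trans; rewrite -(subnKC Nn) (le_trans (dist _ _)) //.
rewrite [leRHS](_ : _ = (c + 1) * (2 * 2^-1 ^+ N)); last by ring.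
rewrite ler_wpM2l ?addr_ge0 // lerBlDr lerDl.
by rewrite mulr_ge0 // exprn_ge0.
Qed.

(* Riesz-Fischer: a subsequence with geometric steps converges almost          *)
(* everywhere, and Fatou's lemma identifies its pointwise limit as the L2 limit. *)
Lemma L2_complete : is_complete H.
Proof.
move=> u_ uc; have ip := L2_inner_product.
have q0 k : 0 < 4^-1 ^+ k :> R by rewrite exprn_gt0 // invr_gt0.
pose N_ k := projT1 (cid (uc _ (q0 k))).
have HN k m n : (N_ k <= m)%N -> (N_ k <= n)%N ->
    hnorm (u_ m - u_ n) < 4^-1 ^+ k := projT2 (cid (uc _ (q0 k))) m n.
(* Summing successors makes [phi] strictly increasing and at least [N_ k], so consecutive terms of
   the subsequence are closer than 4^-k. *)
pose phi k := (\sum_(j < k.+1) (N_ j).+1)%N.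
have phiS k : (phi k <= phi k.+1)%N by rewrite /phi [leqRHS]big_ord_recr leq_addr.
have phiS' k : (phi k < phi k.+1)%N by rewrite /phi [ltnRHS]big_ord_recr /= addnS ltnS leq_addr.
have phiN k : (N_ k <= phi k)%N by rewrite /phi big_ord_recr /= addnS (leq_trans (leq_addl _ _) (leqnSn _)).
pose f k := L2repr (u_ (phi k)).
have sf k : square_integrable mu (f k) := square_integrable_repr _.
pose g k x := csqnorm (f k.+1 x - f k x).
have g0 k x : 0 <= g k x := csqnorm_ge0 _.
have mg k : measurable_fun setT (g k).
  by apply: cmeasurable_sqnorm; apply: cmeasurableB; [case: (sf k.+1) | case: (sf k)].
have ig k : (\int[mu]_x (g k x)%:E <= (16^-1 ^+ k)%:E)%E.
  rewrite (@integral_hnorm (u_ (phi k.+1) - u_ (phi k)) (fun x => f k.+1 x - f k x)).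
  - rewrite lee_fin (_ : 16^-1 = 4^-1 ^+ 2 :> R); last by field.
    rewrite -exprM mulnC exprM lerXn2r ?nnegrE ?sqrtr_ge0 ?exprn_ge0 //.
    by apply/ltW/HN => //; exact: leq_trans (phiS k).
  - by apply: cmeasurableB; [case: (sf k.+1) | case: (sf k)].
  - exact: L2repr_sub.
(* The squared steps have integral at most 16^-k; after weighting by 4^k they are still summable. So
   [S] is finite almost everywhere, and there it dominates every weighted step, as
   [geometric_step_cvg] requires. *)
pose S x := (\sum_(0 <= k <oo) ((4 ^+ k * g k x)%:E))%E.
have mS k : measurable_fun setT (fun x => (4 ^+ k * g k x)%:E).
  by apply/measurable_EFinP; apply: measurable_funM => //; exact: measurable_cst.
have pS k x : (0 <= (4 ^+ k * g k x)%:E)%E by rewrite lee_fin mulr_ge0 ?exprn_ge0.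
have iS : (\int[mu]_x S x <= 2%:E)%E.
  rewrite integral_nneseries //.
  apply: lime_le; first by apply: is_cvg_nneseries => n _ _; exact: integral_ge0.
  apply: nearW => n.
  have : (\sum_(0 <= k < n) \int[mu]_x (4 ^+ k * g k x)%:E <=
          (2 - 2 * 4^-1 ^+ n)%:E)%E.
    elim: n => [|n IH]; first by rewrite big_geq // expr0 mulr1 subrr.
    rewrite big_nat_recr //=; apply: (le_trans (leeD IH _)).
      rewrite (_ : (\int[mu]_x _ = (4 ^+ n)%:E * \int[mu]_x (g n x)%:E)%E); last first.
        rewrite -ge0_integralZl_EFin ?exprn_ge0 //.
          by move=> x _; rewrite lee_fin.
        exact/measurable_EFinP.
      apply: (lee_wpmul2l _ (ig n)); by rewrite lee_fin exprn_ge0.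
    rewrite -EFinM -EFinD lee_fin exprS -exprMn.
    rewrite (_ : 4 * 16^-1 = 4^-1 :> R); last by field.
    by have := q0 n; lra.
  by move=> /le_trans; apply; rewrite lee_fin lerBlDr lerDl mulr_ge0 // exprn_ge0.
have aeS : {ae mu, forall x, exists t, (fun k => f k x) @ \oo --> (t : R[i]^o)}.
  have mSS : measurable_fun setT S by apply: ge0_emeasurable_fun_sum.
  have S0 x : (0 <= S x)%E by apply: nneseries_ge0.
  have : mu.-integrable setT S.
    apply/integrableP; split => //; apply: (@le_lt_trans _ _ 2%:E); last exact: ltry.
    by under eq_integral do rewrite gee0_abs //.
  move/(integrable_ae measurableT); apply: filterS => x /(_ I) Sx.
  apply: (@geometric_step_cvg _ (fine (S x))); first exact: fine_ge0.
  move=> k; rewrite -lee_fin fineK //.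
  have := @nneseries_lim_ge _ (fun k => (4 ^+ k * g k x)%:E) xpredT 0 k.+1 (fun n _ _ => pS n x).
  apply: le_trans; rewrite big_nat_recr //= leeDr //.
  by apply: sume_ge0.
(* Upper limits make [l] measurable everywhere; it is the actual limit only where the subsequence
   converges. *)
pose l x := Complex (fine (limn_esup (fun k => (Re (f k x))%:E)))
                    (fine (limn_esup (fun k => (Im (f k x))%:E))).
have ml : cmeasurable l.
  split; apply: (measurableT_comp (fine_measurable _)) => //;
    apply: measurable_fun_limn_esup => k; apply/measurable_EFinP;
    by case: (sf k) => [[]].
have lim_EFin (w : nat -> R) (t : R) : w @ \oo --> t ->
    limn_esup (fun k => (w k)%:E) = t%:E.
  move=> wt; have : (fun k => (w k)%:E) @ \oo --> t%:E.
    by apply: cvg_EFin; [exact: nearW|].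
  by move=> /cvg_limn_einf_sup[].
have fl : {ae mu, forall x, (fun k => f k x) @ \oo --> (l x : R[i]^o)}.
  apply: filterS aeS => x [t ft]; rewrite (_ : l x = t) //.
  move/cvg_ReImP : ft => [t1 t2]; apply: eqC => /=.
    by rewrite (lim_EFin _ _ t1).
  by rewrite (lim_EFin _ _ t2).
(* Fatou along the subsequence passes the Cauchy estimate to [l]. One instance shows that [l] is
   square-integrable, the others give convergence of the whole sequence. *)
have close e N : 0 < e -> (forall m n, (N <= m)%N -> (N <= n)%N ->
    hnorm (u_ m - u_ n) < e) -> forall n, (N <= n)%N ->
    (\int[mu]_x (csqnorm (l x - L2repr (u_ n) x))%:E <= (e ^+ 2)%:E)%E.
  move=> e0 HNe n Nn; have [mun _] := square_integrable_repr (u_ n).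
  pose h k x := (csqnorm (f k x - L2repr (u_ n) x))%:E.
  have mh k : measurable_fun setT (h k).
    apply/measurable_EFinP/cmeasurable_sqnorm/cmeasurableB => //.
    by case: (sf k).
  have h0 k x : (0 <= h k x)%E by rewrite lee_fin csqnorm_ge0.
  apply: (fatou_cvg (h := h) (hl := fun x => (csqnorm (l x - L2repr (u_ n) x))%:E) (K := N) mh h0).
  - by apply/measurable_EFinP/cmeasurable_sqnorm/cmeasurableB.
  - by move=> x; rewrite lee_fin csqnorm_ge0.
  - apply: filterS fl => x lx; apply: cvg_EFin; first exact: nearW.
    rewrite /comp /=; apply: (@cvg_csqnorm _ _ _ _ (fun k => f k x - L2repr (u_ n) x)).
    exact: cvg_complexB lx (@cvg_complex_cst _ _ _ _ _).
  - move=> k Nk; rewrite (@integral_hnorm (u_ (phi k) - u_ n)); last first.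
    + exact: L2repr_sub.
    + by apply: cmeasurableB => //; case: (sf k).
    rewrite lee_fin lerXn2r ?nnegrE ?sqrtr_ge0 ?(ltW e0) //.
    apply/ltW/HNe => //; rewrite (leq_trans Nk) //.
    by elim: k {Nk} => [|k IH]; rewrite // (leq_ltn_trans IH) // phiS'.
have sl : square_integrable mu l.
  have [N HN1] := uc 1 ltr01.
  have sN : square_integrable mu (fun x => l x - L2repr (u_ N) x).
    split; first by apply: cmeasurableB => //; case: (square_integrable_repr (u_ N)).
    exact: le_lt_trans (close _ _ ltr01 HN1 N (leqnn N)) (ltry _).
  have -> : l = fun x => 1 * (l x - L2repr (u_ N) x) + L2repr (u_ N) x.
    by apply/funext => x; rewrite mul1r subrK.
  by apply: square_integrable_lin => //; exact: square_integrable_repr.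
exists (L2class mu l) => e e0.
have e20 : 0 < e / 2 by rewrite divr_gt0.
have [N HNe] := uc _ e20; exists N => n Nn.
apply: (@le_lt_trans _ _ (e / 2)); last by rewrite gtr_pMr // invf_lt1 // ltr1n.
rewrite -(@ler_pXn2r _ 2) ?nnegrE ?sqrtr_ge0 ?(ltW e20) // -lee_fin.
have inner := inner_semi ip.
rewrite hnormE (seminormB inner) -hnormE.
have := close _ _ e20 HNe n Nn; rewrite (@integral_hnorm (L2class mu l - u_ n)) //.
  by apply: cmeasurableB; [case: sl | case: (square_integrable_repr (u_ n))].
by apply: filterS2 (L2repr_sub (L2class mu l) (u_ n)) (L2class_repr_ae sl) => x -> ->.
Qed.

Lemma L2_hilbert : is_hilbert H.
Proof. by split; [exact: L2_inner_product | exact: L2_complete]. Qed.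

End L2Space.

(** * Radon measures on locally compact spaces *)

Section LocallyCompactHausdorff.
Context (X : topologicalType) (R : realType).
Hypotheses (Xh : hausdorff_space X) (Xlc : locally_compact [set: X]).

Local Notation opc := (one_point_compactification X).

Lemma opc_normal : normal_space opc.
Proof.
apply: compact_normal; first exact: one_point_compactification_hausdorff.
exact: one_point_compactification_compact.
Qed.

Lemma closed_some_compact (K : set X) : compact K -> closed (Some @` K : set opc).
Proof.
move=> cK; apply: compact_closed; first exact: one_point_compactification_hausdorff.
apply: (@continuous_compact X opc Some K) => //.
by apply: continuous_subspaceT; exact: one_point_compactification_some_continuous.
Qed.

(** The one-point compactification is normal, and in it [K] and the complement of [U] are disjoint
    closed sets, the latter containing the point at infinity. The separating function vanishes at
    infinity, which is what makes the support compact. *)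
Lemma Urysohn_compact (K U : set X) : compact K -> open U -> K `<=` U ->
  exists f : X -> R, [/\ continuous f, forall x, 0 <= f x <= 1,
    forall x, K x -> f x = 1, forall x, ~ U x -> f x = 0 &
    compact (closure [set x | f x != 0])].
Proof.
move=> cK oU KU.
have cU : closed (~` (Some @` U) : set opc).
  by apply: open_closedC; exact: one_point_compactification_open_some.
have disj : (~` (Some @` U) : set opc) `&` Some @` K = set0.
  by rewrite -subset0 => o [nUo [x Kx E]]; apply: nUo; exists x => //; exact: KU.
have [g [cg g0 g1 g01]] := @urysohn_ext_itv opc R opc_normal _ _ 0 1 cU
  (closed_some_compact cK) disj ltr01.
have gK x : K x -> g (Some x) = 1 by move=> Kx; apply: g1; exists (Some x) => //; exists x.
have gU x : ~ U x -> g (Some x) = 0.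
  by move=> Ux; apply: g0; exists (Some x) => //= -[y Uy [yx]]; apply: Ux; rewrite -yx.
have gN : g None = 0 by apply: g0; exists None => //= -[].
have g01' o : 0 <= g o <= 1.
  have H : range g (g o) by exists o.
  by have := g01 _ H; rewrite /= in_itv.
have cgS : continuous (g \o Some).
  by move=> x; apply: continuous_comp; [exact: one_point_compactification_some_continuous | exact: cg].
(* Vanishing at infinity does not bound the support of [g] itself; cutting at height 1/2 confines
   the support of [f] to the set where g >= 1/2, which lies in a compact set. *)
pose f x := Num.max 0 (2 * g (Some x) - 1).
exists f; split.
- move=> x; rewrite /f; apply: (@continuous_max _ _ (fun=> 0) (fun x => 2 * g (Some x) - 1)).
    exact: cvg_cst.
  apply: cvgB; last exact: cvg_cst.
  by apply: cvgM; [exact: cvg_cst | exact: cgS].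
- move=> x; rewrite /f le_max lexx /= ge_max ler01 /=.
  by have /andP[_] := g01' (Some x); lra.
- by move=> x Kx; rewrite /f gK //; rewrite max_r; lra.
- by move=> x Ux; rewrite /f gU //; rewrite max_l; lra.
have : \forall o \near (None : opc), g o < 2^-1.
  have := cg None => /cvgrPdist_lt /(_ 2^-1).
  rewrite invr_gt0 ltr0n => /(_ isT); apply: filterS => o Ho.
  have {Ho} : `|g None - g o| < 2^-1 := Ho.
  by rewrite gN sub0r normrN; apply: le_lt_trans; exact: ler_norm.
move=> [W [cW _] Wg].
have cl2 : closed [set x | 2^-1 <= g (Some x)].
  by apply: (@closed_comp _ _ (g \o Some) [set r | 2^-1 <= r]) => // ? ?; exact: cgS.
apply: (@subclosed_compact _ _ W); [exact: closed_closure | exact: cW |].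
apply: (@subset_trans _ [set x | 2^-1 <= g (Some x)]).
  rewrite [X in _ `<=` X](closure_id _).1 //; apply: closureS => x /=.
  by rewrite /f; apply: contraNT; rewrite -ltNge => gx; apply/eqP; rewrite max_l //; lra.
move=> x /= gx; apply: contrapT => Wx.
have : g (Some x) < 2^-1 by apply: Wg; left; exists x.
by rewrite ltNge gx.
Qed.

Lemma Tietze_compact (C : set X) (f : X -> R) : compact C ->
  {within C, continuous f} ->
  exists g : X -> R, continuous g /\ forall x, C x -> g x = f x.
Proof.
move=> cC cf; pose f' (o : opc) : R := if o is Some x then f x else 0.
have cf' : {within (Some @` C : set opc), continuous (f' : opc -> R)}.
  apply/subspace_continuousP => _ [x Cx <-].
  move/subspace_continuousP : cf => /(_ x Cx) fx A /fx.
  rewrite /within /= /nbhs /=; apply: filterS => y Ay [z Cz [zy]].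
  by apply: Ay; rewrite -zy.
have [M [M0 fM]] : exists M : R, 0 < M /\ forall x, C x -> `|f x| <= M.
  have [M [_ HM]] := compact_bounded (continuous_compact cf cC).
  exists (`|M| + 1); split; first by rewrite ltr_pwDr.
  move=> x Cx; apply: HM; last by exists x.
  by rewrite (le_lt_trans (ler_norm M)) // ltrDl.
have [|g [gf cg _]] := @continuous_bounded_extension opc R opc_normal _
    (closed_some_compact cC) f' M M0 cf'.
  by move=> _ [x Cx <-]; exact: fM.
exists (g \o Some); split.
  by move=> x; apply: continuous_comp; [exact: one_point_compactification_some_continuous | exact: cg].
by move=> x Cx; rewrite /= -gf //; apply/mem_set; exists x.
Qed.

(** A filter on [A] pushed forward to [X] clusters in [K], and closedness of [A] keeps a cluster
    point inside [A]. *)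
Lemma compact_preimage_set_val (A K : set X) : closed A -> compact K ->
  compact (set_val @^-1` K : set A).
Proof.
move=> cA cK F PF FK.
have valA (a : A) : A (set_val a) by case: a => z zA; exact: set_mem zA.
have PG : ProperFilter (set_val @ F) by exact: fmap_proper_filter.
have [|p [[Kp Ap] Fp]] := compact_closedI cK cA PG.
  have : F (set_val @^-1` (K `&` A)).
    by apply: filterS FK => a Ka; split; [exact: Ka | exact: valA].
  by [].
exists (exist _ p (mem_set Ap)); split => //.
move=> B D FB [_ [[W oW <-] Wp WD]].
have [||q [[b Bb <-] Wb]] := Fp (set_val @` B) W.
- have : F (set_val @^-1` (set_val @` B)) by apply: filterS FB => b Bb; exists b.
  by [].
- exact: open_nbhs_nbhs.
by exists b; split => //; exact: WD.
Qed.

Lemma compact_image_set_val (A : set X) (K : set A) : compact K ->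
  compact (set_val @` K).
Proof.
move=> cK; apply: continuous_compact => //; apply: continuous_subspaceT.
exact: initial_continuous.
Qed.

Lemma hausdorff_set_type (A : set X) : hausdorff_space (A : Type).
Proof.
move=> p q pq; apply: val_inj; apply: Xh => B D Bp Dq.
have [||r [Br Dr]] := pq (set_val @^-1` B) (set_val @^-1` D); last by exists (set_val r).
- exact: initial_continuous.
- exact: initial_continuous.
Qed.

End LocallyCompactHausdorff.

Section CountableBasis.
Context (X : ptopologicalType).

Lemma second_countable_seq : @second_countable X ->
  exists B : nat -> set X, (forall n, open (B n)) /\
    forall (x : X) (U : set X), open U -> U x -> exists n, B n x /\ B n `<=` U.
Proof.
move=> [D /countable_injP[f injf] [Do Db]].
pose P n (A : set X) := D A /\ f A = n.
have PA n A A' : P n A -> P n A' -> A = A'.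
  by move=> [DA fA] [DA' fA']; apply: injf; rewrite ?inE // fA fA'.
(* At most one basic set has code [n], so the union is that set, or empty when [n] codes none. *)
exists (fun n => \bigcup_(A in P n) A); split.
  by move=> n; apply: bigcup_open => A [DA _]; exact: Do.
move=> x U oU Ux; have [A [DA Ax] AU] := Db x U (open_nbhs_nbhs (conj oU Ux)).
exists (f A); split; first by exists A.
by move=> y [A' PA' A'y]; apply: AU; rewrite (PA _ A A' (conj DA erefl) PA').
Qed.

Lemma compact_finite_basis (B : nat -> set X) (K U : set X) :
  (forall n, open (B n)) ->
  (forall (x : X) (U : set X), open U -> U x -> exists n, B n x /\ B n `<=` U) ->
  compact K -> open U -> K `<=` U ->
  exists s : seq nat, let W := [set x | exists2 i, i \in s & B i x] in
    K `<=` W /\ W `<=` U.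
Proof.
move=> Bo Bb + oU KU; rewrite compact_cover => /(_ nat [set n | B n `<=` U] B).
case=> [n _|x Kx|D DU KD]; first exact: Bo.
  by have [n [Bx BU]] := Bb x U oU (KU x Kx); exists n.
exists (finmap.enum_fset D); split=> x.
  by move=> /KD[i iD Bx]; exists i.
by move=> [i iD]; have := DU i iD; rewrite inE; apply.
Qed.

End CountableBasis.

Section BorelMeasurability.
Context (R : realType).

Lemma borel_open (X : ptopologicalType) (U : set X) : open U ->
  measurable (U : set (borel X)).
Proof. exact: sub_sigma_algebra. Qed.

Lemma borel_closed (X : ptopologicalType) (U : set X) : closed U ->
  measurable (U : set (borel X)).
Proof.
by move=> cU; rewrite -[U]setCK; apply: measurableC; apply: borel_open; exact: closed_openC.
Qed.

Lemma continuous_borel (X Y : ptopologicalType) (f : X -> Y) : continuous f ->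
  measurable_fun setT (f : borel X -> borel Y).
Proof.
move=> /continuousP cf; apply: (@measurability _ _ (borel X) (borel Y) setT f (@open Y)) => //.
by move=> _ [U oU <-]; rewrite setTI; apply: borel_open; exact: cf.
Qed.

Lemma continuous_real_borel (X : ptopologicalType) (f : X -> R) : continuous f ->
  measurable_fun setT (f : borel X -> R).
Proof.
move=> /continuousP cf; apply: (measurability _ (RGenOInfty.measurableE R)).
move=> _ [_ [c ->] <-]; rewrite setTI; apply: borel_open; apply: cf.
exact: interval_open.
Qed.

Lemma continuous_complexP (X : topologicalType) (f : X -> R[i]) :
  continuous (f : X -> R[i]^o) <->
  continuous (fun x => Re (f x)) /\ continuous (fun x => Im (f x)).
Proof.
split=> [cf|[cr ci] x].
  by split=> x; have /(cvg_ReImP f)[] := cf x.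
by apply/(cvg_ReImP f); split; [exact: cr | exact: ci].
Qed.

Lemma continuous_cmeasurable (X : ptopologicalType) (f : X -> R[i]) :
  continuous (f : X -> R[i]^o) -> cmeasurable (f : borel X -> R[i]).
Proof. by move=> /continuous_complexP[? ?]; split; exact: continuous_real_borel. Qed.

End BorelMeasurability.

(** * Density in L2 from families that separate compact sets *)

Section L2Density.
Context (R : realType) (X : ptopologicalType).
Variable m : {measure set (borel X) -> \bar R}.
Hypotheses (Xh : hausdorff_space X) (m_radon : is_radon m).

Local Notation H := (L2space m).

(** The density argument asks only this of a family, so it serves both for all C_c functions and for
    a countable family. *)
Definition separates_compacts (phi : set (X -> R)) : Prop :=
  forall K U : set X, compact K -> open U -> K `<=` U ->
  exists2 f, phi f & [/\ measurable_fun setT (f : borel X -> R),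
    forall x, 0 <= f x <= 1, forall x, K x -> f x = 1 &
    forall x, ~ U x -> f x = 0].

Let hip := L2_inner_product m.
Let hs := inner_semi hip.

Lemma indic_square_integrable (A : set (borel X)) : measurable A -> (m A < +oo)%E ->
  square_integrable m (fun x => \1_A x : R[i]).
Proof.
move=> mA Afin; split; first exact: cmeasurable_indic.
under eq_integral do rewrite csqnorm_indic.
by rewrite integral_indic // setIT.
Qed.

Lemma cmeasurable_real (f : borel X -> R) : measurable_fun setT f ->
  cmeasurable (fun x => (f x)%:C%C).
Proof. by move=> mf; split => //=; exact: measurable_cst. Qed.

Section ClosedSubspace.
Variables (phi : set (X -> R)) (S : set H).
Hypotheses (phi_sep : separates_compacts phi) (S_closed : @closed_subspace R H S).
Hypothesis S_phi : forall f, phi f ->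
  square_integrable m (fun x => (f x)%:C%C) ->
  S (L2class m (fun x => (f x)%:C%C)).

(** Regularity encloses [A] in an open [U] of nearly equal measure and fills [U] by a compact [K].
    For a function [f] separating [K] from the complement of [U], |1_A - f|^2 is at most 1_{U \ A} +
    1_{U \ K}; [K] need not lie in [A]. *)
Lemma closed_subspace_indic (A : set (borel X)) : measurable A ->
  (m A < +oo)%E -> S (L2class m (fun x => \1_A x)).
Proof.
move=> mA Afin; have [_ _ clS] := S_closed; apply: clS => e e0.
have [rK rO rU] := m_radon.
have Af : m A \is a fin_num by rewrite ge0_fin_numE.
(* The two error sets together contribute 2 r, which stays below e^2. *)
pose r := e ^+ 2 / 4; have r0 : 0 < r by rewrite divr_gt0 // exprn_gt0.
have [U [oU AU] mU] : exists2 U : set X, open U /\ A `<=` U & (m U < m A + r%:E)%E.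
  have := rO A mA => E.
  have : (ereal_inf [set m U | U in [set U : set X | open U /\ A `<=` U]] < m A + r%:E)%E.
    by rewrite -E lteDl // lte_fin.
  by move=> /ereal_inf_lt[_ [U [oU AU] <-] H]; exists U.
have Ufin : (m U < +oo)%E.
  by apply: (lt_trans mU); rewrite -(fineK Af) -EFinD ltry.
have mUm : measurable (U : set (borel X)) := borel_open oU.
have Uf : m U \is a fin_num by rewrite ge0_fin_numE.
have [K [cK KU] mK] : exists2 K : set X, compact K /\ K `<=` U & (m U - r%:E < m K)%E.
  have : (m U - r%:E < ereal_sup [set m K | K in [set K : set X | compact K /\ K `<=` U]])%E.
    by rewrite -rU // -(fineK Uf) -EFinB lte_fin ltrBlDr ltrDl.
  by move=> /ereal_sup_gt[_ [K [cK KU] <-] H]; exists K.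
have mKm : measurable (K : set (borel X)) := borel_closed (compact_closed Xh cK).
have [f phif [mf f01 fK fU]] := phi_sep cK oU KU.
have sU := indic_square_integrable mUm Ufin.
have cf := cmeasurable_real mf.
have sf : square_integrable m (fun x => (f x)%:C%C).
  apply: (square_integrable_le cf sU) => x.
  rewrite csqnorm_indic indicE /csqnorm /= expr0n addr0.
  have /andP[f0 f1] := f01 x; case: (boolP (x \in U)) => [_|]; first by rewrite /=; nra.
  by rewrite notin_setE => /fU ->; rewrite expr0n.
exists (L2class m (fun x => (f x)%:C%C)); first exact: S_phi.
have sA := indic_square_integrable mA Afin.
rewrite -L2class_sub // -(@ltr_pXn2r _ 2) ?nnegrE ?sqrtr_ge0 ?(ltW e0) //.
rewrite hnorm_class; last exact: square_integrableB.
have mUA : measurable (U `\` A : set (borel X)) by exact: measurableD.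
have mUK : measurable (U `\` K : set (borel X)) by exact: measurableD.
have fUA : (m (U `\` A) <= r%:E)%E.
  by rewrite measureD // setIidr // leeBlDl // ltW.
have fUK : (m (U `\` K) <= r%:E)%E.
  have Kf : m K \is a fin_num by rewrite ge0_fin_numE // rK.
  rewrite measureD // setIidr // leeBlDl // -leeBlDr //; exact: ltW.
have : (\int[m]_x (csqnorm ((\1_A x : R[i]) - (f x)%:C%C))%:E <= r%:E + r%:E)%E.
  apply: (@le_trans _ _ (\int[m]_x ((\1_(U `\` A) x)%:E + (\1_(U `\` K) x)%:E))%E).
    apply: ge0_le_integral => //.
    - by move=> x _; rewrite lee_fin csqnorm_ge0.
    - apply/measurable_EFinP/cmeasurable_sqnorm/cmeasurableB => //.
      exact: cmeasurable_indic.
    - by apply: emeasurable_funD; apply/measurable_EFinP; exact: measurable_indic.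
    - move=> x _; rewrite -EFinD lee_fin /csqnorm !ReImE Re_indic Im_indic /=.
      rewrite !indicE !in_setD.
      have /andP[f0 f1] := f01 x; case: (boolP (x \in A)) => xA.
        have xU : x \in U by rewrite inE; apply: AU; exact: set_mem.
        rewrite xU; case: (boolP (x \in K)) => xK /=; last by nra.
        by rewrite (fK x (set_mem xK)); lra.
      case: (boolP (x \in U)) => xU /=; last first.
        by rewrite fU ?andbF; [lra | by move=> Ux; rewrite (mem_set Ux) in xU].
      by case: (x \in K) => /=; nra.
  rewrite ge0_integralD //; first last.
  - by apply/measurable_EFinP; exact: measurable_indic.
  - by apply/measurable_EFinP; exact: measurable_indic.
  by rewrite !integral_indic // !setIT leeD.
move=> le2; rewrite /Rintegral.
have : (fine (\int[m]_x (csqnorm ((\1_A x : R[i]) - (f x)%:C%C))%:E)%E <= r + r).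
  rewrite -lee_fin fineK // ge0_fin_numE; first by rewrite (le_lt_trans le2) // ltry.
  by apply: integral_ge0 => x _; rewrite lee_fin csqnorm_ge0.
move=> /le_lt_trans; apply; rewrite /r.
by have := exprn_gt0 2 e0; lra.
Qed.

Lemma closed_subspace_sum (I : eqType) (s : seq I) (c : I -> R[i]) (f : I -> borel X -> R[i]) :
  (forall i, i \in s -> square_integrable m (fun x => c i * f i x) /\
     S (L2class m (fun x => c i * f i x))) ->
  square_integrable m (fun x => \sum_(i <- s) c i * f i x) /\
  S (L2class m (fun x => \sum_(i <- s) c i * f i x)).
Proof.
have [S0 Sl _] := S_closed; elim: s => [_|i s IH Hs].
  under [fun x => _]eq_fun do rewrite big_nil.
  by split; [exact: square_integrable0 | rewrite L2class0].
have [s1 S1] := Hs i (mem_head _ _).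
have [j js|s2 S2] := IH; first by apply: Hs; rewrite in_cons js orbT.
under [fun x => _]eq_fun do rewrite big_cons -[c i * _]mul1r.
split; first exact: square_integrable_lin.
by rewrite L2class_lin //; exact: Sl.
Qed.

Import HBNNSimple.

(** Simple functions increase to [f], and |f - g n|^2 is dominated by |f|^2, so they converge in
    L2. *)
Lemma closed_subspace_nonneg (f : borel X -> R) : measurable_fun setT f ->
  (forall x, 0 <= f x) -> square_integrable m (fun x => (f x)%:C%C) ->
  S (L2class m (fun x => (f x)%:C%C)).
Proof.
move=> mf f0 sf; have [_ _ clS] := S_closed; apply: clS => e e0.
have cf := cmeasurable_real mf.
have mfE : measurable_fun setT (fun x => (f x)%:E) by exact/measurable_EFinP.
pose g := nnsfun_approx measurableT mfE.
have gcvg x : (fun n => g n x) @ \oo --> f x.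
  have := @cvg_nnsfun_approx _ _ _ _ measurableT _ mfE (fun x _ => f0 x) x I.
  by move=> /fine_cvg.
have gf n x : g n x <= f x.
  have nd : nondecreasing_seq (fun n => g n x).
    by move=> i j ij; have /lefP := nd_nnsfun_approx measurableT mfE ij; apply.
  rewrite -(cvg_lim (@Rhausdorff R) (gcvg x)); apply: nondecreasing_cvgn_le => //.
  by apply/cvg_ex; exists (f x); exact: gcvg.
have g0 n x : 0 <= g n x by [].
have mg n : measurable_fun setT (g n) by [].
have sg n : square_integrable m (fun x => (g n x)%:C%C).
  apply: (square_integrable_le (cmeasurable_real (mg n)) sf) => x.
  rewrite /csqnorm /= !expr0n !addr0 lerXn2r ?nnegrE //; exact: gf.
have Sg n : S (L2class m (fun x => (g n x)%:C%C)).
  pose s := finmap.enum_fset (fset_set (range (g n))).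
  have gE : (fun x => (g n x)%:C%C) = (fun x => \sum_(r <- s) r%:C%C *
      (\1_(g n @^-1` [set r]) x : R[i])).
    apply/funext => x; rewrite {1}fimfunE fsbig_finite //= rmorph_sum /=.
    apply: eq_bigr => r _; rewrite rmorphM /= !indicE.
    by congr (_ * _); case: (_ \in _).
  rewrite gE; apply: (proj2 (closed_subspace_sum _)) => r _.
  (* The level set of the value 0 may have infinite measure, so its term is treated as the zero
     function. *)
  have [->|r0] := eqVneq r 0.
    have -> : (fun x => 0%:C%C * \1_(g n @^-1` [set 0]) x) = (fun=> 0) :> (_ -> R[i]).
      by apply/funext => x; rewrite mul0r.
    by split; [exact: square_integrable0 | rewrite L2class0; case: S_closed].
  pose A := g n @^-1` [set r].
  have mA : measurable A by exact: measurable_funPTI.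
  have Afin : (m A < +oo)%E.
    have [_ fin] := sg n.
    (* Chebyshev's inequality makes the level sets of nonzero values finite in measure. *)
    have : ((r ^+ 2)%:E * m A <= \int[m]_x (csqnorm (g n x)%:C%C)%:E)%E.
      rewrite -(setIT A) -integral_indic // -ge0_integralZl_EFin ?sqr_ge0 //.
      - apply: ge0_le_integral => //.
        + by move=> x _; rewrite -EFinM lee_fin mulr_ge0 ?sqr_ge0.
        + by apply/measurable_EFinP/measurable_funM => //; exact: measurable_cst.
        + by apply/measurable_EFinP/cmeasurable_sqnorm; case: (sg n).
        + move=> x _; rewrite -EFinM lee_fin /csqnorm /= expr0n addr0 indicE.
          case: (boolP (x \in A)) => [|_]; last by rewrite mulr0 sqr_ge0.
          by rewrite inE /A /= => <-; rewrite mulr1.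
      - by apply/measurable_EFinP; exact: measurable_indic.
    move=> /le_lt_trans /(_ fin); have := measure_ge0 m A.
    case: (m A) => [a| |] //= _.
      by rewrite !ltry.
    by rewrite gt0_muley // lte_fin exprn_even_gt0.
  have sA := indic_square_integrable mA Afin.
  have SA := closed_subspace_indic mA Afin.
  split; first exact: square_integrableZ.
  rewrite L2classZ // -[_ *: _]addr0.
  by case: S_closed => S0 Sl _; exact: Sl.
have : (fun n => cintegral m (fun x => (csqnorm ((f x)%:C%C - (g n x)%:C%C))%:C%C))
    @ \oo --> (cintegral m (fun=> 0) : R[i]^o).
  have /square_integrableP[_ If] := sf.
  apply: (cintegral_dominated _ _ _ If).
  - by move=> n; apply: cmeasurable_real; apply: cmeasurable_sqnorm;
      apply: cmeasurableB => //; exact: cmeasurable_real.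
  - exact: cmeasurable_cst.
  - move=> x; apply/(cvg_ReImP (fun n => (csqnorm ((f x)%:C%C - (g n x)%:C%C))%:C%C)).
    split => /=; last exact: cvg_cst.
    rewrite /csqnorm; under eq_fun do rewrite !ReImE /= subrr expr0n addr0 expr2.
    have gc : (fun n => f x - g n x) @ \oo --> f x - f x.
      by apply: cvgB; [exact: cvg_cst | exact: gcvg].
    have gg := cvgM gc gc; rewrite [in X in _ --> X](subrr (f x)) [in X in _ --> X]mulr0 in gg.
    exact: gg.
  - move=> n x; rewrite normc_real ?csqnorm_ge0 // /csqnorm !ReImE /=.
    rewrite subrr !expr0n !addr0 lerXn2r ?nnegrE ?subr_ge0 ?gf //.
    by rewrite gerBl.
have c0 : Re (cintegral m (fun=> 0 : R[i])) = 0 by rewrite /= /Rintegral integral0_eq.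
move=> /cvg_ReImP[+ _]; rewrite c0 => cv.
move/cvgrPdist_lt : cv => /(_ _ (exprn_gt0 2 e0))[N _ HN].
exists (L2class m (fun x => (g N x)%:C%C)) => //.
rewrite -L2class_sub // -(@ltr_pXn2r _ 2) ?nnegrE ?sqrtr_ge0 ?(ltW e0) //.
rewrite hnorm_class; last exact: square_integrableB.
by have := HN N (leqnn N); rewrite /= sub0r normrN; apply: le_lt_trans; exact: ler_norm.
Qed.

(** Every function is a combination of the positive and negative parts of its real and imaginary
    parts, each square-integrable and nonnegative. *)
Lemma closed_subspace_full (u : H) : S u.
Proof.
have [_ Sl _] := S_closed; pose p (r : R) := Num.max 0 r.
have pE r : r = p r - p (- r).
  by rewrite /p; case: (leP 0 r) => r0; [rewrite max_l | rewrite max_r]; lra.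
have p0 r : 0 <= p r by rewrite le_max lexx.
have p2 r : p r ^+ 2 <= r ^+ 2.
  by rewrite /p; case: (leP 0 r) => r0 //; rewrite expr0n sqr_ge0.
have su := square_integrable_repr u; set f := L2repr u in su.
have [mr mi] := proj1 su.
have key (h : borel X -> R) : measurable_fun setT h ->
    (forall x, h x ^+ 2 <= csqnorm (f x)) ->
    square_integrable m (fun x => (p (h x))%:C%C) /\ S (L2class m (fun x => (p (h x))%:C%C)).
  move=> mh hf; have mp : measurable_fun setT (fun x => p (h x)).
    by apply: measurable_maxr => //; exact: measurable_cst.
  have sp : square_integrable m (fun x => (p (h x))%:C%C).
    apply: (square_integrable_le (cmeasurable_real mp) su) => x.
    by rewrite {1}/csqnorm /= expr0n addr0 (le_trans (p2 _)).
  by split => //; exact: closed_subspace_nonneg.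
have [s1 S1] := key _ mr (fun x => ltac:(by rewrite /csqnorm lerDl sqr_ge0)).
have [s2 S2] := key (fun x => - Re (f x)) (measurableT_comp (@oppr_measurable _ _) mr)
  (fun x => ltac:(by rewrite sqrrN /csqnorm lerDl sqr_ge0)).
have [s3 S3] := key _ mi (fun x => ltac:(by rewrite /csqnorm lerDr sqr_ge0)).
have [s4 S4] := key (fun x => - Im (f x)) (measurableT_comp (@oppr_measurable _ _) mi)
  (fun x => ltac:(by rewrite sqrrN /csqnorm lerDr sqr_ge0)).
pose i : R[i] := Complex 0 1.
have s12 := square_integrable_lin (-1) s2 s1.
have s34 := square_integrable_lin (-1) s4 s3.
rewrite -[u]L2class_repr -/f.
rewrite (_ : f = fun x => i * (-1 * (p (- Im (f x)))%:C%C + (p (Im (f x)))%:C%C) +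
   (-1 * (p (- Re (f x)))%:C%C + (p (Re (f x)))%:C%C)).
  by rewrite !L2class_lin //; apply: (Sl); exact: Sl.
apply/funext => x; apply: eqC; rewrite !ReImE /=.
  by rewrite [LHS]pE; ring.
by rewrite [LHS]pE; ring.
Qed.

End ClosedSubspace.
End L2Density.

(** * Compactly supported functions and a countable Urysohn family *)

Section CompactSupport.
Context (R : realType) (X : ptopologicalType).
Hypothesis Xh : hausdorff_space X.
Implicit Types f g : X -> R[i].

Lemma Cc_intro (K : set X) f : continuous (f : X -> R[i]^o) -> compact K ->
  (forall x, ~ K x -> f x = 0) -> Cc f.
Proof.
move=> cf cK fK; split => //; apply: (@subclosed_compact _ _ K) => //.
  exact: closed_closure.
rewrite [X in _ `<=` X](closure_id _).1; last exact: compact_closed.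
by apply: closureS => x /= /eqP fx; apply: contrapT => /fK.
Qed.

Lemma Cc_out f x : ~ closure [set y | f y != 0] x -> f x = 0.
Proof.
move=> H; apply/eqP; apply: contrapT => fx; apply: H.
by apply: subset_closure => /=; exact/negP.
Qed.

Lemma Cc_map2 (F : R[i] -> R[i] -> R[i]) f g : Cc f -> Cc g -> F 0 0 = 0 ->
  continuous ((fun x => F (f x) (g x)) : X -> R[i]^o) -> Cc (fun x => F (f x) (g x)).
Proof.
move=> [cf sf] [cg sg] F0 cF.
apply: (Cc_intro cF (compactU sf sg)) => x /not_orP[fx gx].
by rewrite (Cc_out fx) (Cc_out gx).
Qed.

Lemma Cc_mulr f g : Cc f -> continuous (g : X -> R[i]^o) ->
  Cc (fun x => g x * f x).
Proof.
move=> [cf sf] cg; apply: (Cc_intro _ sf) => x; last by move=> /Cc_out ->; rewrite mulr0.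
exact: cvg_complexM (cg x) (cf x).
Qed.

Lemma Cc0 : Cc (fun _ : X => 0 : R[i]).
Proof.
apply: (Cc_intro (K := set0)) => //; last exact: compact0.
by move=> x; exact: (@cvg_complex_cst R X (nbhs x)).
Qed.

Lemma Cc_lin (a : R[i]) f g : Cc f -> Cc g -> Cc (fun x => a * f x + g x).
Proof.
move=> Cf Cg; apply: (Cc_map2 (F := fun z w => a * z + w) Cf Cg).
  by rewrite mulr0 addr0.
case: Cf Cg => cf _ [cg _] x.
have ca : (fun _ : X => a) @ x --> (a : R[i]^o) by exact: (@cvg_complex_cst R X (nbhs x)).
exact: cvg_complexD (cvg_complexM ca (cf x)) (cg x).
Qed.

Lemma Cc_conjM f g : Cc f -> Cc g -> Cc (fun x => conjc (f x) * g x).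
Proof.
move=> [cf _] Cg; apply: Cc_mulr => // x.
exact: cvg_complex_conj (cf x).
Qed.

Lemma Cc_real (phi : X -> R) : continuous phi ->
  compact (closure [set x | phi x != 0]) -> Cc (fun x => (phi x)%:C%C).
Proof.
move=> cphi sphi; split.
  by apply/continuous_complexP; split => //= x; exact: cvg_cst.
rewrite (_ : [set x | _] = [set x | phi x != 0]) //.
apply/seteqP; split => x /=; apply: contraNN => /eqP; first by move=> ->.
by move=> [->].
Qed.

Lemma Cc_bounded f : Cc f -> exists2 C : R, 0 <= C & forall x, normc (f x) <= C.
Proof.
move=> [cf sf]; set K := closure _ in sf.
have cn : continuous (fun x => csqnorm (f x)) by move=> x; exact: cvg_csqnorm (cf x).
have [M [_ HM]] := compact_bounded (continuous_compact (continuous_subspaceT cn) sf).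
exists (Num.sqrt (`|M| + 1)); first exact: sqrtr_ge0.
move=> x; rewrite normc_sqrt; apply: ler_wsqrtr.
have [Kx|/Cc_out ->] := pselect (K x); last by rewrite /csqnorm /= expr0n addr0 addr_ge0.
rewrite -[leLHS]ger0_norm ?csqnorm_ge0 //; apply: HM; last by exists x.
by rewrite (le_lt_trans (ler_norm M)) // ltrDl.
Qed.

End CompactSupport.

Section CountableUrysohn.
Context (R : realType) (X : ptopologicalType).
Hypotheses (Xh : hausdorff_space X) (Xlc : locally_compact [set: X])
  (Xsc : @second_countable X).

(* One function for each separable pair of finite unions of basic open sets    *)
(* suffices, since a compact set is covered by finitely many of them.          *)
Lemma countable_Urysohn : exists phi : nat -> X -> R,
  (forall n, [/\ continuous (phi n), forall x, 0 <= phi n x <= 1 &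
     compact (closure [set x | phi n x != 0])]) /\
  forall K U : set X, compact K -> open U -> K `<=` U ->
    exists n, (forall x, K x -> phi n x = 1) /\ (forall x, ~ U x -> phi n x = 0).
Proof.
have [B [Bo Bb]] := second_countable_seq Xsc.
pose W (s : seq nat) := [set x | exists2 i, i \in s & B i x].
pose P (st : seq nat * seq nat) (f : X -> R) :=
  [/\ continuous f, forall x, 0 <= f x <= 1, compact (closure [set x | f x != 0]),
    forall x, W st.1 x -> f x = 1 & forall x, ~ W st.2 x -> f x = 0].
pose G (f : X -> R) := [/\ continuous f, forall x, 0 <= f x <= 1 &
     compact (closure [set x | f x != 0])].
have G0 : G (fun=> 0).
  split; first by move=> x; exact: cvg_cst.
    by move=> x; rewrite lexx ler01.
  rewrite (_ : [set x | _] = set0) ?closure0; first exact: compact0.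
  by apply/seteqP; split => x //=; rewrite eqxx.
(* A code with no separating function, or no decoding at all, is assigned the zero function. *)
have /choice[phi Hphi] : forall n : nat, exists f : X -> R, G f /\
    forall st, unpickle n = Some st -> (exists f, P st f) -> P st f.
  move=> n; case E : (unpickle n : option (seq nat * seq nat)) => [st|]; last by exists (fun=> 0).
  have [[f Pf]|nP] := pselect (exists f, P st f).
    by exists f; split; [case: Pf | move=> _ [<-]].
  by exists (fun=> 0); split => // _ [<-] /nP.
exists phi; split; first by move=> n; case: (Hphi n).
move=> K U cK oU KU.
have [f [cf f01 fK fU sf]] := Urysohn_compact R Xh Xlc cK oU KU.
(* The level sets of one Urysohn function yield a separable pair (s, t): [K] lies in [W s], which
   lies in the compact set f >= 1/2, which lies in [W t], which lies in the set f > 0, hence in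
   [U]. *)
have o2 : open [set x | 2^-1 < f x].
  by apply: (open_comp (f := f) (D := [set r | 2^-1 < r])) => // x _; exact: cf.
have o0 : open [set x | 0 < f x].
  by apply: (open_comp (f := f) (D := [set r | 0 < r])) => // x _; exact: cf.
have c2 : compact [set x | 2^-1 <= f x].
  apply: (@subclosed_compact _ _ (closure [set x | f x != 0])) => //.
    by apply: (closed_comp (f := f) (D := [set r | 2^-1 <= r])) => // x _; exact: cf.
  move=> x /= fx; apply: subset_closure => /=; rewrite gt_eqF //.
  by apply: lt_le_trans fx; rewrite invr_gt0.
have K2 : K `<=` [set x | 2^-1 < f x] by move=> x Kx /=; rewrite fK // invf_lt1 // ltr1n.
have c20 : [set x | 2^-1 <= f x] `<=` [set x | 0 < f x].
  by move=> x /=; apply: lt_le_trans; rewrite invr_gt0.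
have [s [Ks s2]] := compact_finite_basis Bo Bb cK o2 K2.
have [t [ct t0]] := compact_finite_basis Bo Bb c2 o0 c20.
have oW : open (W t).
  rewrite (_ : W t = \bigcup_(i in [set i | i \in t]) B i); last first.
    by apply/seteqP; split => x [i it Bx]; exists i.
  by apply: bigcup_open.
have [g [cg g01 g1 g0 sg]] := Urysohn_compact R Xh Xlc c2 oW ct.
have [_ /(_ (s, t) (pickleK _))[|_ _ _ h1 h0]] := Hphi (pickle (s, t)).
  exists g; split => //= x Wx; apply: g1 => /=.
  by apply: ltW; exact: s2.
exists (pickle (s, t)); split=> x; first by move=> /Ks/h1.
by move=> Ux; apply: h0 => /t0 /= fx; move: fx; rewrite fU // ltxx.
Qed.

End CountableUrysohn.

(** * Change of variables, projections, local approximation *)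

Section MeasureTransfer.
Context d1 d2 (X : measurableType d1) (Y : measurableType d2) (R : realType).
Variables (phi : X -> Y) (mu : {measure set X -> \bar R}) (nu : {measure set Y -> \bar R}).
Hypotheses (mphi : measurable_fun setT phi)
  (phi_nu : forall A, measurable A -> mu (phi @^-1` A) = nu A).

Lemma transfer_ge0 (f : Y -> \bar R) : measurable_fun setT f -> (forall y, 0 <= f y)%E ->
  (\int[nu]_y f y = \int[mu]_x f (phi x))%E.
Proof.
move=> mf f0; rewrite -[RHS](@ge0_integral_pushforward _ _ _ _ _ _ mphi mu setT f) //.
by apply: eq_measure_integral => A mA _; rewrite -phi_nu.
Qed.

Lemma transfer_integral (f : Y -> \bar R) : measurable_fun setT f ->
  (\int[nu]_y f y = \int[mu]_x f (phi x))%E.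
Proof.
move=> mf; rewrite integralE [RHS]integralE; congr (_ - _)%E.
  rewrite (transfer_ge0 (measurable_funepos mf)) //.
  by apply: eq_integral => x _; rewrite !funeposE.
rewrite (transfer_ge0 (measurable_funeneg mf)) //.
by apply: eq_integral => x _; rewrite !funenegE.
Qed.

Lemma transfer_cintegral (f : Y -> R[i]) : cmeasurable f ->
  cintegral nu f = cintegral mu (fun x => f (phi x)).
Proof.
move=> [f1 f2]; rewrite /cintegral /Rintegral.
by rewrite !transfer_integral //; exact/measurable_EFinP.
Qed.

Lemma transfer_ae (P : Y -> Prop) :
  {ae nu, forall y, P y} -> {ae mu, forall x, P (phi x)}.
Proof.
move=> [N [mN N0 PN]]; exists (phi @^-1` N); split.
- by rewrite -[X in measurable X]setTI; exact: mphi.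
- by rewrite phi_nu.
- by move=> x /= Px; apply: PN.
Qed.

Lemma transfer_square_integrable (f : Y -> R[i]) :
  square_integrable nu f -> square_integrable mu (fun x => f (phi x)).
Proof.
move=> [mf If]; split; first exact: cmeasurable_comp.
rewrite -(@transfer_ge0 (fun y => (csqnorm (f y))%:E)) //.
- by apply/measurable_EFinP; exact: cmeasurable_sqnorm.
- by move=> y; rewrite lee_fin csqnorm_ge0.
Qed.

End MeasureTransfer.

Section Projections.
Context (R : realType) (H : innerSpace R).
Hypothesis HH : is_inner_product H.
Let hs := inner_semi HH.

Lemma projection_dot (P : H -> H) : projection P ->
  forall u, dot u (P u) = dot (P u) (P u).
Proof. by move=> [_ aP PP] u; rewrite -aP PP. Qed.

Lemma projection_le (P : H -> H) : projection P ->
  forall u, dot (P u) (P u) <= dot u u.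
Proof.
move=> pP u; have := projection_dot pP u => E.
have : 0 <= dot (u - P u) (u - P u) by case: HH => _ _ ->.
rewrite !(formDr hs) !(formDl hs) !(formNr hs) !(formNl hs) opprK E.
by rewrite (formC hs u (P u)) E -(formC hs) addNr addr0 subr_ge0.
Qed.

Lemma projection_effect (P : H -> H) : projection P -> effect P.
Proof.
move=> pP; split; first split; first by case: pP.
- by move=> u; rewrite projection_dot //; case: HH => _ _ ->.
- by move=> u; rewrite projection_dot //; exact: projection_le.
Qed.

Lemma projection_hnorm (P : H -> H) : projection P -> forall u, hnorm (P u) <= hnorm u.
Proof.
move=> pP u; rewrite /hnorm ler_wsqrtr //.
by have := projection_le pP u; rewrite lecE => /andP[].
Qed.

Lemma projection_opnorm (P : H -> H) : projection P -> P <> (fun=> 0) -> opnorm P = 1.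
Proof.
move=> pP P0; have [[lP _] _ PP] := pP.
have [u Pu0] : exists u, P u <> 0.
  by apply: contrapT => /forallNP Pu; apply: P0; apply/funext => u; apply: contrapT; exact: Pu.
have n0 : 0 < hnorm (P u).
  by rewrite lt0r sqrtr_ge0 andbT; apply/eqP => /(hnorm_eq0 HH).
pose w := ((hnorm (P u))^-1)%:C%C *: P u.
have Pw : P w = w by rewrite (linear_opZ lP) PP.
have w1 : hnorm w = 1.
  rewrite hnormE seminormZ // -hnormE normc_real ?invr_ge0 ?ltW //.
  by rewrite mulVf // gt_eqF.
have ub1 : ubound [set hnorm (P u) | u in [set u | hnorm u <= 1]] 1.
  by move=> _ [v /= v1 <-]; exact: le_trans (projection_hnorm pP v) v1.
apply/eqP; rewrite eq_le; apply/andP; split.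
  by apply: ge_sup => //; exists (hnorm (P w)), w => //=; rewrite w1.
apply: sup_ubound; first by exists 1.
by exists w => /=; rewrite ?Pw w1.
Qed.

End Projections.

(** Splits the difference as <xi - f, A eta> + <f, A (eta - h)>. It is used with the unitaries
    [can_rep] and with the projections [can_povm]. *)
Lemma dot_perturb (R : realType) (H K : innerSpace R) (A : K -> H) :
  is_inner_product H -> is_inner_product K ->
  (forall u v, A (u - v) = A u - A v) -> (forall u, hnorm (A u) <= hnorm u) ->
  forall (xi f : H) (eta h : K),
  normc (dot xi (A eta) - dot f (A h)) <=
    hnorm (xi - f) * hnorm eta + hnorm f * hnorm (eta - h).
Proof.
move=> HH HK AB An xi f eta h; have hs := inner_semi HH; have ks := inner_semi HK.
rewrite (_ : _ - _ = dot (xi - f) (A eta) + dot f (A (eta - h))).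
  rewrite (le_trans (le_normcD _ _)) // lerD //.
    by rewrite (le_trans (normc_form hs _ _)) // ler_wpM2l ?seminorm_ge0 // -hnormE An.
  by rewrite (le_trans (normc_form hs _ _)) // ler_wpM2l ?seminorm_ge0 // -hnormE An.
by rewrite AB (formDl hs) (formNl hs) (formDr hs) (formNr hs) addrA addrNK.
Qed.

Section LocalApproximation.
Variable R : realType.

(** The approximant may depend on the point and on [e], and has to be continuous only at that
    point. *)
Lemma continuous_local_approx (X : topologicalType) (h : X -> R[i]) :
  (forall (x : X) (e : R), 0 < e -> exists2 g : X -> R[i],
     g @ x --> (g x : R[i]^o) & \forall y \near x, normc (h y - g y) <= e) ->
  continuous (h : X -> R[i]^o).
Proof.
move=> Hh x; apply/(cvg_complexP h) => e e0.
have e40 : 0 < e / 4 by rewrite divr_gt0.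
have [g cg hg] := Hh x _ e40.
have hgx : normc (h x - g x) <= e / 4 := nbhs_singleton hg.
move/(cvg_complexP g) : cg => /(_ _ e40) gg.
apply: filterS2 hg gg => y hgy ggy.
rewrite (_ : h x - h y = (h x - g x) + ((g x - g y) - (h y - g y))); last by ring.
rewrite (le_lt_trans (le_normcD _ _)) //.
have := le_normcD (g x - g y) (- (h y - g y)); rewrite normcN; lra.
Qed.

Lemma continuous_real_local_approx (X : topologicalType) (h : X -> R) :
  (forall (x : X) (e : R), 0 < e -> exists2 g : X -> R,
     g @ x --> g x & \forall y \near x, `|h y - g y| <= e) ->
  continuous h.
Proof.
move=> Hh; suff : continuous ((fun x => (h x)%:C%C) : X -> R[i]^o).
  by move=> /continuous_complexP[].
apply: continuous_local_approx => x e e0; have [g cg hg] := Hh x e e0.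
exists (fun x => (g x)%:C%C).
  by apply/(cvg_ReImP (fun x => (g x)%:C%C)); split => //=; exact: cvg_cst.
apply: filterS hg => y; rewrite -rmorphB => hg.
by rewrite (le_trans (normc_leD _)) //= normr0 addr0.
Qed.

(** Uncountably many local approximants are reduced to countably many: one is chosen for each basic
    open set and each precision 1/(k+1) that admits any. Then h > c is a countable union of
    measurable sets cut out by the chosen functions. *)
Lemma measurable_local_approx (X : ptopologicalType) (h : X -> R) :
  @second_countable X ->
  (forall (x : X) (e : R), 0 < e -> exists2 g : borel X -> R,
     measurable_fun setT g & \forall y \near x, `|h y - g y| <= e) ->
  measurable_fun setT (h : borel X -> R).
Proof.
move=> Xsc Hh; have [B [Bo Bb]] := second_countable_seq Xsc.
pose P n k (g : borel X -> R) := measurable_fun setT g /\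
  forall y, B n y -> `|h y - g y| <= k.+1%:R^-1.
have [g0 Hg0] : exists g : nat -> nat -> borel X -> R, forall n k,
    (exists f, P n k f) -> P n k (g n k).
  have Hc n k : exists g, (exists f, P n k f) -> P n k g.
    by have [[f Pf]|nP] := pselect (exists f, P n k f); [exists f | exists (fun=> 0)].
  exists (fun n k => projT1 (cid (Hc n k))) => n k.
  exact: projT2 (cid (Hc n k)).
apply: (measurability _ (RGenOInfty.measurableE R)).
move=> _ [_ [c ->] <-]; rewrite setTI.
rewrite (_ : h @^-1` _ = \bigcup_n \bigcup_k (B n `&`
    [set y | (exists f, P n k f) /\ c + k.+1%:R^-1 < g0 n k y])).
  apply: bigcupT_measurable => n; apply: bigcupT_measurable => k.
  apply: measurableI; first exact: borel_open.
  (* Nothing is known about [g0 n k] when no approximant exists; in that case the set is empty. *)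
  have [e|ne] := pselect (exists f, P n k f); last first.
    by rewrite (_ : [set y | _] = set0) // -subset0 => y [].
  rewrite (_ : [set y | _] = g0 n k @^-1` `]c + k.+1%:R^-1, +oo[%classic).
    have [mg _] := Hg0 _ _ e.
    by rewrite -[X in measurable X]setTI; apply: mg => //; exact: measurable_itv.
  by apply/seteqP; split => y /=; rewrite in_itv /= andbT; [move=> [] | split].
apply/seteqP; split => y /=; rewrite in_itv /= andbT; last first.
  move=> [n _ [k _ [Bny [ef cg]]]]; have [_ /(_ y Bny)] := Hg0 _ _ ef.
  rewrite ler_norml => /andP[Hk _].
  by rewrite -(ltrD2r k.+1%:R^-1) (lt_le_trans cg) // -lerBlDr -lerBrDl.
(* With an error below half the gap, the approximant still exceeds [c] by more than the error. *)
move=> cy; have d0 : 0 < (h y - c) / 2 by lra.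
have [k Hk] : exists k : nat, k.+1%:R^-1 < (h y - c) / 2.
  have [k Hk] := @ltr_add_invr R 0 ((h y - c) / 2) d0.
  by exists k; rewrite add0r in Hk.
have k0 : 0 < k.+1%:R^-1 :> R by rewrite invr_gt0.
have [g mg hg] := Hh y _ k0.
have : nbhs y [set z | `|h z - g z| <= k.+1%:R^-1] := hg.
rewrite nbhsE => -[U [oU Uy] UH].
have [n [Bny BnU]] := Bb y U oU Uy.
have ef : exists f, P n k f by exists g; split => // z /BnU/UH.
exists n => //; exists k => //; split => //; split => //.
have [_ /(_ y Bny)] := Hg0 _ _ ef.
rewrite ler_norml => /andP[_]; rewrite lerBlDl -lerBlDr; apply: lt_le_trans.
by move: Hk; move: (k.+1%:R^-1) => K Hk; lra.
Qed.

End LocalApproximation.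

(** * Groupoids and their fibres *)

Section Groupoids.
Context (Gam M : topologicalType) (G : continuous_groupoid Gam M).

Local Notation mulG := (Defs.comp G).
Local Notation invG := (Defs.inv G).
Local Notation oneG := (Defs.unit G).

Lemma comp_inj_l (a b c : Gam) : src G a = tgt G b -> src G a = tgt G c ->
  mulG a b = mulG a c -> b = c.
Proof.
move=> ab ac E; have := congr1 (mulG (invG a)) E.
by rewrite !Defs.compA ?Defs.src_inv // Defs.inv_comp ab Defs.comp1l -ab ac Defs.comp1l.
Qed.

Lemma inv_unit x : invG (oneG x) = oneG x.
Proof.
have C : mulG (oneG x) (oneG x) = oneG x.
  by have := Defs.comp1l G (oneG x); rewrite Defs.tgt_unit.
apply: (@comp_inj_l (oneG x)); rewrite ?Defs.tgt_inv ?Defs.src_unit ?Defs.tgt_unit //.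
by rewrite Defs.comp_inv Defs.tgt_unit C.
Qed.

Lemma inv_inv (a : Gam) : invG (invG a) = a.
Proof.
apply: (@comp_inj_l (invG a)); rewrite ?Defs.tgt_inv ?Defs.src_inv //.
by rewrite Defs.comp_inv Defs.inv_comp Defs.tgt_inv.
Qed.

Lemma inv_compE (a b : Gam) : src G a = tgt G b ->
  invG (mulG a b) = mulG (invG b) (invG a).
Proof.
move=> ab; have sab := Defs.src_comp ab; have tab := Defs.tgt_comp ab.
have ba : src G (invG b) = tgt G (invG a) by rewrite Defs.src_inv Defs.tgt_inv.
apply: (@comp_inj_l (mulG a b)).
- by rewrite Defs.tgt_inv.
- by rewrite Defs.tgt_comp // Defs.tgt_inv.
rewrite Defs.comp_inv tab -Defs.compA //; last by rewrite Defs.tgt_comp // Defs.tgt_inv.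
rewrite (Defs.compA (esym (Defs.tgt_inv G b)) ba) Defs.comp_inv -ab.
by rewrite -(Defs.tgt_inv G a) Defs.comp1l Defs.comp_inv.
Qed.

Lemma arrow_eq x y (a b : arrow G x y) : sval a = sval b -> a = b.
Proof. by case: a b => [a pa] [b pb] /= E; exact: eq_exist. Qed.

Lemma fibre_eq x (g h : fibre G x) : set_val g = set_val h -> g = h.
Proof. exact: val_inj. Qed.

Lemma fibre_tgt x (g : fibre G x) : tgt G (set_val g) = x.
Proof. exact: set_mem (valP g). Qed.

Lemma set_val_ltrans x y (a : arrow G x y) g :
  set_val (ltrans a g) = mulG (sval a) (set_val g).
Proof. by []. Qed.

Lemma ltrans_comp x y z (a : arrow G y z) (b : arrow G x y) g :
  ltrans (arrow_comp a b) g = ltrans a (ltrans b g).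
Proof.
apply: fibre_eq; rewrite !set_val_ltrans /=.
case: a b => [a [sa ta]] [b [sb tb]] /=; rewrite Defs.compA //; first by rewrite sa.
by rewrite fibre_tgt.
Qed.

Lemma ltrans_unit x g : ltrans (arrow_unit G x) g = g.
Proof. by apply: fibre_eq; rewrite set_val_ltrans /= -{1}(fibre_tgt g) Defs.comp1l. Qed.

Lemma arrow_inv_comp x y z (a : arrow G y z) (b : arrow G x y) :
  arrow_inv (arrow_comp a b) = arrow_comp (arrow_inv b) (arrow_inv a).
Proof.
apply: arrow_eq => /=; case: a b => [a [sa ta]] [b [sb tb]] /=.
by rewrite inv_compE // sa.
Qed.

Lemma arrow_inv_unit x : arrow_inv (arrow_unit G x) = arrow_unit G x.
Proof. by apply: arrow_eq => /=; exact: inv_unit. Qed.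

Lemma arrow_invK x y (a : arrow G x y) : arrow_inv (arrow_inv a) = a.
Proof. by apply: arrow_eq => /=; exact: inv_inv. Qed.

Lemma arrow_compV x y (a : arrow G x y) : arrow_comp a (arrow_inv a) = arrow_unit G y.
Proof. by apply: arrow_eq; case: a => [a [sa ta]] /=; rewrite Defs.comp_inv ta. Qed.

Lemma arrow_compVl x y (a : arrow G x y) : arrow_comp (arrow_inv a) a = arrow_unit G x.
Proof. by apply: arrow_eq; case: a => [a [sa ta]] /=; rewrite Defs.inv_comp sa. Qed.

Lemma ltransK x y (a : arrow G x y) g : ltrans (arrow_inv a) (ltrans a g) = g.
Proof. by rewrite -ltrans_comp arrow_compVl ltrans_unit. Qed.

Lemma ltransVK x y (a : arrow G x y) g : ltrans a (ltrans (arrow_inv a) g) = g.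
Proof. by rewrite -ltrans_comp arrow_compV ltrans_unit. Qed.

Lemma set_val_continuous x : continuous (set_val : fibre G x -> Gam).
Proof. exact: initial_continuous. Qed.

Lemma ltrans_continuous x y (a : arrow G x y) :
  continuous (ltrans a : fibre G x -> fibre G y).
Proof.
apply: (@continuous_comp_initial _ (fibre G x) Gam set_val).
move=> g; have := @Defs.comp_continuous _ _ G.
move=> /subspace_continuousP /(_ (sval a, set_val g)).
have E (h : fibre G x) : src G (sval a) = tgt G (set_val h) by rewrite fibre_tgt; case: a => [a []].
move=> /(_ (E g)) cG A /= /cG; rewrite /within /= => -[[U V] [/= Ua Vg] UV].
have : nbhs g (set_val @^-1` V : set (fibre G x)) := set_val_continuous Vg.
apply: filterS => h Vh; apply: (UV (sval a, set_val h)) => //=.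
by split => //; exact: nbhs_singleton.
Qed.

End Groupoids.

Lemma weighted_sum_le (R : realType) (n s t e : R) :
  0 <= s -> s * (n + 1) <= e / 2 -> t <= e / 2 -> n * s + t <= e.
Proof. lra. Qed.

Section Fibres.
Context (R : realType) (Gam M : ptopologicalType) (G : continuous_groupoid Gam M).
Variable nu : fibre_measures R G.
Hypotheses (Gam_h : hausdorff_space Gam) (M_h : hausdorff_space M)
  (Gam_lc : locally_compact [set: Gam]) (Gam_sc : @second_countable Gam)
  (nu_haar : haar_system nu).

Local Notation cansec := (@can_sections R Gam M G nu).

Lemma fibre_closed x : closed [set g | tgt G g = x].
Proof.
apply: (closed_comp (f := tgt G) (D := [set x])); first by move=> g _; exact: tgt_continuous.
exact/accessible_closed_set1/hausdorff_accessible.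
Qed.

Lemma fibre_hausdorff x : hausdorff_space (fibre G x).
Proof. exact: hausdorff_set_type. Qed.

Lemma fibre_compact x (K : set Gam) : compact K ->
  compact (set_val @^-1` K : set (fibre G x)).
Proof. by move=> cK; apply: compact_preimage_set_val => //; exact: fibre_closed. Qed.

Lemma set_val_measurable x :
  measurable_fun setT (set_val : borel (fibre G x) -> borel Gam).
Proof. by apply: (@continuous_borel (fibre G x) Gam set_val); exact: set_val_continuous. Qed.

Lemma restr_cmeasurable x (f : borel Gam -> R[i]) : cmeasurable f ->
  cmeasurable (fun g : borel (fibre G x) => f (set_val g)).
Proof. by move=> mf; apply: (cmeasurable_comp (@set_val_measurable x) mf). Qed.

Lemma Cc_cmeasurable x (f : Gam -> R[i]) : Cc f ->
  cmeasurable (fun g : borel (fibre G x) => f (set_val g)).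
Proof. by move=> [cf _]; apply: restr_cmeasurable; exact: continuous_cmeasurable. Qed.

(** The majorant is a bound of [f] times the indicator of the slice of its support, which has finite
    measure because [nu x] is Radon. *)
Lemma Cc_dominated x (f : Gam -> R[i]) : Cc f ->
  exists2 h : borel (fibre G x) -> R, (nu x).-integrable setT (fun g => (h g)%:E) &
    forall g, normc (f (set_val g)) <= h g.
Proof.
move=> Cf; have [C C0 fC] := Cc_bounded Cf; have [_ sf] := Cf.
set K := closure _ in sf; pose K' : set (borel (fibre G x)) := set_val @^-1` K.
have cK' : compact (K' : set (fibre G x)) by exact: fibre_compact.
have mK' : measurable K' by apply: borel_closed; apply: compact_closed cK'; exact: fibre_hausdorff.
have fin : (nu x K' < +oo)%E by case: nu_haar => /(_ x)[+ _ _] _ _ _; apply.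
exists (fun g => C * \1_K' g).
  rewrite (_ : (fun g => _) = (fun g => C%:E * (\1_K' g)%:E)%E); last by apply/funext.
  apply: integrableZl => //; apply/integrableP; split.
    by apply/measurable_EFinP; exact: measurable_indic.
  under eq_integral do rewrite gee0_abs ?lee_fin //.
  by rewrite integral_indic // setIT.
move=> g; rewrite indicE; case: (boolP (g \in K')) => [_|]; first by rewrite mulr1.
by rewrite notin_setE => /Cc_out ->; rewrite normc0 mulr0.
Qed.

Lemma Cc_cintegrable x (f : Gam -> R[i]) : Cc f ->
  cintegrable (nu x) (fun g => f (set_val g)).
Proof.
move=> Cf; have [h ih fh] := Cc_dominated x Cf.
exact: (cintegrable_le (Cc_cmeasurable x Cf) ih fh).
Qed.

Lemma Cc_square_integrable x (f : Gam -> R[i]) : Cc f ->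
  square_integrable (nu x) (fun g => f (set_val g)).
Proof.
move=> Cf; apply/square_integrableP; split; first exact: Cc_cmeasurable.
have [] := Cc_cintegrable x (Cc_conjM Gam_h Cf Cf).
by under eq_fun do rewrite conjM_csqnorm /=.
Qed.

Lemma can_section_dot f h x : Cc f -> Cc h ->
  dot (can_section nu f x) (can_section nu h x) =
  cintegral (nu x) (fun g => conjc (f (set_val g)) * h (set_val g)).
Proof. by move=> Cf Ch; rewrite dot_class //; exact: Cc_square_integrable. Qed.

Lemma sqr_hnorm_can_section f x : Cc f ->
  hnorm (can_section nu f x) ^+ 2 =
  Re (cintegral (nu x) (fun g => conjc (f (set_val g)) * f (set_val g))).
Proof.
by move=> Cf; rewrite -can_section_dot // sqr_hnorm //; exact: L2_inner_product.
Qed.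

Lemma haar_continuous f : Cc f ->
  continuous ((fun x => cintegral (nu x) (fun g => f (set_val g))) : M -> R[i]^o).
Proof. by case: nu_haar => _ _ + _; apply. Qed.

Lemma hnorm_can_section_continuous f : Cc f ->
  continuous (fun x => hnorm (can_section nu f x)).
Proof.
move=> Cf; have /continuous_complexP[cr _] := haar_continuous (Cc_conjM Gam_h Cf Cf).
rewrite (_ : (fun x => _) = Num.sqrt \o (fun x => Re (cintegral (nu x)
    (fun g => conjc (f (set_val g)) * f (set_val g))))).
  by move=> x; apply: continuous_comp; [exact: cr | exact: sqrt_continuous].
apply/funext => x; rewrite /comp -sqr_hnorm_can_section //.
by rewrite sqrtr_sqr ger0_norm // sqrtr_ge0.
Qed.

Lemma can_section_lin (a : R[i]) f h x : Cc f -> Cc h ->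
  can_section nu (fun g => a * f g + h g) x =
  a *: can_section nu f x + can_section nu h x.
Proof. by move=> Cf Ch; rewrite /can_section L2class_lin //; exact: Cc_square_integrable. Qed.

Lemma can_section0 x : can_section nu (fun=> 0) x = 0.
Proof. exact: L2class0. Qed.

(** A compact subset of a fibre is compact in [Gam], and an open subset of the fibre is the trace of
    an open set of [Gam], so separation can be done in [Gam] and restricted. *)
Lemma restr_separates (phi : set (Gam -> R)) x :
  (forall f, phi f -> continuous f /\ forall g, 0 <= f g <= 1) ->
  (forall K U : set Gam, compact K -> open U -> K `<=` U -> exists2 f, phi f &
     (forall g, K g -> f g = 1) /\ (forall g, ~ U g -> f g = 0)) ->
  separates_compacts [set (f \o set_val : fibre G x -> R) | f in phi].
Proof.
move=> phiP phiS K _ cK [U oU <-] KU.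
have cK' : compact (set_val @` K : set Gam) by exact: compact_image_set_val.
have [|f phif [fK fU]] := phiS _ _ cK' oU; first by move=> _ [g Kg <-]; exact: KU.
have [cf f01] := phiP _ phif.
exists (f \o set_val); first by exists f.
split=> [|g|g Kg|g Ug] /=.
- have mf : measurable_fun setT (f : borel Gam -> R) by exact: continuous_real_borel.
  exact: (measurableT_comp mf (@set_val_measurable x)).
- exact: f01.
- by apply: fK; exists g.
- exact: fU.
Qed.

(** The closure of the C_c sections is a closed subspace containing the restricted Urysohn
    functions, so [closed_subspace_full] applies. *)
Lemma can_section_dense x (u : can_fib nu x) (e : R) : 0 < e ->
  exists2 f, Cc f & hnorm (u - can_section nu f x) < e.
Proof.
have hip := L2_inner_product (nu x).
pose D := [set can_section nu f x | f in @Cc R Gam].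
pose S := [set v : can_fib nu x | forall e : R, 0 < e ->
  exists2 w, D w & hnorm (v - w) < e].
suff : S u.
  by move=> Du e0; have [_ [f Cf <-] Hf] := Du e e0; exists f.
pose phi := [set f : Gam -> R | [/\ continuous f, forall g, 0 <= f g <= 1 &
  compact (closure [set g | f g != 0])]].
apply: (@closed_subspace_full R (fibre G x) (nu x) (@fibre_hausdorff x) _
    [set (f \o set_val : fibre G x -> R) | f in phi] S).
- by case: nu_haar.
- apply: restr_separates; first by move=> f [].
  move=> K U cK oU KU; have [f [cf f01 fK fU sf]] := Urysohn_compact R Gam_h Gam_lc cK oU KU.
  by exists f.
- apply: closure_closed_subspace => //.
    by exists (fun=> 0); [exact: Cc0 | exact: can_section0].
  move=> a _ _ r [f Cf <-] [h Ch <-] r0.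
  exists (can_section nu (fun g => a * f g + h g) x).
    by exists (fun g => a * f g + h g) => //; exact: Cc_lin.
  by rewrite can_section_lin // subrr hnormE seminorm0 //; exact: inner_semi.
- move=> _ [f [cf f01 sf] <-] _ r r0; exists (can_section nu (fun g => (f g)%:C%C) x).
    by exists (fun g => (f g)%:C%C) => //; exact: Cc_real.
  by rewrite subrr hnormE seminorm0 //; exact: inner_semi.
Qed.

(** The density argument again, now with the closure of rational combinations of the countable
    Urysohn family. *)
Lemma can_fib_separable x : is_separable (can_fib nu x).
Proof.
have hip := L2_inner_product (nu x).
have [phi [phiP phiS]] := countable_Urysohn R Gam_h Gam_lc Gam_sc.
pose psi n := can_section nu (fun g => (phi n g)%:C%C) x.
apply: (@rat_combination_separable R (can_fib nu x) psi) => u.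
pose S := [set v : can_fib nu x | forall e : R, 0 < e ->
  exists2 w, range (rat_combination psi) w & hnorm (v - w) < e].
suff : S u by [].
apply: (@closed_subspace_full R (fibre G x) (nu x) (@fibre_hausdorff x) _
    [set (f \o set_val : fibre G x -> R) | f in range phi] S).
- by case: nu_haar.
- apply: restr_separates; first by move=> _ [n _ <-]; case: (phiP n).
  move=> K U cK oU KU; have [n [fK fU]] := phiS K U cK oU KU.
  by exists (phi n) => //; exists n.
- exact: rat_combination_closure.
- move=> _ [_ [n _ <-] <-] _ r r0.
  exists (psi n); last by rewrite subrr hnormE seminorm0 //; exact: inner_semi.
  exists [:: (1, 0, n)] => //; rewrite /rat_combination big_seq1 /= rmorph1 rmorph0.
  by rewrite (_ : Complex 1 0 = 1) // scale1r.
Qed.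

Lemma can_section_in f : Cc f -> cansec (can_section nu f).
Proof.
move=> Cf x e e0; exists (can_section nu f); first by exists f.
apply: nearW => y; rewrite subrr hnormE seminorm0 ?ltW //.
exact/inner_semi/L2_inner_product.
Qed.

Lemma can_section_approx xi (x : M) (e : R) : cansec xi -> 0 < e ->
  exists2 f, Cc f & \forall y \near x, hnorm (xi y - can_section nu f y) <= e.
Proof. by move=> Hxi e0; have [_ [f Cf <-] Hf] := Hxi x e e0; exists f. Qed.

Lemma can_sections_hnorm_continuous xi : cansec xi ->
  continuous (fun x => hnorm (xi x)).
Proof.
move=> Hxi; apply: continuous_real_local_approx => x e e0.
have [f Cf Hf] := can_section_approx x Hxi e0.
exists (fun x => hnorm (can_section nu f x)); first exact: hnorm_can_section_continuous.
apply: filterS Hf => y; apply: le_trans.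
exact: (seminorm_dist (inner_semi (L2_inner_product (nu y)))).
Qed.

Lemma can_continuous_field : continuous_field cansec.
Proof.
split.
- by move=> x; exact: L2_hilbert.
- split.
    move=> x e e0; exists (can_section nu (fun=> 0)).
      by exists (fun=> 0) => //; exact: Cc0.
    apply: nearW => y; rewrite can_section0 subrr hnormE seminorm0 ?ltW //.
    exact/inner_semi/L2_inner_product.
  move=> a xi eta Hxi Heta x e e0.
  have n0 := normc_ge0 a.
  have d0 : 0 < e / 2 / (normc a + 1) by rewrite !divr_gt0 // ltr_pwDr.
  have [f Cf Hf] := can_section_approx x Hxi d0.
  have [h Ch Hh] := can_section_approx x Heta (divr_gt0 e0 (ltr0Sn R 1)).
  exists (can_section nu (fun g => a * f g + h g)).
    by exists (fun g => a * f g + h g) => //; exact: Cc_lin.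
  apply: filterS2 Hf Hh => y fy hy.
  have ys := inner_semi (L2_inner_product (nu y)).
  rewrite can_section_lin // opprD addrACA -scalerBr.
  rewrite (le_trans (seminormD ys _ _)) // seminormZ //.
  move: fy; rewrite ler_pdivlMr ?ltr_pwDr // hnormE => fy; rewrite hnormE in hy.
  exact: (weighted_sum_le (seminorm_ge0 _ _) fy hy).
- move=> x u e e0; have [f Cf Hf] := can_section_dense u e0.
  by exists (can_section nu f) => //; exact: can_section_in.
- exact: can_sections_hnorm_continuous.
- move=> zeta Hz x e e0; have e20 : 0 < e / 2 by rewrite divr_gt0.
  have [xi Hxi Hzx] := Hz x _ e20; have [f Cf Hf] := can_section_approx x Hxi e20.
  exists (can_section nu f); first by exists f.
  apply: filterS2 Hzx Hf => y zy fy.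
  have ys := inner_semi (L2_inner_product (nu y)).
  rewrite -(subrKA (xi y)) (le_trans (seminormD ys _ _)) // (splitr e).
  exact: lerD.
Qed.

End Fibres.

(** * The canonical frame *)

(** Partial sums are integrals over the finite unions [W n], whose indicators converge pointwise;
    |Re w| + |Im w| dominates. *)
Lemma cintegral_sigma_additive d (T : measurableType d) (R : realType)
    (mu : {measure set T -> \bar R}) (D : nat -> set T) (w : T -> R[i]) :
  (forall n, measurable (D n)) -> trivIset setT D -> cintegrable mu w ->
  (fun n => \sum_(k < n) cintegral mu (fun t => \1_(D k) t * w t)) @ \oo -->
    (cintegral mu (fun t => \1_(\bigcup_n D n) t * w t) : R[i]^o).
Proof.
move=> mD tD iw; have mw := cintegrable_measurable iw; have [i1 i2] := iw.
have ih : mu.-integrable setT (fun t => (`|Re (w t)| + `|Im (w t)|)%:E).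
  rewrite (_ : (fun t => _) = (fun t => `|(Re (w t))%:E| + `|(Im (w t))%:E|)%E) //.
  by apply: integrableD => //; exact: integrable_abse.
have mE E : measurable E -> cmeasurable (fun t => \1_E t * w t : R[i]).
  by move=> mE; apply: cmeasurableM => //; exact: cmeasurable_indic.
have hE E t : normc (\1_E t * w t : R[i]) <= `|Re (w t)| + `|Im (w t)|.
  rewrite indicE; case: (_ \in _); rewrite ?mul1r ?mul0r ?normc_leD //.
  by rewrite normc0 addr_ge0.
pose W n := \big[setU/set0]_(k < n) D k.
have mW n : measurable (W n) by apply: bigsetU_measurable.
have sumE n : \sum_(k < n) cintegral mu (fun t => \1_(D k) t * w t) =
    cintegral mu (fun t => \1_(W n) t * w t).
  elim: n => [|n IH].
    rewrite big_ord0 /W big_ord0 -[LHS](cintegral0 mu).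
    by apply: eq_cintegral => t; rewrite indic0 mul0r.
  rewrite big_ord_recr {}IH /=.
  have := cintegral_lin 1 (cintegrable_le (mE _ (mW n)) ih (hE _))
    (cintegrable_le (mE _ (mD n)) ih (hE _)); rewrite mul1r => <-.
  apply: eq_cintegral => t; rewrite mul1r -mulrDl; congr (_ * _).
  rewrite /W [in RHS]big_ord_recr /= -/(W n) !indicE in_setU.
  case: (boolP (t \in W n)) => tW /=; case: (boolP (t \in D n)) => tDn //=;
    rewrite ?addr0 ?add0r //.
  exfalso; move: tW; rewrite inE /W -bigcup_mkord => -[k /= kn Dk].
  have := tD k n I I; rewrite inE in tDn.
  by move=> /(_ (ex_intro _ t (conj Dk tDn))) E; rewrite E ltnn in kn.
rewrite (funext sumE).
apply: (cintegral_dominated (fun n => mE _ (mW n)) (mE _ (bigcupT_measurable _ mD)) _ ih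
  (fun n => hE (W n))).
move=> t; apply/(cvg_complexP (fun n => \1_(W n) t * w t)) => e e0.
have [[k _ Dk]|nt] := pselect ((\bigcup_n D n) t).
  exists k.+1 => // n /= kn; rewrite !indicE !mem_set ?subrr ?normc0 //.
    by rewrite /W -bigcup_mkord; exists k.
  by exists k.
apply: nearW => n; rewrite !indicE !memNset ?mul0r ?subrr ?normc0 //.
by rewrite /W -bigcup_mkord => -[k _ Dk]; apply: nt; exists k.
Qed.

Section CanonicalRepresentation.
Context (R : realType) (Gam M : ptopologicalType) (G : continuous_groupoid Gam M).
Variable nu : fibre_measures R G.
Hypothesis nu_haar : haar_system nu.

Lemma ltrans_measurable x y (a : arrow G x y) :
  measurable_fun setT (ltrans a : borel (fibre G x) -> borel (fibre G y)).
Proof.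
by apply: (@continuous_borel (fibre G x) (fibre G y) (ltrans a)); exact: ltrans_continuous.
Qed.

Lemma haar_transfer x y (a : arrow G x y) (A : set (borel (fibre G y))) :
  measurable A -> nu x (ltrans a @^-1` A) = nu y A.
Proof. by case: nu_haar => _ _ _ /(_ x y a A). Qed.

Definition translate x y (a : arrow G x y) (f : borel (fibre G x) -> R[i]) :
  borel (fibre G y) -> R[i] := fun g => f (ltrans (arrow_inv a) g).

Lemma translate_square_integrable x y (a : arrow G x y) f :
  square_integrable (nu x) f -> square_integrable (nu y) (translate a f).
Proof.
exact: (transfer_square_integrable (@ltrans_measurable _ _ (arrow_inv a)) (@haar_transfer _ _ (arrow_inv a))).
Qed.

Lemma translate_ae x y (a : arrow G x y) (P : fibre G x -> Prop) :
  {ae nu x, forall g, P g} -> {ae nu y, forall g, P (ltrans (arrow_inv a) g)}.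
Proof.
exact: (transfer_ae (@ltrans_measurable _ _ (arrow_inv a)) (@haar_transfer _ _ (arrow_inv a))).
Qed.

Lemma can_rep_ae x y (a : arrow G x y) (u : can_fib nu x) :
  {ae nu y, forall g, L2repr (can_rep a u) g = translate a (L2repr u) g}.
Proof.
by apply: L2class_repr_ae; apply: translate_square_integrable; exact: square_integrable_repr.
Qed.

(** Translation may be computed on any representative, because left invariance carries null sets to
    null sets. *)
Lemma can_rep_class x y (a : arrow G x y) f : square_integrable (nu x) f ->
  can_rep a (L2class (nu x) f) = L2class (nu y) (translate a f).
Proof.
move=> sf; apply: L2class_eq.
- by apply: translate_square_integrable; exact: square_integrable_repr.
- exact: translate_square_integrable.
- exact: (translate_ae a (L2class_repr_ae sf)).
Qed.

Lemma can_rep_comp x y z (a : arrow G y z) (b : arrow G x y) (u : can_fib nu x) :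
  can_rep (arrow_comp a b) u = can_rep a (can_rep b u).
Proof.
have su := square_integrable_repr u.
rewrite -[in LHS](L2class_repr u) -[in RHS](L2class_repr u).
rewrite !can_rep_class //; last exact: translate_square_integrable.
congr L2class; apply/funext => g; rewrite /translate.
by rewrite arrow_inv_comp ltrans_comp.
Qed.

Lemma can_rep_unit x (u : can_fib nu x) : can_rep (arrow_unit G x) u = u.
Proof.
have su := square_integrable_repr u.
rewrite -[in RHS](L2class_repr u) -[in LHS](L2class_repr u) can_rep_class //.
congr L2class; apply/funext => g; rewrite /translate.
by rewrite arrow_inv_unit ltrans_unit.
Qed.

Lemma can_repK x y (a : arrow G x y) : cancel (@can_rep R _ _ G nu x y a) (can_rep (arrow_inv a)).
Proof. by move=> u; rewrite -can_rep_comp arrow_compVl can_rep_unit. Qed.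

Lemma can_repVK x y (a : arrow G x y) : cancel (can_rep (arrow_inv a)) (@can_rep R _ _ G nu x y a).
Proof. by move=> u; rewrite -can_rep_comp arrow_compV can_rep_unit. Qed.

(** Substituting g by a^-1 g in the inner product, which preserves the Haar measures. *)
Lemma can_rep_adjoint x y (a : arrow G x y) :
  is_adjoint (@can_rep R _ _ G nu x y a) (can_rep (arrow_inv a)).
Proof.
move=> u v; have [mu _] := square_integrable_repr u; have [mv _] := square_integrable_repr v.
have mt x' y' (b : arrow G x' y') f : cmeasurable f -> cmeasurable (translate b f).
  by move=> mf; apply: cmeasurable_comp mf; exact: ltrans_measurable.
rewrite (dot_ae mv (mt _ _ a _ mu) (aeW _ (fun=> erefl)) (can_rep_ae a u)).
rewrite (dot_ae (mt _ _ (arrow_inv a) _ mv) mu (can_rep_ae (arrow_inv a) v) (aeW _ (fun=> erefl))).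
rewrite [RHS](transfer_cintegral (@ltrans_measurable _ _ (arrow_inv a))
  (@haar_transfer _ _ (arrow_inv a))); last first.
  by apply: cmeasurableM => //; apply: cmeasurable_conj; exact: mt.
by apply: eq_cintegral => g; rewrite /translate arrow_invK ltransVK.
Qed.

Lemma can_rep_linear x y (a : arrow G x y) (c : R[i]) (u v : can_fib nu x) :
  can_rep a (c *: u + v) = c *: can_rep a u + can_rep a v.
Proof.
apply: (adjoint_linear _ _ (@can_rep_adjoint x y a)); exact: L2_inner_product.
Qed.

Lemma can_rep_hnorm x y (a : arrow G x y) (u : can_fib nu x) :
  hnorm (can_rep a u) = hnorm u.
Proof. by rewrite /hnorm can_rep_adjoint can_repK. Qed.

Lemma can_rep_unitary x y (a : arrow G x y) : unitary (@can_rep R _ _ G nu x y a).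
Proof.
split; first split; first exact: can_rep_linear.
  by exists 1 => u; rewrite mul1r can_rep_hnorm.
exists (can_rep (arrow_inv a)); split.
- exact: can_rep_adjoint.
- exact: can_repK.
- exact: can_repVK.
Qed.

Lemma can_povm_ae x (D : set (borel (fibre G x))) (u : can_fib nu x) : measurable D ->
  {ae nu x, forall g, L2repr (can_povm D u) g = \1_D g * L2repr u g}.
Proof.
move=> mD; apply: L2class_repr_ae; apply: square_integrable_indic => //.
exact: square_integrable_repr.
Qed.

Lemma can_povm_class x (D : set (borel (fibre G x))) f : measurable D ->
  square_integrable (nu x) f ->
  can_povm D (L2class (nu x) f) = L2class (nu x) (fun g => \1_D g * f g).
Proof.
move=> mD sf; apply: L2class_eq.
- by apply: square_integrable_indic => //; exact: square_integrable_repr.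
- exact: square_integrable_indic.
- by apply: filterS (L2class_repr_ae sf) => g ->.
Qed.

Lemma can_povm_dot x (D : set (borel (fibre G x))) (u v : can_fib nu x) : measurable D ->
  dot u (can_povm D v) =
  cintegral (nu x) (fun g => \1_D g * (conjc (L2repr u g) * L2repr v g)).
Proof.
move=> mD; have [mu _] := square_integrable_repr u; have [mv _] := square_integrable_repr v.
have mDv : cmeasurable (fun g => \1_D g * L2repr v g : R[i]).
  by apply: cmeasurableM => //; exact: cmeasurable_indic.
rewrite (dot_ae mu mDv (aeW _ (fun=> erefl)) (can_povm_ae v mD)).
by apply: eq_cintegral => g; rewrite mulrCA.
Qed.

(** Indicators are real, hence self-adjoint, and equal to their squares. Linearity follows from
    self-adjointness by [adjoint_linear]. *)
Lemma can_povm_projection x (D : set (borel (fibre G x))) : measurable D ->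
  projection (@can_povm R _ _ G nu x D).
Proof.
move=> mD; have hip := L2_inner_product (nu x).
have adj : is_adjoint (@can_povm R _ _ G nu x D) (@can_povm R _ _ G nu x D).
  move=> u v; rewrite can_povm_dot // (formC (inner_semi hip)) can_povm_dot //.
  have su := square_integrable_repr u; have sv := square_integrable_repr v.
  rewrite -cintegral_conj.
    apply: eq_cintegral => g; rewrite !rmorphM /= conj_indic conjcK.
    by congr (_ * _); rewrite mulrC.
  under eq_fun do rewrite mulrCA.
  by apply: cintegrable_conjM => //; exact: square_integrable_indic.
have idem (u : can_fib nu x) : can_povm D (can_povm D u) = can_povm D u.
  have su := square_integrable_repr u; rewrite -[u]L2class_repr.
  rewrite !can_povm_class //; last exact: square_integrable_indic.
  congr L2class; apply/funext => g; rewrite mulrA indicE.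
  by case: (_ \in _); rewrite ?mulr1 ?mul0r.
have lin := adjoint_linear hip hip adj.
split => //; split => //; exists 1 => u; rewrite mul1r.
have su := square_integrable_repr u; have sDu := square_integrable_indic mD su.
rewrite -(@ler_pXn2r _ 2) ?nnegrE ?sqrtr_ge0 //.
rewrite (hnorm_ae (proj1 sDu) (can_povm_ae u mD)).
rewrite (hnorm_ae (proj1 su) (aeW _ (fun=> erefl))).
have /square_integrableP[_ i1] := su; have /square_integrableP[_ i2] := sDu.
apply: le_Rintegral => // g _.
rewrite csqnormM csqnorm_indic indicE; case: (_ \in _); rewrite ?mul1r //.
by rewrite mul0r csqnorm_ge0.
Qed.

Lemma can_povm_setT x (u : can_fib nu x) : can_povm setT u = u.
Proof.
rewrite -[RHS]L2class_repr; congr L2class; apply/funext => g.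
by rewrite indicE in_setT mul1r.
Qed.

Lemma can_povm_sigma_additive x (D : nat -> set (borel (fibre G x))) :
  (forall n, measurable (D n)) -> trivIset setT D -> forall u v : can_fib nu x,
  (fun n => \sum_(k < n) dot u (can_povm (D k) v) : R[i]^o) @ \oo -->
    (dot u (can_povm (\bigcup_n D n) v) : R[i]^o).
Proof.
move=> mD tD u v; rewrite (can_povm_dot u v (bigcupT_measurable _ mD)).
under eq_fun do under eq_bigr do rewrite can_povm_dot //.
apply: cintegral_sigma_additive => //.
by apply: cintegrable_conjM; exact: square_integrable_repr.
Qed.

(** The image of [D] under an arrow is its preimage under the inverse arrow, so both sides multiply
    by the same indicator. *)
Lemma can_covariant : covariant_povm (canonical_frame nu).
Proof.
move=> x y a; exists (can_rep (arrow_inv a)); first exact: can_rep_adjoint.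
move=> D mD; apply/funext => u /=.
have -> : ltrans a @` D = ltrans (arrow_inv a) @^-1` D.
  apply/seteqP; split => [_ [g Dg <-]|g Dg] /=; first by rewrite ltransK.
  by exists (ltrans (arrow_inv a) g) => //; rewrite ltransVK.
have mLD : measurable (ltrans (arrow_inv a) @^-1` D : set (borel (fibre G y))).
  by rewrite -[X in measurable X]setTI; apply: ltrans_measurable.
have su := square_integrable_repr u; rewrite -[u]L2class_repr.
have st := translate_square_integrable (arrow_inv a) su.
rewrite can_rep_class // can_povm_class // can_rep_class; last exact: square_integrable_indic.
rewrite can_povm_class //; congr L2class; apply/funext => g.
by rewrite /translate arrow_invK ltransVK !indicE.
Qed.

End CanonicalRepresentation.

(** * Continuity of the matrix coefficients of the representation *)

Section CoefficientContinuity.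
Context (R : realType) (Gam M : ptopologicalType) (G : continuous_groupoid Gam M).
Variable nu : fibre_measures R G.
Hypotheses (Gam_h : hausdorff_space Gam) (M_h : hausdorff_space M)
  (Gam_lc : locally_compact [set: Gam]) (nu_haar : haar_system nu).

Local Notation mulG := (Defs.comp G).
Local Notation invG := (Defs.inv G).

Lemma inv_comp_cvg (a g : Gam) : tgt G a = tgt G g ->
  (fun p : Gam * Gam => mulG (invG p.1) p.2)
    @ within [set p | tgt G p.1 = tgt G p.2] (nbhs (a, g)) --> mulG (invG a) g.
Proof.
move=> ag; have /subspace_continuousP := @Defs.comp_continuous _ _ G.
have ag' : src G (invG a) = tgt G g by rewrite Defs.src_inv.
move=> /(_ (invG a, g) ag') cG A /= /cG; rewrite /within /= => -[[U V] [/= Ua Vg] UV].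
have Ua' : nbhs a (invG @^-1` U) := @Defs.inv_continuous _ _ G a _ Ua.
exists (invG @^-1` U, V) => //= -[b h] /= [Ub Vh] bh.
by apply: (UV (invG b, h)) => //=; rewrite Defs.src_inv.
Qed.

(* Freezing the arrow at [a0] replaces the translate of [h] by a function that *)
(* does not depend on the arrow, at the price of a small error on [K].         *)
Lemma translate_freeze (K : set Gam) (h : Gam -> R[i]) (a0 : Gam) :
  compact K -> continuous (h : Gam -> R[i]^o) ->
  exists2 H : Gam -> R[i], continuous (H : Gam -> R[i]^o) &
    forall e : R, 0 < e -> \forall a \near a0, forall g, K g -> tgt G g = tgt G a ->
      normc (h (mulG (invG a) g) - H g) < e.
Proof.
move=> cK ch; pose C := K `&` [set g | tgt G g = tgt G a0].
have cC : compact C.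
  apply: subclosed_compact (cK) _; last by move=> g [].
  by apply: closedI; [exact: compact_closed | exact: fibre_closed].
have slice g : C g -> (fun g => h (mulG (invG a0) g)) @ within C (nbhs g) -->
    (h (mulG (invG a0) g) : R[i]^o).
  move=> [Kg tg]; apply: (@cvg_trans _ ((fun p : Gam * Gam => h (mulG (invG p.1) p.2) : R[i]^o)
      @ within [set p | tgt G p.1 = tgt G p.2] (nbhs (a0, g)))); last first.
    apply: (cvg_comp _ (h : Gam -> R[i]^o) (inv_comp_cvg (esym tg))); exact: ch.
  move=> A /=; rewrite /within /= /nbhs /= => -[[U V] [/= Ua Vg] UV].
  by apply: filterS Vg => g' Vg' [_ tg']; apply: (UV (a0, g')) => //=; split=> //; exact: nbhs_singleton.
have [H1 [cH1 EH1]] : exists g : Gam -> R, continuous g /\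
    (forall x, C x -> g x = Re (h (mulG (invG a0) x))).
  apply: Tietze_compact => //; apply/subspace_continuousP => g Cg.
  by have /(cvg_ReImP (fun g => h (mulG (invG a0) g)))[] := slice g Cg.
have [H2 [cH2 EH2]] : exists g : Gam -> R, continuous g /\
    (forall x, C x -> g x = Im (h (mulG (invG a0) x))).
  apply: Tietze_compact => //; apply/subspace_continuousP => g Cg.
  by have /(cvg_ReImP (fun g => h (mulG (invG a0) g)))[] := slice g Cg.
pose H g := Complex (H1 g) (H2 g).
have cH : continuous (H : Gam -> R[i]^o) by apply/continuous_complexP.
exists H => // e e0.
(* By compactness of [K] it suffices to prove the estimate jointly near (g, a0) for each [g] in
   [K]. *)
have /compact_near_coveringP := cK.
move=> /(_ _ (nbhs a0) (fun a g => tgt G g = tgt G a ->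
  normc (h (mulG (invG a) g) - H g) < e) _); apply => g Kg.
(* If the targets differ, disjoint neighbourhoods of them in [M] leave no nearby pair with equal
   targets, and the estimate is vacuous. Otherwise both functions agree at (a0, g) and continuity
   gives it. *)
have [tg|tg] := pselect (tgt G g = tgt G a0); last first.
  have [[U V] /= [Ug Va] UV] : exists2 UV : set M * set M,
      tgt G g \in UV.1 /\ tgt G a0 \in UV.2 &
      [/\ open UV.1, open UV.2 & UV.1 `&` UV.2 == set0].
    by have := M_h; rewrite open_hausdorff => /(_ (tgt G g) (tgt G a0)); apply; apply/eqP.
  case: UV => oU oV /eqP UV0; rewrite !inE in Ug Va.
  exists (tgt G @^-1` U, tgt G @^-1` V).
    by split; apply: Defs.tgt_continuous; exact: open_nbhs_nbhs.
  move=> [g' a] /= [Ug' Va'] E; exfalso.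
  by have : (U `&` V) (tgt G g') by [split => //; rewrite E]; rewrite UV0.
have EH : H g = h (mulG (invG a0) g).
  by rewrite /H EH1 ?EH2 //; case: (h _).
have hc : (fun p : Gam * Gam => h (mulG (invG p.1) p.2) - H p.2)
    @ within [set p | tgt G p.1 = tgt G p.2] (nbhs (a0, g)) --> (0 : R[i]^o).
  rewrite -[0](subrr (H g)).
  apply: cvg_complexB.
    rewrite EH.
    apply: (cvg_comp _ (h : Gam -> R[i]^o) (inv_comp_cvg (esym tg))); exact: ch.
  apply: cvg_within_filter.
  apply: (cvg_comp (@snd Gam Gam) (H : Gam -> R[i]^o)); first exact: cvg_snd.
  exact: cH.
move/(cvg_complexP (fun p : Gam * Gam => h (mulG (invG p.1) p.2) - H p.2)) : hc => /(_ e e0).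
rewrite /within /= => -[[U V] [/= Ua Vg] UV].
exists (V, U) => //= -[g' a] /= [Vg' Ua'] E.
by have := UV (a, g') (conj Ua' Vg') (esym E); rewrite /= sub0r normcN.
Qed.

Lemma Cc_normc (X : ptopologicalType) (f : X -> R[i]) : hausdorff_space X -> Cc f ->
  Cc (fun x => (normc (f x))%:C%C).
Proof.
move=> Xh [cf sf]; apply: (Cc_intro Xh _ sf); last first.
  by move=> x /Cc_out ->; rewrite normc0.
apply/continuous_complexP; split => [x|x] /=; last exact: cvg_cst.
rewrite (_ : (fun x => _) = Num.sqrt \o (fun x => csqnorm (f x))).
  by apply: continuous_comp; [exact: cvg_csqnorm (cf x) | exact: sqrt_continuous].
by apply/funext => y; exact: normc_sqrt.
Qed.

Lemma can_rep_dot (f h : Gam -> R[i]) (a : Gam) : Cc f -> Cc h ->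
  dot (can_section nu f (tgt G a)) (can_rep (arrow_of G a) (can_section nu h (src G a))) =
  cintegral (nu (tgt G a)) (fun g => conjc (f (set_val g)) * h (mulG (invG a) (set_val g))).
Proof.
move=> Cf Ch; have sh := Cc_square_integrable Gam_h M_h nu_haar (src G a) Ch.
rewrite can_rep_class // dot_class //; first exact: Cc_square_integrable.
exact: translate_square_integrable.
Qed.

(** After freezing, the coefficient becomes \int conj(f) H, a continuous function of the target by
    the Haar property. The error is at most a small constant times \int |f|, and this integral is
    itself continuous in the target, hence locally bounded. *)
Lemma can_coefficient_Cc (f h : Gam -> R[i]) : Cc f -> Cc h ->
  continuous ((fun a => dot (can_section nu f (tgt G a))
    (can_rep (arrow_of G a) (can_section nu h (src G a)))) : Gam -> R[i]^o).
Proof.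
move=> Cf Ch; apply: continuous_local_approx => a0 e e0.
have [H cH HH] := translate_freeze a0 (proj2 Cf) (proj1 Ch).
have Cphi : Cc (fun g => conjc (f g) * H g).
  apply: (Cc_intro Gam_h (K := closure [set x | f x != 0])).
  - by move=> g; exact: cvg_complexM (cvg_complex_conj (proj1 Cf g)) (cH g).
  - exact: (proj2 Cf).
  - by move=> g /Cc_out ->; rewrite rmorph0 mul0r.
have Cn := Cc_normc Gam_h Cf.
pose N x := Re (cintegral (nu x) (fun g => (normc (f (set_val g)))%:C%C)).
have cN : continuous N by have /continuous_complexP[] := haar_continuous nu_haar Cn.
have iN x : (nu x).-integrable setT (fun g => (normc (f (set_val g)))%:E).
  by have [] := Cc_cintegrable Gam_h M_h nu_haar x Cn.
have N0 x : 0 <= N x by apply: Rintegral_ge0 => g _; exact: normc_ge0.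
(* The 2 cancels the factor in [normc_cintegral_le], and N x0 + 1 bounds the integral of |f| over
   fibres near [x0]. *)
set x0 := tgt G a0; pose d := e / (2 * (N x0 + 1)).
have d0 : 0 < d by rewrite divr_gt0 // mulr_gt0 // ltr_wpDl.
exists (fun a => cintegral (nu (tgt G a)) (fun g => conjc (f (set_val g)) * H (set_val g))).
  apply: (cvg_comp (tgt G) ((fun x => cintegral (nu x)
    (fun g => conjc (f (set_val g)) * H (set_val g))) : M -> R[i]^o)).
    exact: tgt_continuous.
  exact: haar_continuous Cphi _.
have Nlt : \forall a \near a0, N (tgt G a) < N x0 + 1.
  have cNt : (N \o tgt G) @ a0 --> N x0.
    by apply: (cvg_comp (tgt G) N); [exact: tgt_continuous | exact: cN].
  by apply: (cvgr_lt _ cNt); rewrite ltrDl.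
apply: filterS2 Nlt (HH d d0) => a Na Ha; rewrite can_rep_dot //.
have Ih := cintegrable_conjM (Cc_square_integrable Gam_h M_h nu_haar (tgt G a) Cf)
  (translate_square_integrable nu_haar (arrow_of G a) (Cc_square_integrable Gam_h M_h nu_haar (src G a) Ch)).
have IH := Cc_cintegrable Gam_h M_h nu_haar (tgt G a) Cphi.
have Id := cintegrable_lin (-1) IH Ih.
rewrite (_ : _ - _ = cintegral (nu (tgt G a)) (fun g => -1 * (conjc (f (set_val g)) * H (set_val g)) +
  conjc (f (set_val g)) * h (mulG (invG a) (set_val g)))); last first.
  by rewrite (cintegral_lin (-1) IH Ih) mulN1r addrC.
apply: (le_trans (@normc_cintegral_le _ _ _ (nu (tgt G a)) _
  (fun g => d * normc (f (set_val g))) Id _ _)).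
- rewrite (_ : (fun g => _) = (fun g => d%:E * (normc (f (set_val g)))%:E)%E) //.
  exact: integrableZl.
- move=> g; rewrite mulN1r addrC -mulrBr normcM normc_conj mulrC.
  have [Kg|/Cc_out ->] := pselect (closure [set x | f x != 0] (set_val g)).
    rewrite ler_wpM2r ?normc_ge0 //; apply/ltW/Ha => //; exact: fibre_tgt.
  by rewrite normc0 !mulr0.
rewrite (@RintegralZl _ _ _ (nu (tgt G a)) setT (fun g => normc (f (set_val g))) d
  measurableT (iN (tgt G a))).
rewrite -[X in d * X]/(N (tgt G a)) /d.
have p0 : 0 < N x0 + 1 by rewrite ltr_wpDl.
rewrite mulrA (_ : 2 * (e / (2 * (N x0 + 1))) = e / (N x0 + 1)); last first.
  by field; rewrite gt_eqF.
by rewrite mulrAC ler_pdivrMr // ler_wpM2l // ltW.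
Qed.

(** The controlled quantity is the right-hand side of [dot_perturb]. Two base points are allowed
    because source and target of an arrow differ. *)
Lemma can_section_approx2 xi eta (x0 y0 : M) (e : R) :
  @can_sections R Gam M G nu xi -> @can_sections R Gam M G nu eta -> 0 < e ->
  exists f h : Gam -> R[i], [/\ Cc f, Cc h &
    exists U V : set M, [/\ nbhs x0 U, nbhs y0 V & forall x y, U x -> V y ->
      hnorm (xi x - can_section nu f x) * hnorm (eta y) +
      hnorm (can_section nu f x) * hnorm (eta y - can_section nu h y) <= e]].
Proof.
move=> Hxi Heta e0.
have cn zeta := @can_sections_hnorm_continuous R Gam M G nu Gam_h M_h nu_haar zeta.
(* In each of [A] and [B], one unit allows for the variation of the norm near the base point. The
   second unit in [A] covers the distance from [xi] to its approximant, kept at most 1 by the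
   minimum in [d10]. *)
pose A := hnorm (xi x0) + 2; pose B := hnorm (eta y0) + 1.
have A0 : 0 < A by rewrite ltr_wpDl // sqrtr_ge0.
have B0 : 0 < B by rewrite ltr_wpDl // sqrtr_ge0.
have d10 : 0 < Num.min 1 (e / (2 * B)) by rewrite lt_min ltr01 divr_gt0 // mulr_gt0.
have d20 : 0 < e / (2 * A) by rewrite divr_gt0 // mulr_gt0.
have [f Cf Hf] := can_section_approx x0 Hxi d10.
have [h Ch Hh] := can_section_approx y0 Heta d20.
have Bn : \forall y \near y0, hnorm (eta y) < B.
  by apply: (cvgr_lt _ (cn eta Heta y0)); rewrite ltrDl.
have An : \forall y \near x0, hnorm (xi y) < hnorm (xi x0) + 1.
  by apply: (cvgr_lt _ (cn xi Hxi x0)); rewrite ltrDl.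
exists f, h; split => //; do 2 eexists; split; [exact: filterI An Hf | exact: filterI Bn Hh |].
move=> x y [a1 a2] [a3 a4]; move: a2; rewrite le_min => /andP[a2 a2'].
have a5 : hnorm (can_section nu f x) <= A.
  have hs := inner_semi (L2_inner_product (nu x)).
  rewrite -[can_section _ _ _](subKr (xi x)) hnormE.
  rewrite (le_trans (seminormD hs _ _)) // (seminormN hs) -!hnormE /A (natrD _ 1 1) addrA.
  by rewrite lerD // ltW.
rewrite (splitr e) lerD //.
  rewrite (le_trans (ler_pM (sqrtr_ge0 _) (sqrtr_ge0 _) a2' (ltW a3))) //.
  by rewrite le_eqVlt; apply/orP; left; apply/eqP; field; rewrite gt_eqF.
rewrite (le_trans (ler_pM (sqrtr_ge0 _) (sqrtr_ge0 _) a5 a4)) //.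
by rewrite le_eqVlt; apply/orP; left; apply/eqP; field; rewrite gt_eqF.
Qed.

Lemma can_coefficient_continuous xi eta :
  @can_sections R Gam M G nu xi -> @can_sections R Gam M G nu eta ->
  continuous ((fun a => dot (xi (tgt G a)) (can_rep (arrow_of G a) (eta (src G a)))) : Gam -> R[i]^o).
Proof.
move=> Hxi Heta; apply: continuous_local_approx => a0 e e0.
have [f [h [Cf Ch [U [V [nU nV HUV]]]]]] := can_section_approx2 (tgt G a0) (src G a0) Hxi Heta e0.
exists (fun a => dot (can_section nu f (tgt G a))
  (can_rep (arrow_of G a) (can_section nu h (src G a)))).
  exact: (can_coefficient_Cc Cf Ch).
have nU' : nbhs a0 (tgt G @^-1` U) := @Defs.tgt_continuous _ _ G a0 _ nU.
have nV' : nbhs a0 (src G @^-1` V) := @Defs.src_continuous _ _ G a0 _ nV.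
apply: filterS2 nU' nV' => a Ua Va; apply: le_trans (HUV _ _ Ua Va).
have iso u : hnorm (can_rep (arrow_of G a) u : can_fib nu _) <= hnorm u by rewrite can_rep_hnorm.
exact: (dot_perturb (L2_inner_product _) (L2_inner_product _)
  (linear_opB (can_rep_linear nu_haar (arrow_of G a))) iso).
Qed.

Lemma can_unitary_representation : unitary_representation (canonical_frame nu).
Proof.
split.
- by move=> x y a; exact: can_rep_unitary.
- by move=> x y z a b; apply/funext => u; exact: can_rep_comp.
- by move=> x; apply/funext => u; exact: can_rep_unit.
- move=> xi eta Hxi Heta.
  exact: (@continuous_cmeasurable R Gam _ (can_coefficient_continuous Hxi Heta)).
Qed.

End CoefficientContinuity.

(** * Ultraweak continuity *)

Lemma trace_norm_comp (R : realType) (H K : innerSpace R) (A : H -> K) (U : K -> H) (c : R) :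
  is_hilbert H -> is_separable H -> is_inner_product K -> is_trace_norm A c ->
  (forall (a : R[i]) u v, U (a *: u + v) = a *: U u + U v) ->
  (forall u, hnorm (U u) = hnorm u) ->
  exists2 t : R[i], is_trace (fun u => U (A u)) t & normc t <= c.
Proof.
move=> hH sH hK Ac lU nU; have [y [z [Ayz yz]]] := trace_norm_nuclear hH sH hK Ac.
apply: (nuclear_trace hH (nuclear_repr_comp hK lU nU Ayz)) => n.
by under eq_bigr do rewrite nU.
Qed.

Section TraceContinuity.
Context (R : realType) (Gam M : ptopologicalType) (G : continuous_groupoid Gam M).
Variable nu : fibre_measures R G.
Hypotheses (Gam_h : hausdorff_space Gam) (M_h : hausdorff_space M)
  (Gam_lc : locally_compact [set: Gam]) (Gam_sc : @second_countable Gam)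
  (nu_haar : haar_system nu).

Lemma can_finite_rank_trace n (xi eta : 'I_n -> forall x, can_fib nu x) (a : Gam) :
  is_trace (fun u => can_rep (arrow_of G a) (@finite_rank_field R Gam M G (canonical_frame nu) n xi eta a u))
    (\sum_(j < n) dot (eta j (tgt G a)) (can_rep (arrow_of G a) (xi j (src G a)))).
Proof.
rewrite (_ : (fun u => _) = (fun u : can_fib nu (tgt G a) =>
    \sum_(j < n) dot (eta j (tgt G a)) u *: (can_rep (arrow_of G a) (xi j (src G a)) : can_fib nu (tgt G a)))).
  by apply: finite_rank_trace; exact: L2_hilbert.
by apply/funext => u; exact: (linear_op_sum (can_rep_linear nu_haar (arrow_of G a))).
Qed.

(** Replacing the test field by a finite-rank field changes the trace by at most the trace norm of
    the difference, uniformly near the given arrow, and for finite-rank fields the trace is a finite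
    sum of continuous coefficients. *)
Lemma can_uw_continuous : uw_continuous (canonical_frame nu).
Proof.
move=> chi [chi_tc chi_loc].
have hil x : is_hilbert (can_fib nu x) by exact: L2_hilbert.
have sep x : is_separable (can_fib nu x) by exact: can_fib_separable.
have lin a := can_rep_linear nu_haar (arrow_of G a).
have tr a (A : can_fib nu (tgt G a) -> can_fib nu (src G a)) c := @trace_norm_comp R _ _ A
  (can_rep (arrow_of G a)) c (hil _) (sep _) (proj1 (hil _)).
have /choice[tau tauP] : forall a, exists t,
    is_trace (fun u : can_fib nu (tgt G a) => can_rep (arrow_of G a) (chi a u) : can_fib nu (tgt G a)) t.
  move=> a; have [_ [c chi_c]] := chi_tc a.
  by have [t Ht _] := tr a _ c chi_c (lin a) (can_rep_hnorm nu_haar (arrow_of G a)); exists t.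
exists tau => //; apply: continuous_local_approx => a0 e e0.
have [V V0 HV] := chi_loc a0; have [n [xi [eta [S HF]]]] := HV e e0.
pose g a := \sum_(j < n) dot (eta j (tgt G a)) (can_rep (arrow_of G a) (xi j (src G a))).
exists g.
  rewrite /g; apply: cvg_complex_sum => j; have [Sxi Seta] := S j.
  exact: (can_coefficient_continuous Gam_h M_h Gam_lc nu_haar Seta Sxi).
apply: filterS V0 => a /HF[c ce Hc].
have [t Ht tc] := tr a _ c Hc (lin a) (can_rep_hnorm nu_haar (arrow_of G a)).
(* The bounded trace [t] of the difference is the difference of the traces, by uniqueness of
   traces. *)
have E : is_trace (fun u : can_fib nu (tgt G a) => can_rep (arrow_of G a)
    (chi a u - @finite_rank_field R Gam M G (canonical_frame nu) n xi eta a u)) (tau a - g a).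
  move: (is_traceB (proj1 (hil (tgt G a))) (tauP a) (@can_finite_rank_trace n xi eta a)).
  by congr is_trace; apply/funext => u; rewrite (linear_opB (lin a)).
by rewrite -(is_trace_unique (hil _) (sep _) Ht E) (le_trans tc).
Qed.

End TraceContinuity.

(** * Measurability of the POVM *)

Lemma cmeasurable_cvg d (T : measurableType d) (R : realType) (f_ : nat -> T -> R[i]) f :
  (forall n, cmeasurable (f_ n)) ->
  (forall x, (fun n => f_ n x) @ \oo --> (f x : R[i]^o)) -> cmeasurable f.
Proof.
move=> mf cf; split.
  apply: (@measurable_fun_cvg _ _ _ setT (fun n x => Re (f_ n x))); first by move=> n; have [] := mf n.
  by move=> x _; have /(cvg_ReImP (fun n => f_ n x))[] := cf x.
apply: (@measurable_fun_cvg _ _ _ setT (fun n x => Im (f_ n x))); first by move=> n; have [] := mf n.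
by move=> x _; have /(cvg_ReImP (fun n => f_ n x))[] := cf x.
Qed.

Section OpenIndicator.
Context (R : realType) (X : ptopologicalType).
Hypotheses (Xh : hausdorff_space X) (Xlc : locally_compact [set: X])
  (Xsc : @second_countable X).

(** The approximants are 1 - \prod_(i < n) (1 - h i), where [h i] is the i-th Urysohn function if it
    vanishes off [D], and 0 otherwise. For x in [D] some [h i] equals 1 at x, so the value is
    exactly 1 from then on. *)
Lemma open_indic_limit (D : set X) : open D ->
  exists chi : nat -> X -> R, [/\ forall n, continuous (chi n),
    forall n x, 0 <= chi n x <= 1 & forall x, \forall n \near \oo, chi n x = \1_D x].
Proof.
move=> oD; have [phi [phiP phiS]] := countable_Urysohn R Xh Xlc Xsc.
pose h n x := if `[< forall x, ~ D x -> phi n x = 0 >] then phi n x else 0.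
have ch n : continuous (h n).
  by rewrite /h; case: asboolP => _ x; [case: (phiP n) => + _ _; apply | exact: cvg_cst].
have h01 n x : 0 <= h n x <= 1.
  by rewrite /h; case: asboolP => _; [case: (phiP n) | rewrite lexx ler01].
have hD n x : ~ D x -> h n x = 0 by move=> nD; rewrite /h; case: asboolP => // ->.
pose E n x := \prod_(i < n) (1 - h i x).
have cE n : continuous (E n).
  elim: n => [|n IH].
    rewrite (_ : E 0 = fun=> 1); first by move=> x; exact: cvg_cst.
    by apply/funext => x; rewrite /E big_ord0.
  rewrite (_ : E n.+1 = fun x => E n x * (1 - h n x)).
    by move=> x; apply: cvgM; [exact: IH | apply: cvgB; [exact: cvg_cst | exact: ch]].
  by apply/funext => x; rewrite /E big_ord_recr.
have E01 n x : 0 <= E n x <= 1.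
  apply/andP; split.
    by apply: prodr_ge0 => i _; rewrite subr_ge0; case/andP: (h01 i x).
  apply: prodr_ile1 => i _.
  by rewrite subr_ge0 lerBlDr lerDl; have /andP[-> ->] := h01 i x.
exists (fun n x => 1 - E n x); split.
- by move=> n x; apply: cvgB; [exact: cvg_cst | exact: cE].
- by move=> n x; rewrite subr_ge0 lerBlDr lerDl; have /andP[-> ->] := E01 n x.
move=> x; rewrite indicE; have [Dx|nDx] := pselect (D x); last first.
  apply: nearW => n; rewrite memNset // /E big1 ?subrr // => i _.
  by rewrite hD // subr0.
have [n [n1 n0]] := phiS [set x] D (@compact_set1 _ x) oD (fun y yx => eq_ind_r D Dx yx).
exists n.+1 => // m /= nm; rewrite mem_set // /E (bigD1 (Ordinal nm)) //= /h.
case: asboolP => [_|[]]; last exact: n0.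
by rewrite n1 // subrr mul0r subr0.
Qed.

End OpenIndicator.

Section PovmMeasurability.
Context (R : realType) (Gam M : ptopologicalType) (G : continuous_groupoid Gam M).
Variable nu : fibre_measures R G.
Hypotheses (Gam_h : hausdorff_space Gam) (M_h : hausdorff_space M)
  (Gam_lc : locally_compact [set: Gam]) (Gam_sc : @second_countable Gam)
  (M_sc : @second_countable M) (nu_haar : haar_system nu).

Lemma haar_part_measurable (f : Gam -> R[i]) (D : set (borel Gam)) :
  Cc f -> measurable D ->
  cmeasurable (fun x : borel M => cintegral (nu x)
    (fun g : borel (fibre G x) => \1_D (set_val g) * f (set_val g))).
Proof.
move=> Cf; pose k (E : set (borel Gam)) (y : borel Gam) : R[i] := \1_E y * f y.
pose I E (x : borel M) := cintegral (nu x) (fun g : borel (fibre G x) => k E (set_val g)).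
pose P E := cmeasurable (I E).
have mk E : measurable E -> cmeasurable (k E).
  move=> mE; apply: cmeasurableM; first exact: cmeasurable_indic.
  exact: (@continuous_cmeasurable R Gam f (proj1 Cf)).
have kle E y : normc (k E y) <= normc (f y).
  by rewrite /k indicE; case: (_ \in _); rewrite ?mul1r // mul0r normc0 normc_ge0.
have mI E x : measurable E -> cintegrable (nu x)
    (fun g : borel (fibre G x) => k E (set_val g)).
  move=> mE; have [h ih fh] := Cc_dominated Gam_h M_h nu_haar x Cf.
  apply: (@cintegrable_le _ _ _ (nu x) (fun g => k E (set_val g)) h _ ih) => [|g].
    exact: (restr_cmeasurable G x (mk _ mE)).
  exact: le_trans (kle _ _) (fh g).
(* Continuous by the Haar property; complements are obtained by subtracting from this case. *)
have PT : P setT.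
  rewrite /P /I; apply: (@continuous_cmeasurable R M).
  rewrite (_ : (fun x => _) = (fun x => cintegral (nu x) (fun g => f (set_val g)))).
    exact: (haar_continuous nu_haar Cf).
  by apply/funext => x; apply: eq_cintegral => g; rewrite /k indicT mul1r.
apply: (@dynkin_induction _ (borel Gam) open P) => //.
- by move=> A B oA oB; exact: openI.
(* On open sets the integral is a pointwise limit of integrals of C_c functions, each continuous in
   [x]. *)
- move=> A oA; have [chi [cchi chi01 chiA]] := open_indic_limit R Gam_h Gam_lc Gam_sc oA.
  have Cchi n : Cc (fun g => (chi n g)%:C%C * f g).
    apply: (Cc_mulr Gam_h Cf); apply/continuous_complexP; split => //= x.
    exact: cvg_cst.
  apply: (@cmeasurable_cvg _ _ _ (fun n (x : borel M) => cintegral (nu x)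
      (fun g : borel (fibre G x) => (chi n (set_val g))%:C%C * f (set_val g)))).
    by move=> n; exact: (@continuous_cmeasurable R M _ (haar_continuous nu_haar (Cchi n))).
  move=> x; have [h ih fh] := Cc_dominated Gam_h M_h nu_haar x Cf.
  apply: (cintegral_dominated _ (restr_cmeasurable G x (mk _ (borel_open oA))) _ ih).
  + by move=> n; exact: (Cc_cmeasurable G x (Cchi n)).
  + move=> g; apply/(cvg_complexP (fun n => (chi n (set_val g))%:C%C * f (set_val g))) => e e0.
    apply: filterS (chiA (set_val g)) => n ->.
    rewrite /k (_ : (\1_A (set_val g))%:C%C = \1_A (set_val g)) ?subrr ?normc0 //.
    by rewrite !indicE; case: (_ \in _); rewrite ?rmorph1 ?rmorph0.
  + move=> n g; apply: le_trans (fh g); have /andP[c0 c1] := chi01 n (set_val g).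
    by rewrite normcM normc_real // ler_piMl ?normc_ge0.
- move=> A mA PA.
  rewrite /P (_ : I (~` A) = fun x => I setT x - I A x); first exact: cmeasurableB.
  apply/funext => x; rewrite [RHS]addrC -mulN1r.
  have := cintegral_lin (-1) (mI A x mA) (mI setT x measurableT); rewrite /I => <-.
  apply: eq_cintegral => g; rewrite /k !indicE in_setC in_setT mul1r.
  by case: (_ \in _); rewrite /= ?mul1r ?mul0r ?mulr0 ?add0r // mulN1r addNr.
- move=> A mA tA PA.
  apply: (@cmeasurable_cvg _ _ _ (fun n x => \sum_(j < n) I (A j) x)).
    elim=> [|n IH].
      by under eq_fun do rewrite big_ord0; exact: cmeasurable_cst.
    rewrite (_ : (fun x => _) = (fun x => \sum_(j < n) I (A j) x + I (A n) x)).
      exact: (cmeasurableD IH (PA n)).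
    by apply/funext => x; rewrite big_ord_recr.
  move=> x; pose B n : set (borel (fibre G x)) := set_val @^-1` A n.
  have mB n : measurable (B n).
    by rewrite -[B n]setTI; apply: set_val_measurable.
  have tB : trivIset setT B.
    by move=> i j _ _ [g [Ai Aj]]; apply: tA => //; exists (set_val g).
  have := cintegral_sigma_additive mB tB (Cc_cintegrable Gam_h M_h nu_haar x Cf).
  by rewrite /B -preimage_bigcup.
Qed.

Lemma can_measurable_povm : measurable_povm (canonical_frame nu).
Proof.
move=> D mD xi eta Hxi Heta.
have mD' x : measurable ([set g | D (set_val g)] : set (borel (fibre G x))).
  rewrite (_ : [set g | _] = set_val @^-1` D) // -[X in measurable X]setTI.
  exact: set_val_measurable.
have approx (x0 : M) (e : R) : 0 < e -> exists2 g : borel M -> R[i], cmeasurable g &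
    \forall x \near x0, normc (dot (xi x) (can_povm [set g : borel (fibre G x) | D (set_val g)] (eta x)) - g x) <= e.
  move=> e0; have [f [h [Cf Ch [U [V [nU nV HUV]]]]]] :=
    can_section_approx2 Gam_h M_h nu_haar x0 x0 Hxi Heta e0.
  have Cfh := Cc_conjM Gam_h Cf Ch.
  eexists; first exact: (haar_part_measurable Cfh mD).
  apply: filterS2 nU nV => x Ux Vx; apply: le_trans (HUV _ _ Ux Vx).
  have sf := Cc_square_integrable Gam_h M_h nu_haar x Cf.
  have sh := Cc_square_integrable Gam_h M_h nu_haar x Ch.
  have pP := @can_povm_projection R Gam M G nu x _ (mD' x).
  have HH : is_inner_product (can_fib nu x) := L2_inner_product (nu x).
  have [[lP _] _ _] := pP.
  have := dot_perturb HH HH (linear_opB lP) (projection_hnorm HH pP)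
    (xi x) (can_section nu f x) (eta x) (can_section nu h x).
  rewrite can_povm_class // dot_class //; last exact: square_integrable_indic.
  congr (normc (_ - _) <= _); apply: eq_cintegral => g.
  by rewrite mulrCA.
split; apply: (measurable_local_approx M_sc) => x e /(approx x)[g [mg1 mg2] Hg].
  exists (fun x => Re (g x)) => //; apply: filterS Hg => y; apply: le_trans.
  by rewrite -ReN -ReD; exact: ler_normRe.
exists (fun x => Im (g x)) => //; apply: filterS Hg => y; apply: le_trans.
by rewrite -ImN -ImD; exact: ler_normIm.
Qed.

End PovmMeasurability.

(** * Admissibility, sharpness and localizability *)

Section CanonicalFrameProperties.
Context (R : realType) (Gam M : ptopologicalType) (G : continuous_groupoid Gam M).
Variable nu : fibre_measures R G.

(** For almost every [x] the set s^-1(N) is null in the fibre, so multiplying by its indicator gives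
    the zero class. *)
Lemma can_mu_admissible (mu : {measure set (borel M) -> \bar R}) :
  source_compatible nu mu -> mu_admissible (canonical_frame nu) mu.
Proof.
apply: filterS => x /null_content_dominatesP dom N mN N0.
have src_m : measurable_fun setT ((fun g => src G (set_val g)) : borel (fibre G x) -> borel M).
  apply: (@continuous_borel (fibre G x) M) => g.
  apply: (cvg_comp (set_val : fibre G x -> Gam) (src G)); first exact: set_val_continuous.
  exact: Defs.src_continuous.
have mD : measurable ([set g | N (src G (set_val g))] : set (borel (fibre G x))).
  by rewrite -[X in measurable X]setTI; exact: src_m.
apply/funext => u; rewrite -[RHS](L2class0 (nu x)); apply: L2class_eq.
- by apply: square_integrable_indic => //; exact: square_integrable_repr.
- exact: square_integrable0.
exists [set g | N (src G (set_val g))]; split => //; first exact: dom.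
by move=> g /=; apply: contra_notP => Ng; rewrite indicE memNset // mul0r.
Qed.

Lemma can_normalized_povm x : normalized_povm (canonical_frame nu) x.
Proof.
split.
- move=> D mD; apply: (@projection_effect R (can_fib nu x)); first exact: L2_inner_product.
  exact: can_povm_projection.
- by apply/funext => u; exact: can_povm_setT.
- by move=> D mD tD u v; exact: can_povm_sigma_additive.
Qed.

Lemma can_sharp : sharp (canonical_frame nu).
Proof. by move=> x D mD; exact: can_povm_projection. Qed.

Lemma can_localizable : localizable (canonical_frame nu).
Proof.
move=> x D mD; apply: projection_opnorm; first exact: L2_inner_product.
exact: can_povm_projection.
Qed.

End CanonicalFrameProperties.

Theorem theorem4p41 (R : realType) (Gam M : ptopologicalType)
    (G : continuous_groupoid Gam M)
    (nu : fibre_measures R G) (mu : {measure set (borel M) -> \bar R})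
    (Gam_hausdorff : hausdorff_space Gam) (M_hausdorff : hausdorff_space M)
    (Gam_sc : @second_countable Gam) (M_sc : @second_countable M)
    (Gam_lc : locally_compact [set: Gam])
    (nu_haar : haar_system nu)
    (mu_radon : is_radon mu) (mu_sigma_finite : sigma_finite setT mu)
    (mu_quasi_invariant : quasi_invariant nu mu)
    (nu_source_compatible : source_compatible nu mu) :
  [/\ principal_frame (canonical_frame nu),
      [/\ sharp (canonical_frame nu), ideal_frame (canonical_frame nu) &
          localizable (canonical_frame nu)],
      mu_admissible (canonical_frame nu) mu,
      forall (nG nM : nat) (AG : set (chart R Gam nG)) (AM : set (chart R M nM)),
        lie_groupoid G AG AM -> lie_frame AG AM (canonical_frame nu) &
      forall (nG nM : nat) (AG : set (chart R Gam nG)) (AM : set (chart R M nM)),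
        bisection_admissible G AG AM mu ->
        bisection_admissible_frame AG AM (canonical_frame nu) mu].
Proof.
have frame_nu : principal_frame (canonical_frame nu).
  split; [split | | | exact: can_normalized_povm | split].
  - exact: can_continuous_field.
  - by move=> x; exact: can_fib_separable.
  - exact: can_unitary_representation.
  - exact: can_uw_continuous.
  - exact: can_measurable_povm.
  - exact: can_covariant.
(* The Lie and bisection clauses close here, since their conclusions unfold to their hypotheses. *)
split => //.
- split; [exact: can_sharp | split; [by [] | exact: can_sharp] | exact: can_localizable].
- exact: can_mu_admissible.
Qed.
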